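(* A (finite) maximal triangle-free graph $G$ satisfies property $\mathscr{D}_4$ if and only if $G$ is a blow-up of either an Andrásfai graph $\Gamma_k$ (for some $k\ge 1$) or a Vega graph $\Upsilon_i^{\mu\nu}$ (for some $i\ge 2$ and $\mu,\nu\in\{0,1\}$).
   Context: All graphs are finite and simple. A graph is maximal triangle-free if it contains no triangle but adding any new edge between two non-adjacent vertices creates a triangle. For a graph $H$, a blow-up of $H$ is any graph (up to isomorphism) obtained by replacing each vertex of $H$ by a non-empty independent set and each edge of $H$ by the complete bipartite graph between the corresponding sets, with no further edges. Property $\mathscr{D}_k$ ($k\in\mathbb N$): a graph $G$ has $\mathscr{D}_k$ if for every $m\in\{1,\dots,k\}$ and every sequence $x_1,\dots,x_{3m}$ of (not necessarily distinct) vertices of $G$ there is a vertex $y$ with $|\{i\in[3m]: x_iy\in E(G)\}|\ge m+1$. Andrásfai graph $\Gamma_k$ ($k\ge1$): vertex set $\mathbb Z/(3k-1)\mathbb Z$, with $ij$ an edge iff $i-j\in\{k,k+1,\dots,2k-1\}$ (mod $3k-1$). Vega graphs: for $i\ge2$, $\Upsilon_i^{00}$ has vertex set $\mathbb Z/(3i-1)\mathbb Z\cup\{a,b,c,u,v,w,x,y\}$. Its edges are: the edges of $\Gamma_i$ on $\mathbb Z/(3i-1)\mathbb Z$; the hexagon $av,vc,cu,ub,bw,wa$; all edges from $a$ and from $u$ to the ''red'' set $\{0,\dots,i-1\}$; all edges from $b$ and from $v$ to the ''green'' set $\{i,\dots,2i-1\}$; all edges from $c$ and from $w$ to the ''blue''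 set $\{2i,\dots,3i-2\}$; the edges $xa,xb,xc$, $yu,yv,yw$, and $xy$. Further $\Upsilon_i^{10}=\Upsilon_i^{00}-y$, $\Upsilon_i^{01}=\Upsilon_i^{00}-(2i-1)$, $\Upsilon_i^{11}=\Upsilon_i^{00}-\{y,2i-1\}$ (vertex deletions). *)

(* Defs.v *)
From mathcomp Require Import all_boot.
Set Implicit Arguments. Unset Strict Implicit. Unset Printing Implicit Defensive.

Section Graphs.
Variable T : finType.
Variable e : rel T.

Definition simple_graph : Prop := symmetric e /\ irreflexive e.

Definition triangle_free : Prop :=
  forall x y z : T, ~~ [&& e x y, e y z & e z x].

(* triangle-free, and adding any new edge xy (x <> y, x,y non-adjacent)
   creates a triangle, i.e. x and y have a common neighbour *)
Definition maximal_triangle_free : Prop :=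
  triangle_free /\
  forall x y : T, x != y -> ~~ e x y -> exists z : T, e x z && e z y.

Definition prop_D (k : nat) : Prop :=
  forall m : nat, 1 <= m <= k ->
  forall xs : 'I_(3 * m) -> T,
  exists y : T, m.+1 <= #|[pred j : 'I_(3 * m) | e (xs j) y]|.

End Graphs.

(* G = (T,e) is (isomorphic to) a blow-up of the induced subgraph H[S] of
   the host graph H = (U,h): the classes f^-1(u), u in S, are non-empty,
   and x ~ y in G iff f x ~ f y in H (so classes are independent because H
   is loopless, and edges of H become complete bipartite graphs). *)
Definition blowup_on (T U : finType) (e : rel T) (h : rel U) (S : {set U}) : Prop :=
  exists f : T -> U,
    [/\ forall x, f x \in S,
        forall u, u \in S -> exists x, f x = u
      & forall x y, e x y = h (f x) (f y)].

Definition blowup (T U : finType) (e : rel T) (h : rel U) : Prop :=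
  blowup_on e h setT.

Definition andrasfai_rel (k : nat) : rel 'I_(3 * k - 1) :=
  fun i j =>
    let d := (i + (3 * k - 1) - j) %% (3 * k - 1) in (k <= d) && (d <= 2 * k - 1).

Definition vega_a : 'I_8 := @Ordinal 8 0 isT.
Definition vega_b : 'I_8 := @Ordinal 8 1 isT.
Definition vega_c : 'I_8 := @Ordinal 8 2 isT.
Definition vega_u : 'I_8 := @Ordinal 8 3 isT.
Definition vega_v : 'I_8 := @Ordinal 8 4 isT.
Definition vega_w : 'I_8 := @Ordinal 8 5 isT.
Definition vega_x : 'I_8 := @Ordinal 8 6 isT.
Definition vega_y : 'I_8 := @Ordinal 8 7 isT.

Definition vega_vertex (i : nat) : finType := ('I_(3 * i - 1) + 'I_8)%type.

Definition is_red (i : nat) (p : 'I_(3 * i - 1)) : bool := p < i.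
Definition is_green (i : nat) (p : 'I_(3 * i - 1)) : bool := (i <= p) && (p <= 2 * i - 1).
Definition is_blue (i : nat) (p : 'I_(3 * i - 1)) : bool := (2 * i <= p) && (p <= 3 * i - 2).

(* one orientation of each edge of Upsilon_i^{00} *)
Definition vega_base (i : nat) (s t : vega_vertex i) : bool :=
  match s, t with
  | inl p, inl q => @andrasfai_rel i p q
  | inr q, inl p =>
      [|| ((q == vega_a) || (q == vega_u)) && is_red p,
          ((q == vega_b) || (q == vega_v)) && is_green p
        | ((q == vega_c) || (q == vega_w)) && is_blue p]
  | inr q, inr r =>
      [|| (q == vega_a) && (r == vega_v), (q == vega_v) && (r == vega_c),
          (q == vega_c) && (r == vega_u), (q == vega_u) && (r == vega_b),
          (q == vega_b) && (r == vega_w), (q == vega_w) && (r == vega_a),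
          (q == vega_x) && [|| r == vega_a, r == vega_b | r == vega_c],
          (q == vega_y) && [|| r == vega_u, r == vega_v | r == vega_w]
        | (q == vega_x) && (r == vega_y)]
  | inl _, inr _ => false
  end.

Definition vega_rel (i : nat) : rel (vega_vertex i) :=
  fun s t => vega_base s t || vega_base t s.

Definition vega_set (i : nat) (mu nu : bool) : {set vega_vertex i} :=
  [set z : vega_vertex i |
    match z with
    | inl p => ~~ (nu && (nat_of_ord p == 2 * i - 1))
    | inr q => ~~ (mu && (q == vega_y))
    end].

(* Main.v *)
(* Twins may be identified. Let the twin-free graph have property D_4.

   Suppose that there is no induced hexagon. Fix a vertex g0 with neighbourhood R, and let p be a non-neighbour of g0
   with as few neighbours in R as possible. Avoiding hexagons forces p to have a single neighbour r0 in R, and R,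
   G = N(r0) and the set B of all other vertices are independent.

   Suppose that there is an induced hexagon. Then D_4 yields a Groetzsch graph, and restricts how further vertices attach
   to it; this yields the letters a, b, c, u, v, w, x (and possibly y) of a Vega graph such that all other vertices fall
   into three independent classes: red, green and blue. These are finitely many local claims. Each of them is proved by a
   certificate, a tree of applications of D_1, ..., D_4 and of the fact that non-adjacent vertices have a common
   neighbour. The certificates were found by computer search; a verified checker evaluates them.

   In both cases the neighbourhoods that vertices of one class have in another class form a chain, and non-adjacent
   vertices from two classes have a common neighbour in the third one. Hence the vertices of each class are ordered by
   their number of neighbours in one other class, and these numbers are the coordinates of an Andrasfai graph.

   For the converse it suffices to find vertex weights such that every vertex sees more than a third of the total. *)

Require Import Defs.
From mathcomp Require Import all_boot zify.
Set Implicit Arguments. Unset Strict Implicit. Unset Printing Implicit Defensive.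

(** * Votes and certificates *)

(** Computation reaches only boundedly many vertices, whereas the index i of a Vega graph is
    unbounded. So the certificates prove local statements only, collected in [skeleton], and
    counting does the rest: degrees between colour classes are injective, hence the class sizes
    differ by at most one. Which classes are larger decides nu, and the presence of y decides mu.

    The hexagon case is divided by the occurrence of Upsilon_3^11. Where it occurs, the hexagon on
    a, b, c, u, v, w alone determines the kind of every vertex. Where it does not, only sixteen
    traces on the Groetzsch graph, which is Upsilon_2^11, remain possible, and two vertices are
    adjacent exactly when their traces are disjoint; the skeleton is then found by enumeration. *)

Lemma card_nth_count (T : Type) (x0 : T) (P : pred T) (s : seq T) (n : nat) :
  size s = n -> #|[pred j : 'I_n | P (nth x0 s j)]| = count P s.
Proof.
move=> sz; rewrite -sum1_card -sum1_count (big_nth x0) sz big_mkord.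
by apply: eq_bigl.
Qed.

Section Votes.
Variables (T : finType) (e : rel T).
Hypothesis e_sym : symmetric e.

Lemma prop_D_seq (k m : nat) (s : seq T) :
  prop_D e k -> 1 <= m <= k -> size s = 3 * m -> exists y, m < count (e^~ y) s.
Proof.
move=> De mk; case: s => [|x0 s'] sz.
  by move: mk; case: m sz => //= m; rewrite mulnS.
have [y Hy] := De m mk (fun j => nth x0 (x0 :: s') j).
by exists y; move: Hy; rewrite (card_nth_count x0 (e^~ y)).
Qed.

Lemma prop_D_weights (k m : nat) (phi : nat -> T) (ws : seq (nat * nat)) :
  prop_D e k -> 1 <= m <= k -> sumn (unzip2 ws) = 3 * m ->
  exists y, m < sumn [seq p.2 * e (phi p.1) y | p <- ws].
Proof.
move=> De mk sz.
have [|y Hy] := prop_D_seq (s := flatten [seq nseq p.2 (phi p.1) | p <- ws]) De mk.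
  by rewrite size_flatten /shape -map_comp -sz; congr sumn; apply: eq_map => p /=; rewrite size_nseq.
exists y; congr (_ < _): Hy; rewrite count_flatten -map_comp; congr sumn.
by apply: eq_map => p /=; rewrite count_nseq mulnC.
Qed.

Hypothesis e_mtf : maximal_triangle_free e.
Hypothesis e_D : prop_D e 4.

Lemma exists_nbr x : exists z, e x z.
Proof.
have [//|y] := prop_D_seq (m := 1) (s := [:: x; x; x]) e_D isT.
by rewrite /=; case H: (e x y) => // _; exists y.
Qed.

Lemma common_nbr x y : ~~ e x y -> exists2 z, e x z & e y z.
Proof.
move=> xy; have [<-|nxy] := eqVneq x y.
  by have [z xz] := exists_nbr x; exists z.
by have [z /andP[xz zy]] := e_mtf.2 x y nxy xy; exists z => //; rewrite e_sym.
Qed.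

Lemma no_triangle x y z : e x y -> e y z -> e x z -> False.
Proof. by move=> xy yz xz; have:= e_mtf.1 x y z; rewrite xy yz e_sym xz. Qed.

Lemma common_nbrN x y z : e x z -> e y z -> ~~ e x y.
Proof. by move=> xz yz; apply/negP=> xy; apply: (no_triangle xy yz). Qed.

End Votes.

(* A certificate refutes a configuration, that is, finitely many numbered vertices with some known edges and
   non-edges. The vertices added by its steps get the next free numbers:
   - [Conflict]: an edge is also a non-edge (vertices with a common neighbour are non-adjacent);
   - [Embedded k f]: the map [f] embeds the [k]-th of the [goals], graphs that end the search;
   - [Common i j t]: adds a common neighbour of the non-adjacent vertices [i], [j];
   - [Branch i j t1 t2]: either [i], [j] are adjacent or they have a common neighbour;
   - [Trace g v t]: adds all facts shared by those admissible [traces] of the vertex [v] on the copy [g] of the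
     Groetzsch graph that agree with what is known;
   - [Vote m ws cs]: property D_m for the multiset [ws] of vertex-multiplicity pairs gives a vertex adjacent to one of
     the sets listed in [cs].
   In the checker [if] replaces [&&] and [||] where [vm_compute] has to skip the second operand. *)
Inductive cert :=
| Conflict
| Embedded of nat & seq nat
| Common of nat & nat & cert
| Branch of nat & nat & cert & cert
| Trace of seq nat & nat & cert
| Vote of nat & seq (nat * nat) & seq (seq nat * cert).

Record conf := Conf { nverts : nat; edges : seq (nat * nat); nonedges : seq (nat * nat) }.

Definition haspair (s : seq (nat * nat)) i j := has (fun p => (p.1 == i) && (p.2 == j)) s.
Definition adj c i j := haspair (edges c) i j || haspair (edges c) j i.
Definition nadj c i j :=
  if [|| haspair (nonedges c) i j, haspair (nonedges c) j i | i == j] then true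
  else has (fun k => if adj c i k then adj c j k else false) (iota 0 (nverts c)).

Definition add_vertex c (s : seq nat) :=
  Conf (nverts c).+1 ([seq (nverts c, i) | i <- s] ++ edges c) (nonedges c).
Definition add_edge c i j := Conf (nverts c) ((i, j) :: edges c) (nonedges c).

(** A branch-and-bound search over the neighbours of the vertex [y] that the vote provides: [ch]
    collects the vertices assumed adjacent to [y], and [w] is their total multiplicity. A branch
    closes when [ch] contains a listed set, when the remaining multiplicities cannot lift [w] above
    [m], or when two adjacent vertices are chosen, since [y] would complete a triangle. *)
Fixpoint vote_cover c (sets : seq (seq nat)) m (ws : seq (nat * nat)) (ch : seq nat) w :=
  if has (all (mem ch)) sets then true else
  if ws is (v, k) :: ws' then
    if w + sumn (unzip2 ws) <= m then true else
    if vote_cover c sets m ws' ch w then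
      if has (adj c v) ch then true else vote_cover c sets m ws' (v :: ch) (w + k)
    else false
  else w <= m.

Definition known c v (g : seq nat) : seq (option bool) :=
  [seq if adj c v i then Some true else if nadj c v i then Some false else None | i <- g].
Definition compat (kn : seq (option bool)) (a : seq bool) :=
  all (fun p => if p.1 is Some b then b == p.2 else true) (zip kn a).
Definition forced (b : bool) (ts : seq (seq bool)) i := all (fun a => nth (~~ b) a i == b) ts.

(** The entry [nth None kn i] is read through [isSome], so only entries not yet known yield facts.
    The default in [forced] makes a missing entry count as a disagreement. *)
Definition add_facts c v g (kn : seq (option bool)) ts :=
  let fr b := [seq (v, nth 0 g i) | i <- iota 0 (size g) & ~~ nth None kn i && forced b ts i] in
  Conf (nverts c) (fr true ++ edges c) (fr false ++ nonedges c).

(* The pentagon is 0..4, the vertex 5 + i is joined to i - 1 and i + 1, and 10 is joined to 5..9. *)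
Definition groetzsch : seq (nat * nat) :=
  [:: (0,1);(5,1);(5,4);(5,10);(1,2);(6,2);(6,0);(6,10);(2,3);(7,3);(7,1);(7,10);
      (3,4);(8,4);(8,2);(8,10);(4,0);(9,0);(9,3);(9,10)].
Definition is_copy c g := all (fun p => adj c (nth 0 g p.1) (nth 0 g p.2)) groetzsch.
Arguments is_copy : simpl never.

Section Checker.
Variables (traces : seq (seq bool)) (goals : seq (seq (nat * nat))).

Fixpoint check (c : conf) (t : cert) : bool :=
  match t with
  | Conflict => has (fun p => nadj c p.1 p.2) (edges c)
  | Embedded k f => (k < size goals) && all (fun p => adj c (nth 0 f p.1) (nth 0 f p.2)) (nth [::] goals k)
  | Common i j t => [&& nadj c i j, i < nverts c, j < nverts c & check (add_vertex c [:: i; j]) t]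
  | Branch i j t1 t2 =>
      [&& i < nverts c, j < nverts c, if nadj c i j then true else check (add_edge c i j) t1
        & check (add_vertex c [:: i; j]) t2]
  | Trace g v t =>
      [&& v < nverts c, all (gtn (nverts c)) g, size g == 11,
          is_copy c g
        & let kn := known c v g in
          let ts := [seq a <- traces | compat kn a] in
          nilp ts || check (add_facts c v g (kn : seq (option bool)) ts) t]
  | Vote m ws cs =>
      [&& 0 < m, m <= 4, sumn (unzip2 ws) == 3 * m,
          all (all (gtn (nverts c))) (unzip1 cs),
          vote_cover c (unzip1 cs) m ws [::] 0
        & all (fun p => check (add_vertex c p.1) p.2) cs]
  end.

End Checker.

(** Only edges are preserved: [h] may identify vertices and may send non-edges to edges. Goals and
    copies of the Groetzsch graph are meant in this weak sense. *)
Definition maps (T : finType) (e : rel T) (P : seq (nat * nat)) (h : nat -> T) :=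
  all (fun p => e (h p.1) (h p.2)) P.

(** * Soundness of the checker *)

Section Sound.
Variables (T : finType) (e : rel T).
Hypotheses (e_sym : symmetric e) (e_irr : irreflexive e).
Hypothesis e_mtf : maximal_triangle_free e.
Hypothesis e_D : prop_D e 4.

(** The bounds keep the number [nverts c] out of every fact, so that [phi] can be redefined there
    when a vertex is added. *)
Definition models (c : conf) (phi : nat -> T) : Prop :=
  [/\ forall i j, adj c i j -> [/\ i < nverts c, j < nverts c & e (phi i) (phi j)]
    & forall i j, haspair (nonedges c) i j -> [/\ i < nverts c, j < nverts c & ~~ e (phi i) (phi j)]].

Lemma haspairP s i j : reflect ((i, j) \in s) (haspair s i j).
Proof.
apply: (iffP hasP) => [[[a b] Hab /= /andP[/eqP<- /eqP<-]] // | H].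
by exists (i, j); rewrite ?eqxx.
Qed.

Lemma models_nadj c phi i j : models c phi -> nadj c i j -> ~~ e (phi i) (phi j).
Proof.
move=> [HE HN]; rewrite /nadj -/(_ || _) => /orP[/or3P[/HN[] // | /HN[_ _] | /eqP->] | /hasP[k _ /andP[/HE[_ _ ik] /HE[_ _ jk]]]].
- by rewrite e_sym.
- by rewrite e_irr.
exact: (common_nbrN e_sym e_mtf ik jk).
Qed.

Lemma models_add_vertex c phi s z :
  models c phi -> all (gtn (nverts c)) s -> all (fun i => e (phi i) z) s ->
  models (add_vertex c s) (fun k => if k == nverts c then z else phi k).
Proof.
move=> [HE HN] /allP Hs /allP Hz.
have old i : i < nverts c -> (if i == nverts c then z else phi i) = phi i.
  by move=> io; rewrite ifN // neq_ltn io.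
have new i j : (i, j) \in [seq (nverts c, i) | i <- s] ->
    [/\ i = nverts c, j < nverts c & e (phi j) z].
  by case/mapP=> k ks [-> ->]; split=> //; [apply: Hs | apply: Hz].
split=> i j /=; last first.
  by case/HN=> io jo ij; rewrite !old // !ltnS (ltnW io) (ltnW jo).
rewrite /adj /= => /orP[] /haspairP; rewrite mem_cat => /orP[/new[-> jo jz] | ].
- by rewrite eqxx old // !ltnS leqnn (ltnW jo) e_sym.
- move/haspairP=> H; have [|io jo ij] := HE i j; first by rewrite /adj H.
  by rewrite !old // !ltnS (ltnW io) (ltnW jo).
- by rewrite eqxx old // !ltnS leqnn ltnW.
move/haspairP=> H; have [|io jo ij] := HE i j; first by rewrite /adj H orbT.
by rewrite !old // !ltnS (ltnW io) (ltnW jo).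
Qed.

Lemma models_add_edge c phi i j :
  models c phi -> i < nverts c -> j < nverts c -> e (phi i) (phi j) ->
  models (add_edge c i j) phi.
Proof.
move=> [HE HN] io jo ij; split=> //= a b; rewrite /adj /=.
case/orP=> /orP[/andP[/eqP<- /eqP<-] | H]; rewrite ?io ?jo ?ij ?(e_sym (phi j)) ?ij //.
  by apply: HE; rewrite /adj H.
by apply: HE; rewrite /adj H orbT.
Qed.

(** Along the choices that [y] actually makes, the search can close neither by weight nor by a
    triangle, so it ends at a listed set. *)
Lemma vote_cover_sound c phi sets m ws ch w y :
  models c phi -> vote_cover c sets m ws ch w ->
  all (fun i => e (phi i) y) ch -> m < w + sumn [seq p.2 * e (phi p.1) y | p <- ws] ->
  exists2 s, s \in sets & all (fun i => e (phi i) y) s.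
Proof.
move=> Hc; elim: ws ch w => [|[v k] ws IH] ch w /=.
  case/orP=> [/hasP[s sS /allP sch] /allP Hch _ | wm _]; last by rewrite addn0 ltnNge wm.
  by exists s => //; apply/allP=> i /sch; apply: Hch.
case/orP=> [/hasP[s sS /allP sch] /allP Hch _ | ].
  by exists s => //; apply/allP=> i /sch; apply: Hch.
case/orP=> [small _ big | /andP[out inn] Hch].
  have: sumn [seq p.2 * e (phi p.1) y | p <- (v, k) :: ws] <= sumn (unzip2 ((v, k) :: ws)).
    by elim: (_ :: _) => //= p s IHs; apply: leq_add => //; case: (e _ _); rewrite ?muln1 ?muln0.
  rewrite -(leq_add2l w) => /(leq_trans big)/leq_trans/(_ small).
  by rewrite ltnn.
case vy: (e (phi v) y); last by rewrite muln0 add0n; apply: (IH _ _ out Hch).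
rewrite muln1 addnA; case/orP: inn => [/hasP[u uch vu] | ].
  have /allP/(_ u uch) uy := Hch; have [_ _ vu'] := Hc.1 _ _ vu.
  by case: (no_triangle e_sym e_mtf vu' uy vy).
by move=> /IH H; apply: H; rewrite /= vy.
Qed.

Variables (traces : seq (seq bool)) (goals : seq (seq (nat * nat))).
Hypothesis e_traces : forall h, maps e groetzsch h ->
  forall v, [seq e v (h i) | i <- iota 0 11] \in traces.

Definition reached := exists2 P, P \in goals & exists h, maps e P h.

Lemma compat_known c phi v g :
  models c phi -> compat (known c v g) [seq e (phi v) (phi i) | i <- g].
Proof.
move=> Hc; elim: g => // i g IH; rewrite /compat /= -/(compat (known c v g) _) IH andbT.
case vi: (adj c v i); first by have [_ _ ->] := Hc.1 _ _ vi.
by case: ifP => // /(models_nadj Hc)/negPf->.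
Qed.

Lemma models_add_facts c phi v g kn ts :
  models c phi -> v < nverts c -> all (gtn (nverts c)) g ->
  [seq e (phi v) (phi i) | i <- g] \in ts -> models (add_facts c v g kn ts) phi.
Proof.
move=> [HE HN] vo /allP go Hts.
have fr (b : bool) i j :
    (i, j) \in [seq (v, nth 0 g i) | i <- iota 0 (size g) & ~~ nth None kn i && forced b ts i] ->
    [/\ i = v, j < nverts c & e (phi v) (phi j) = b].
  case/mapP=> k; rewrite mem_filter mem_iota add0n => /andP[/andP[_ /allP Ha] /andP[_ kg]] [-> ->].
  have /eqP Hb := Ha _ Hts.
  by split=> //; [exact/go/mem_nth | rewrite -[RHS]Hb (nth_map 0)].
split=> i j /=.
  rewrite /adj /= => /orP[] /haspairP; rewrite mem_cat => /orP[/fr[-> jo ij] | /haspairP H].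
  - by rewrite vo jo ij.
  - by apply: HE; rewrite /adj H.
  - by rewrite vo jo e_sym ij.
  by apply: HE; rewrite /adj H orbT.
by move/haspairP; rewrite mem_cat => /orP[/fr[-> jo ->] | /haspairP/HN].
Qed.

(** An explicit fixpoint, because the certificates of a vote sit inside a list, which the generated
    induction principle does not enter. The conclusion does not mention [phi], so each step may pass
    to an extended assignment. *)
Fixpoint check_sound (t : cert) : forall c phi, models c phi -> check traces goals c t -> reached.
Proof.
case: t => [|k f|i j t|i j t1 t2|g v t|m ws cs] c phi Hc /=.
- case/hasP=> p pc /(models_nadj Hc)/negP[].
  by have [] := Hc.1 p.1 p.2 => //; rewrite /adj; apply/orP; left; apply/haspairP; case: p pc.
- case/andP=> kg /allP H; exists (nth [::] goals k); first exact: mem_nth.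
  by exists (fun i => phi (nth 0 f i)); apply/allP=> p /H/(Hc.1 _ _)[].
- case/and4P=> ij io jo H.
  have [z iz jz] := common_nbr e_sym e_mtf e_D (models_nadj Hc ij).
  apply: (check_sound t _ _ _ H); first apply: (models_add_vertex (z := z) Hc).
    by rewrite /= io jo.
  by rewrite /= iz jz.
- case/and4P=> io jo H1 H2.
  case ij: (e (phi i) (phi j)).
    case/orP: H1 => [/(models_nadj Hc) | H1]; first by rewrite ij.
    exact: (check_sound t1 _ _ (models_add_edge Hc io jo ij) H1).
  have [z iz jz] := common_nbr e_sym e_mtf e_D (negbT ij).
  apply: (check_sound t2 _ _ _ H2); first apply: (models_add_vertex (z := z) Hc).
    by rewrite /= io jo.
  by rewrite /= iz jz.
- case/and5P=> vo go /eqP sg /allP gg H.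
  have Ht: [seq e (phi v) (phi i) | i <- g] \in traces.
    have := @e_traces (fun i => phi (nth 0 g i)) _ (phi v).
    have ->: [seq e (phi v) (phi (nth 0 g i)) | i <- iota 0 11] = [seq e (phi v) (phi i) | i <- g].
      by rewrite -{2}(mkseq_nth 0 g) sg /mkseq -map_comp.
    by apply; apply/allP=> p /gg/(Hc.1 _ _)[].
  have Hts: [seq e (phi v) (phi i) | i <- g] \in [seq a <- traces | compat (known c v g) a].
    by rewrite mem_filter compat_known.
  case/orP: H => [/nilP Hn | H]; first by rewrite Hn in Hts.
  exact: (check_sound t _ _ (models_add_facts _ Hc vo go Hts) H).
case/and5P=> m0 m4 /eqP sw /allP Hlt /andP[Hcov].
have [|y Hy] := prop_D_weights phi e_D _ sw; first by rewrite m0.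
have [s sS Hs] := vote_cover_sound (y := y) Hc Hcov isT Hy.
have {Hcov Hlt} ltS := Hlt s sS.
elim: cs sS => //= [[s' t] cs IH]; rewrite inE => /orP[/eqP ss|sS] /andP[H1 H2]; last exact: IH.
rewrite -{}ss in H1.
exact: (check_sound t _ _ (models_add_vertex Hc ltS Hs) H1).
Qed.

End Sound.

(** * Traces on the Groetzsch graph *)

(** Splits the trace [a] of [v] on the vertices from [off] onwards into its edges ([b = true]) and
    its non-edges ([b = false]), as a configuration stores them. *)
Definition att (b : bool) v off (a : seq bool) : seq (nat * nat) :=
  [seq (v, off + j) | j <- iota 0 (size a) & nth false a j == b].

Definition relabel (s : seq nat) (a : seq bool) := [seq nth false a i | i <- s].
Definition mask_of (n : nat) (s : seq nat) : seq bool := [seq i \in s | i <- iota 0 n].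

(** The ten symmetries of the pentagon, acting in the same way on 5..9 and fixing 10; adding 5 keeps
    the reflections free of truncated subtraction. One certificate settles a whole orbit of
    traces. *)
Definition dihedral : seq (seq nat) :=
  [seq [seq f i %% 5 | i <- iota 0 5] ++ [seq 5 + f i %% 5 | i <- iota 0 5] ++ [:: 10]
     | f <- [seq addn k | k <- iota 0 5] ++ [seq subn (5 + k) | k <- iota 0 5]].

Definition surviving (A : seq (seq bool)) (t : seq nat) :=
  [seq a <- A | ~~ has (fun s => relabel s a == mask_of 11 t) dihedral].

Definition trace_conf (t : seq nat) :=
  let a := mask_of 11 t in Conf 12 (att true 11 0 a ++ groetzsch) (att false 11 0 a).

(** The pair 11, 12 is entered as a non-edge, so refuting this configuration forces adjacency. *)
Definition pair_conf (t1 t2 : seq nat) :=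
  let a := mask_of 11 t1 in let b := mask_of 11 t2 in
  Conf 13 (att true 11 0 a ++ att true 12 0 b ++ groetzsch)
          ((11, 12) :: att false 11 0 a ++ att false 12 0 b).

Fixpoint check_steps goals A (steps : seq (seq nat * cert)) :=
  if steps is (t, c) :: steps' then
    check A goals (trace_conf t) c && check_steps goals (surviving A t) steps'
  else true.

Definition bseqs n : seq (seq bool) :=
  iter n (fun l => [seq b :: s | b <- [:: true; false], s <- l]) [:: [::]].

Definition indep_mask (P : seq (nat * nat)) (a : seq bool) :=
  all (fun p => ~~ (nth false a p.1 && nth false a p.2)) P.

(** Meant for lists of certificates, which carry no decidable equality; hence the witness comes
    without its membership in [s]. *)
Lemma has_exists (S : Type) (P : pred S) (s : seq S) : has P s -> exists x, P x.
Proof. by elim: s => //= x s IH /orP[]; [exists x | apply: IH]. Qed.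

Lemma mem_bseqs (a : seq bool) : a \in bseqs (size a).
Proof.
elim: a => //= b a IH; rewrite -/(bseqs _) cats0 mem_cat.
  by case: b; rewrite map_f ?orbT.
Qed.

Section Traces.
Variables (T : finType) (e : rel T).
Hypotheses (e_sym : symmetric e) (e_irr : irreflexive e).
Hypothesis e_mtf : maximal_triangle_free e.
Hypothesis e_D : prop_D e 4.

Definition trace (n : nat) (h : nat -> T) (v : T) : seq bool := [seq e v (h i) | i <- iota 0 n].
Definition traces_ok (A : seq (seq bool)) :=
  forall h, maps e groetzsch h -> forall v, trace 11 h v \in A.

Lemma size_trace n h v : size (trace n h v) = n.
Proof. by rewrite size_map size_iota. Qed.

Lemma nth_trace n h v i : i < n -> nth false (trace n h v) i = e v (h i).
Proof. by move=> ni; rewrite (nth_map 0) ?size_iota // nth_iota. Qed.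

Definition fact (b : bool) (n : nat) (phi : nat -> T) (p : nat * nat) :=
  [&& p.1 < n, p.2 < n & e (phi p.1) (phi p.2) == b].

Lemma models_intro n E N phi :
  all (fact true n phi) E -> all (fact false n phi) N -> models e (Conf n E N) phi.
Proof.
move=> /allP HE /allP HN; split=> i j.
  by case/orP=> /haspairP/HE/and3P[/= -> -> /eqP]; rewrite // e_sym.
by move/haspairP/HN/and3P=> [/= -> -> /eqP->].
Qed.

Lemma facts_att b n phi v off a :
  v < n -> off + size a <= n -> a = [seq e (phi v) (phi (off + i)) | i <- iota 0 (size a)] ->
  all (fact b n phi) (att b v off a).
Proof.
move=> vn on Ha; apply/allP=> _ /mapP[j + ->]; rewrite mem_filter mem_iota add0n.
case/andP=> jb /andP[_ ja]; rewrite /fact /= vn (leq_trans _ on) ?ltn_add2l //=.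
by move: jb; rewrite {1}Ha (nth_map 0) ?size_iota // nth_iota.
Qed.

Lemma facts_pattern n P phi h :
  all (fun p => (p.1 < n) && (p.2 < n)) P -> (forall k, k < n -> phi k = h k) ->
  maps e P h -> forall N, n <= N -> all (fact true N phi) P.
Proof.
move=> /allP Pn phih /allP Hh N nN; apply/allP=> p pP.
have /andP[p1 p2] := Pn p pP.
by rewrite /fact !(leq_trans _ nN) //= !phih // Hh.
Qed.

Lemma reachedN0 : ~ reached e [::].
Proof. by case. Qed.

Lemma traces_ok_start : traces_ok [seq a <- bseqs 11 | indep_mask groetzsch a].
Proof.
move=> h hh v; rewrite mem_filter -{3}(size_trace 11 h v) mem_bseqs andbT.
apply/allP=> p pg; have /andP[p1 p2] : (p.1 < 11) && (p.2 < 11).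
  by apply: (allP (_ : all (fun p => (p.1 < 11) && (p.2 < 11)) groetzsch)) pg.
rewrite !nth_trace //; apply/negP=> /andP[v1 v2].
by apply: (no_triangle e_sym e_mtf v1 _ v2); move/allP: hh; apply.
Qed.

Lemma maps_dihedral s h : s \in dihedral -> maps e groetzsch h ->
  maps e groetzsch (fun i => h (nth 0 s i)).
Proof.
move=> sd /allP hh.
have /allP/(_ s sd)/allP Hs : all (fun s => all (fun p =>
    ((nth 0 s p.1, nth 0 s p.2) \in groetzsch) || ((nth 0 s p.2, nth 0 s p.1) \in groetzsch))
    groetzsch) dihedral by vm_compute.
by apply/allP=> p /Hs/orP[] /hh; rewrite // e_sym.
Qed.

Lemma trace_dihedral s h v : s \in dihedral ->
  trace 11 (fun i => h (nth 0 s i)) v = relabel s (trace 11 h v).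
Proof.
move=> sd.
have /allP/(_ s sd)/andP[/eqP sz /allP s11] :
  all (fun s => (size s == 11) && all (gtn 11) s) dihedral by vm_compute.
rewrite /relabel -{2}(mkseq_nth 0 s) sz /mkseq -map_comp {1}/trace.
apply/eq_in_map=> i; rewrite mem_iota => /andP[_ i11] /=.
by rewrite nth_trace //; apply: s11; rewrite mem_nth ?sz.
Qed.

Variables (goals : seq (seq (nat * nat))).
Hypothesis unreached : ~ reached e goals.

(** If a trace in the orbit of [t] occurred, relabelling the copy by the symmetry would turn it into
    [t] itself, which the certificate excludes. *)
Lemma surviving_ok A t c :
  check A goals (trace_conf t) c -> traces_ok A -> traces_ok (surviving A t).
Proof.
move=> chk HA h hh v; rewrite mem_filter HA // andbT; apply/negP=> /hasP[s sd /eqP Hs].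
have hs := maps_dihedral sd hh; rewrite -(trace_dihedral h v sd) in Hs.
set g := fun i => h _ in Hs hs.
pose phi k := if k < 11 then g k else v.
apply: unreached; apply: (check_sound e_sym e_irr e_mtf e_D HA (phi := phi) _ chk).
have Ht : mask_of 11 t = [seq e (phi 11) (phi (0 + i)) | i <- iota 0 (size (mask_of 11 t))].
  rewrite -Hs size_trace; apply/eq_in_map=> i; rewrite mem_iota => /andP[_ i11].
  by rewrite /phi ltnn i11.
have sz : 0 + size (mask_of 11 t) <= 12 by rewrite size_map.
apply: models_intro; last exact: facts_att.
rewrite all_cat; apply/andP; split; first exact: facts_att.
by apply: (facts_pattern (n := 11) (h := g)) => // k k11; rewrite /phi k11.
Qed.

Lemma check_steps_ok A steps : check_steps goals A steps -> traces_ok A ->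
  traces_ok (foldl surviving A (unzip1 steps)).
Proof.
elim: steps A => //= [[t c] steps IH] A /andP[H1 H2] HA.
exact: IH H2 (surviving_ok H1 HA).
Qed.

Lemma pair_refuted A t1 t2 c h p q :
  check A goals (pair_conf t1 t2) c -> traces_ok A -> maps e groetzsch h ->
  trace 11 h p = mask_of 11 t1 -> trace 11 h q = mask_of 11 t2 -> e p q.
Proof.
move=> chk HA hh Hp Hq; apply/negPn/negP=> npq.
pose phi k := if k < 11 then h k else if k == 11 then p else q.
apply: unreached; apply: (check_sound e_sym e_irr e_mtf e_D HA (phi := phi) _ chk).
have Ht v w t : phi v = w -> trace 11 h w = mask_of 11 t ->
    mask_of 11 t = [seq e (phi v) (phi (0 + i)) | i <- iota 0 (size (mask_of 11 t))].
  move=> -> <-; rewrite size_trace; apply/eq_in_map=> i; rewrite mem_iota => /andP[_ i11].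
  by rewrite /phi i11.
have sz t : 0 + size (mask_of 11 t) <= 13 by rewrite size_map.
have f1 b : all (fact b 13 phi) (att b 11 0 (mask_of 11 t1)) by apply: facts_att => //; apply: Ht Hp.
have f2 b : all (fact b 13 phi) (att b 12 0 (mask_of 11 t2)) by apply: facts_att => //; apply: Ht Hq.
apply: models_intro; last by rewrite /= all_cat f1 f2 /fact /= (negPf npq).
rewrite !all_cat f1 f2.
by apply: (facts_pattern (n := 11) (h := h)) => // k k11; rewrite /phi k11.
Qed.

End Traces.

(** * The certificates *)

(* The traces refuted earlier in the list are inadmissible for the later certificates. *)
Definition trace_steps : seq (seq nat * cert) :=
  [:: ([:: 5; 6], (Common 11 8 (Vote 4 [:: (0,1); (1,1); (2,1); (3,1); (4,1); (5,1); (6,1); (7,1); (8,1);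
      (10,1); (11,1); (12,1)] [:: ([:: 0; 2; 5; 12], (Vote 4 [:: (0,1); (2,1); (3,1); (4,1); (5,1); (6,1); (8,1);
      (9,1); (10,1); (11,1); (12,1); (13,1)] [::]))])));
      ([:: 3; 5; 6], (Common 11 8 (Vote 4 [:: (0,1); (1,1); (2,1); (3,1); (4,1); (5,1); (6,1); (7,1); (8,1);
      (10,1); (11,1); (12,1)] [:: ([:: 0; 2; 5; 12], (Vote 4 [:: (0,1); (2,1); (3,1); (4,1); (5,1); (6,1); (8,1);
      (9,1); (10,1); (11,1); (12,1); (13,1)] [::]))])));
      ([:: 5; 6; 7; 8], (Common 11 9 (Vote 4 [:: (0,1); (1,1); (2,1); (3,1); (4,1); (5,1); (6,1); (7,1); (9,1);
      (10,1); (11,1); (12,1)] [:: ([:: 0; 2; 7; 12], (Vote 4 [:: (0,1); (2,1); (3,1); (4,1); (6,1); (7,1); (8,1);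
      (9,1); (10,1); (11,1); (12,1); (13,1)] [::]))])));
      ([:: 5; 6; 7], (Common 11 8 (Vote 4 [:: (0,1); (1,1); (2,1); (3,1); (4,1); (5,1); (6,1); (8,1); (9,1);
      (10,1); (11,1); (12,1)] [:: ([:: 1; 4; 6; 12], (Vote 4 [:: (1,1); (2,1); (3,1); (4,1); (5,1); (6,1); (7,1);
      (8,1); (10,1); (11,1); (12,1); (13,1)] [::]))])));
      ([:: 2; 5], (Common 11 7 (Vote 4 [:: (0,1); (1,1); (2,1); (3,1); (4,1); (5,1); (7,1); (8,1); (9,1);
      (10,1); (11,1); (12,1)] [:: ([:: 0; 3; 5; 8; 12], (Vote 3 [:: (2,1); (3,1); (5,1); (6,1); (7,1); (10,1);
      (11,1); (12,1); (13,1)] [:: ([:: 3; 5; 6; 12], (Trace [:: 0; 1; 5; 10; 6; 2; 13; 7; 14; 9; 3] 12 Conflict));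
      ([:: 6; 7; 11; 13], (Trace [:: 1; 2; 6; 10; 7; 3; 0; 8; 14; 5; 13] 11 Conflict))]))])));
      ([:: 5; 6; 8], (Vote 4 [:: (0,1); (1,1); (2,1); (3,2); (4,1); (5,1); (6,1); (7,1); (9,1); (10,1); (11,1)] [::
      ([:: 2; 4; 7; 9; 11], (Trace [:: 0; 1; 5; 10; 6; 2; 4; 7; 11; 9; 12] 3 Conflict)); ([:: 0; 3; 10; 11], (Trace
      [:: 0; 1; 2; 3; 4; 5; 6; 7; 8; 12; 10] 11 Conflict)); ([:: 1; 3; 10; 11], (Trace [:: 0; 1; 2; 3; 4; 5; 6; 12;
      8; 9; 10] 11 Conflict))]));
      ([:: 0; 2], (Common 11 5 (Common 11 7 (Vote 4 [:: (0,1); (1,1); (2,1); (3,1); (4,1); (5,1); (7,1); (8,1);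
      (9,1); (10,1); (11,1); (12,1)] [:: ([:: 5; 7; 8; 9; 11], (Trace [:: 0; 1; 2; 3; 4; 5; 11; 7; 8; 9; 14] 10
      Conflict)); ([:: 2; 4; 7; 9; 12], (Vote 4 [:: (0,1); (1,1); (2,1); (4,1); (5,1); (7,1); (8,1); (9,1); (10,1);
      (11,1); (13,1); (14,1)] [:: ([:: 5; 7; 8; 9; 11], (Trace [:: 0; 1; 2; 14; 4; 5; 11; 7; 8; 9; 15] 10
      Conflict)); ([:: 0; 5; 8; 13; 14], (Trace [:: 0; 1; 2; 14; 15; 5; 6; 7; 8; 9; 10] 13 (Vote 4 [:: (0,1); (1,1);
      (2,1); (5,1); (6,1); (7,1); (9,1); (10,1); (11,1); (12,1); (13,1); (14,1)] [:: ([:: 5; 7; 9; 11], (Trace [::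
      0; 1; 5; 16; 11; 2; 15; 7; 12; 9; 14] 8 (Trace [:: 0; 1; 2; 14; 15; 5; 11; 7; 8; 9; 16] 10 Conflict))); ([::
      0; 2; 10; 12; 13], (Trace [:: 1; 5; 15; 14; 7; 10; 0; 12; 13; 2; 16] 11 Conflict))])))]))]))));
      ([:: 5], (Common 11 7 (Vote 4 [:: (0,1); (1,1); (2,1); (3,1); (4,1); (5,1); (7,1); (8,1); (9,1);
      (10,1); (11,1); (12,1)] [:: ([:: 2; 4; 7; 9; 11], (Trace [:: 0; 1; 2; 13; 4; 5; 6; 7; 8; 9; 10] 11 Conflict));
      ([:: 0; 3; 5; 8; 12], (Vote 3 [:: (0,1); (1,1); (2,1); (6,1); (7,1); (8,1); (10,1); (12,1); (13,1)] [:: ([::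
      1; 6; 8; 12], (Vote 2 [:: (0,1); (6,1); (7,1); (10,1); (12,1); (13,1)] [:: ([:: 0; 10; 12], (Trace [:: 0; 1;
      14; 12; 13; 5; 6; 7; 8; 15; 10] 11 Conflict)); ([:: 6; 7; 13], (Trace [:: 1; 7; 10; 6; 14; 12; 5; 15; 8; 0;
      13] 11 Conflict))])); ([:: 0; 2; 10; 12], (Trace [:: 1; 2; 14; 10; 7; 3; 0; 8; 12; 5; 13] 11 Conflict))]))])));
      ([:: 0; 5], (Common 11 7 (Branch 12 2 (Branch 12 4 (Branch 12 9 (Common 11 3 (Common 11 8 (Trace [:: 0; 1;
      2; 12; 4; 5; 6; 7; 8; 9; 10] 14 (Vote 4 [:: (0,1); (1,1); (2,1); (3,1); (4,1); (5,1); (6,1); (7,1); (10,1);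
      (11,1); (12,1); (13,1)] [:: ([:: 0; 2; 5; 7], (Vote 4 [:: (0,1); (2,1); (4,1); (5,1); (6,1); (7,1); (8,1);
      (10,1); (11,1); (12,1); (14,1); (15,1)] [:: ([:: 0; 2; 5; 7; 14], (Vote 2 [:: (2,1); (5,1); (6,1); (10,1);
      (11,1); (12,1)] [:: ([:: 2; 10; 11], (Vote 2 [:: (8,1); (9,1); (10,1); (11,1); (12,1); (14,1)] [:: ([:: 8; 9;
      11], (Trace [:: 0; 4; 12; 2; 16; 5; 9; 8; 7; 6; 10] 18 (Trace [:: 3; 4; 8; 10; 9; 0; 2; 5; 18; 7; 16] 11
      Conflict))); ([:: 10; 12; 14], (Trace [:: 5; 10; 8; 14; 16; 7; 4; 18; 2; 11; 12] 3 (Trace [:: 5; 10; 8; 14;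
      16; 7; 4; 18; 2; 11; 12] 17 (Trace [:: 2; 12; 11; 14; 16; 7; 17; 18; 5; 8; 10] 0 (Trace [:: 0; 11; 12; 2; 15;
      5; 9; 17; 7; 6; 10] 14 (Vote 3 [:: (0,1); (3,1); (4,1); (6,1); (7,1); (10,1); (11,1); (14,1); (17,1)] [:: ([::
      4; 6; 7; 11], (Trace [:: 4; 5; 10; 7; 19; 11; 8; 15; 6; 3; 14] 2 Conflict)); ([:: 7; 14; 17], (Trace [:: 4; 8;
      10; 18; 12; 2; 5; 14; 7; 0; 15] 19 Conflict))]))))))])); ([:: 5; 6; 12], (Trace [:: 0; 6; 10; 5; 16; 2; 9; 17;
      7; 11; 12] 3 Conflict))]))]))])))) (Trace [:: 0; 1; 2; 3; 4; 5; 6; 7; 8; 9; 10] 13 (Vote 4 [:: (0,1); (1,1);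
      (2,1); (3,1); (4,1); (5,1); (6,1); (7,1); (9,1); (10,1); (12,1); (13,1)] [:: ([:: 0; 2; 5; 7; 13], (Vote 2 [::
      (0,1); (4,1); (6,1); (7,1); (10,1); (12,1)] [:: ([:: 4; 6; 7], (Trace [:: 2; 6; 10; 7; 14; 0; 8; 15; 5; 12; 4]
      11 Conflict)); ([:: 0; 10; 12], (Vote 3 [:: (0,1); (4,1); (7,1); (8,1); (9,1); (10,1); (12,1); (13,1); (14,1)]
      [:: ([:: 0; 7; 8; 13], (Trace [:: 0; 6; 10; 8; 16; 13; 15; 2; 7; 4; 12] 3 Conflict)); ([:: 8; 9; 12; 14],
      (Trace [:: 7; 10; 9; 16; 14; 5; 3; 8; 0; 12; 4] 11 Conflict))]))]))]))) (Branch 12 9 (Common 11 8 (Vote 3 [::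
      (0,1); (1,1); (2,1); (4,1); (5,1); (8,1); (9,1); (10,1); (12,1)] [:: ([:: 0; 5; 8; 12], (Vote 3 [:: (0,1);
      (6,1); (7,1); (8,1); (10,1); (11,1); (12,1); (14,1); (15,1)] [:: ([:: 6; 7; 8; 11], (Trace [:: 0; 1; 2; 12;
      15; 5; 6; 7; 8; 9; 10] 16 Conflict)); ([:: 0; 10; 12; 14], (Trace [:: 0; 1; 2; 12; 15; 5; 6; 7; 8; 16; 10] 14
      (Trace [:: 1; 5; 10; 8; 14; 11; 7; 15; 16; 2; 12] 4 Conflict))); ([:: 6; 7; 15], (Trace [:: 1; 2; 6; 10; 7;
      12; 0; 8; 16; 5; 15] 4 Conflict))])); ([:: 1; 4; 10; 12], (Trace [:: 0; 4; 15; 10; 9; 3; 1; 8; 12; 6; 2] 11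
      Conflict))])) (Vote 4 [:: (0,1); (1,1); (2,1); (3,1); (4,1); (5,1); (6,1); (7,1); (9,1); (10,1); (12,1);
      (14,1)] [:: ([:: 1; 4; 6; 9; 12], (Trace [:: 1; 2; 3; 4; 15; 6; 7; 8; 9; 5; 10] 11 Conflict)); ([:: 0; 2; 5;
      7; 14], (Vote 3 [:: (2,1); (3,1); (4,1); (5,1); (8,1); (9,1); (10,1); (14,1); (15,1)] [:: ([:: 3; 5; 8; 14],
      (Vote 4 [:: (0,1); (2,1); (3,1); (5,1); (8,1); (9,1); (10,1); (11,1); (12,1); (14,1); (15,1); (16,1)] [:: ([::
      0; 3; 5; 8; 12], (Trace [:: 0; 15; 2; 3; 17; 5; 6; 7; 8; 9; 10] 14 (Trace [:: 2; 3; 16; 14; 15; 7; 8; 9; 5; 6;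
      10] 11 Conflict))); ([:: 0; 3; 5; 8; 14], (Vote 2 [:: (0,1); (6,1); (7,1); (10,1); (11,1); (12,1)] [:: ([:: 6;
      7; 11], (Trace [:: 0; 15; 2; 3; 17; 5; 6; 7; 8; 9; 10] 18 (Trace [:: 2; 6; 10; 7; 15; 0; 8; 18; 5; 3; 17] 11
      Conflict))); ([:: 0; 10; 12], (Vote 4 [:: (0,1); (2,1); (3,1); (7,1); (8,1); (9,1); (10,1); (12,1); (14,1);
      (15,1); (17,1); (18,1)] [:: ([:: 2; 7; 9; 17; 18], (Trace [:: 0; 15; 2; 19; 17; 5; 6; 7; 8; 18; 10] 14 (Trace
      [:: 2; 15; 14; 17; 19; 7; 6; 5; 9; 8; 10] 11 Conflict)))]))]))])); ([:: 2; 4; 10; 14], (Trace [:: 3; 4; 16;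
      10; 9; 0; 2; 5; 14; 7; 15] 12 Conflict))]))]))) (Trace [:: 0; 1; 2; 3; 4; 5; 6; 7; 8; 9; 10] 12 (Branch 12 4
      (Common 11 3 (Common 11 8 (Vote 3 [:: (0,1); (1,1); (2,1); (4,1); (6,1); (7,1); (8,1); (10,1); (12,1)] [::
      ([:: 1; 6; 8; 12], (Trace [:: 0; 1; 16; 12; 4; 5; 6; 7; 8; 9; 10] 15 (Vote 2 [:: (6,1); (7,1); (10,1); (11,1);
      (12,1); (15,1)] [:: ([:: 6; 7; 11], (Trace [:: 0; 1; 16; 12; 4; 5; 6; 7; 8; 9; 10] 17 (Trace [:: 1; 7; 10; 6;
      16; 12; 5; 17; 8; 0; 4] 11 Conflict))); ([:: 10; 12; 15], (Vote 2 [:: (5,1); (6,1); (10,1); (11,1); (12,1);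
      (16,1)] [:: ([:: 5; 6; 12], (Trace [:: 0; 1; 5; 10; 6; 16; 11; 7; 18; 9; 12] 2 Conflict)); ([:: 10; 11; 16],
      (Vote 4 [:: (0,1); (1,1); (3,1); (4,1); (5,1); (6,1); (7,1); (10,1); (11,1); (12,1); (14,1); (16,1)] [:: ([::
      0; 5; 7; 14; 16], (Vote 4 [:: (0,1); (3,1); (4,1); (6,1); (7,1); (10,1); (11,1); (12,1); (14,1); (16,1);
      (18,1); (19,1)] [:: ([:: 4; 6; 7; 14; 18], (Trace [:: 0; 11; 12; 16; 19; 14; 4; 18; 7; 6; 20] 8 Conflict));
      ([:: 6; 12; 18; 19], (Branch 15 19 (Trace [:: 5; 10; 8; 15; 19; 7; 4; 17; 16; 11; 12] 3 (Trace [:: 0; 1; 16;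
      12; 11; 5; 6; 7; 18; 9; 10] 15 (Trace [:: 4; 5; 10; 7; 12; 11; 8; 1; 17; 3; 15] 2 Conflict))) (Trace [:: 0;
      11; 12; 20; 19; 5; 9; 18; 7; 6; 10] 15 (Trace [:: 0; 4; 12; 16; 19; 5; 9; 8; 7; 6; 10] 15
      Conflict))))]))]))]))]))); ([:: 0; 2; 10; 12], (Trace [:: 1; 2; 16; 10; 7; 3; 0; 8; 12; 5; 4] 11
      Conflict))]))) (Vote 4 [:: (0,1); (1,1); (2,1); (3,1); (4,1); (5,1); (7,1); (8,1); (9,1); (10,1); (11,1);
      (12,1)] [:: ([:: 2; 4; 7; 9; 11], (Vote 4 [:: (0,1); (1,1); (2,1); (4,1); (5,1); (6,1); (7,1); (10,1); (11,1);
      (12,1); (14,1); (15,1)] [:: ([:: 0; 2; 5; 7; 14], (Vote 2 [:: (2,1); (4,1); (12,1); (13,1); (14,1); (15,1)]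
      [:: ([:: 2; 4; 12], (Trace [:: 0; 4; 15; 2; 16; 5; 9; 8; 7; 6; 10] 17 (Trace [:: 0; 4; 15; 2; 16; 5; 9; 17; 7;
      6; 10] 12 Conflict))); ([:: 13; 14; 15], (Vote 4 [:: (0,1); (2,1); (3,1); (4,1); (6,1); (7,1); (8,1); (9,1);
      (10,1); (12,1); (14,1); (16,1)] [:: ([:: 6; 7; 8; 9; 14], (Trace [:: 0; 4; 15; 2; 16; 14; 9; 8; 7; 6; 18] 5
      (Trace [:: 0; 4; 15; 2; 16; 14; 9; 8; 7; 6; 18] 11 Conflict))); ([:: 3; 6; 8; 12; 16], (Vote 4 [:: (0,1);
      (4,1); (6,1); (7,1); (8,1); (9,1); (10,1); (12,1); (14,1); (15,1); (16,1); (18,1)] [:: ([:: 6; 7; 8; 9; 14],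
      (Trace [:: 0; 4; 15; 2; 16; 14; 9; 8; 7; 6; 19] 5 (Trace [:: 0; 4; 15; 2; 16; 14; 9; 8; 7; 6; 19] 11
      Conflict))); ([:: 6; 8; 12; 15; 16], (Vote 2 [:: (5,1); (6,1); (10,1); (11,1); (15,1); (19,1)] [:: ([:: 5; 6;
      15], (Trace [:: 0; 6; 10; 5; 16; 19; 9; 20; 7; 11; 15] 3 (Trace [:: 0; 6; 10; 5; 16; 19; 9; 20; 7; 4; 15] 3
      Conflict))); ([:: 10; 11; 19], (Branch 6 14 (Vote 3 [:: (2,1); (3,1); (4,1); (6,1); (7,1); (10,1); (12,1);
      (13,1); (14,1)] [:: ([:: 2; 4; 10; 12], (Trace [:: 0; 4; 15; 2; 16; 5; 9; 21; 7; 6; 10] 12 Conflict)); ([:: 4;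
      6; 7; 13], (Trace [:: 6; 14; 12; 13; 21; 4; 19; 17; 7; 2; 15] 8 Conflict)); ([:: 3; 10; 14], (Trace [:: 3; 4;
      14; 16; 18; 8; 21; 5; 6; 7; 10] 11 Conflict))]) (Trace [:: 0; 11; 15; 19; 16; 5; 9; 20; 7; 6; 10] 14 (Trace
      [:: 0; 11; 12; 19; 16; 5; 9; 20; 7; 6; 10] 14 (Trace [:: 0; 4; 14; 10; 9; 15; 16; 8; 12; 6; 19] 2
      Conflict)))))])); ([:: 10; 14; 15; 18], (Trace [:: 4; 8; 10; 19; 15; 2; 5; 18; 7; 14; 16] 9
      Conflict))]))]))]))])); ([:: 0; 3; 5; 8; 12], (Vote 4 [:: (0,1); (1,1); (2,1); (3,1); (4,1); (5,1); (6,1);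
      (7,1); (10,1); (12,1); (14,1); (15,1)] [:: ([:: 0; 2; 5; 7; 14], (Vote 3 [:: (0,1); (2,1); (3,1); (4,1);
      (12,1); (13,1); (14,1); (15,1); (16,1)] [:: ([:: 0; 3; 13], (Vote 4 [:: (0,1); (2,1); (3,1); (5,1); (6,1);
      (7,1); (10,1); (12,1); (13,1); (15,1); (16,1); (17,1)] [::])); ([:: 4; 13; 15; 16], (Vote 4 [:: (2,1); (3,1);
      (4,1); (7,1); (8,1); (10,1); (12,1); (13,1); (14,1); (15,1); (16,1); (17,1)] [:: ([:: 10; 13; 15; 16], (Trace
      [:: 0; 15; 3; 2; 16; 18; 9; 8; 7; 6; 10] 13 (Vote 4 [:: (0,1); (2,1); (3,1); (4,1); (6,1); (7,1); (8,1);
      (10,1); (12,1); (14,1); (15,1); (16,1)] [:: ([:: 3; 6; 8; 12; 16], (Vote 3 [:: (0,1); (4,1); (8,1); (9,1);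
      (10,1); (12,1); (14,1); (16,1); (19,1)] [:: ([:: 4; 10; 12; 16], (Trace [:: 0; 4; 20; 10; 9; 3; 16; 8; 12; 6;
      19] 2 Conflict)); ([:: 10; 14], (Trace [:: 0; 15; 12; 19; 16; 5; 9; 8; 7; 6; 10] 14 (Vote 4 [:: (0,1); (2,1);
      (3,1); (4,1); (6,1); (7,1); (8,1); (10,1); (12,1); (13,1); (14,1); (15,1)] [:: ([:: 4; 6; 7; 15], (Trace [::
      6; 10; 7; 16; 19; 8; 21; 5; 12; 0; 15] 4 Conflict))])))]))])))]))]))]))]))))));
      ([:: 10], (Vote 2 [:: (0,1); (1,1); (2,1); (3,1); (4,1); (11,1)] [:: ([:: 0; 2; 11], (Branch 12 5
      (Branch 12 7 (Common 11 1 (Common 11 3 (Common 11 4 (Vote 4 [:: (0,1); (1,1); (2,1); (3,1); (4,1); (5,1);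
      (8,1); (9,1); (10,1); (11,1); (12,1); (13,1)] [:: ([:: 0; 3; 5; 8; 11], (Trace [:: 0; 12; 2; 3; 16; 11; 6; 7;
      8; 9; 10] 13 (Trace [:: 0; 12; 2; 3; 16; 11; 6; 7; 8; 9; 10] 15 (Trace [:: 0; 12; 2; 3; 16; 5; 6; 7; 8; 9; 10]
      13 (Trace [:: 0; 12; 2; 3; 16; 5; 6; 7; 8; 9; 10] 15 (Trace [:: 0; 12; 2; 3; 16; 11; 6; 7; 8; 9; 10] 13 (Trace
      [:: 0; 12; 2; 3; 16; 11; 6; 7; 8; 9; 10] 15 (Trace [:: 0; 6; 2; 3; 9; 10; 12; 13; 15; 16; 11] 5
      Conflict)))))))); ([:: 0; 3; 5; 8; 13], (Vote 4 [:: (0,1); (1,1); (2,2); (3,1); (8,1); (9,1); (10,1); (11,1);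
      (12,1); (13,1); (16,1)] [:: ([:: 0; 2; 10; 13], (Trace [:: 0; 12; 2; 3; 16; 5; 17; 7; 8; 9; 10] 13 (Trace [::
      0; 12; 2; 3; 16; 5; 6; 7; 8; 9; 10] 13 (Vote 4 [:: (0,1); (1,1); (2,1); (3,1); (4,1); (7,1); (8,1); (9,1);
      (10,1); (11,1); (12,1); (13,1)] [:: ([:: 2; 4; 7; 9; 11], (Trace [:: 0; 4; 18; 2; 12; 5; 9; 8; 11; 6; 10] 13
      (Trace [:: 0; 4; 18; 2; 12; 5; 9; 8; 11; 6; 10] 14 (Trace [:: 1; 2; 18; 4; 13; 6; 7; 8; 11; 5; 10] 14
      Conflict))))])))); ([:: 2; 9; 11; 16], (Trace [:: 0; 12; 2; 17; 16; 5; 6; 11; 8; 9; 10] 13 (Trace [:: 0; 12;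
      2; 17; 16; 5; 6; 11; 8; 9; 10] 14 (Trace [:: 0; 12; 2; 3; 16; 5; 6; 7; 8; 9; 10] 13 (Trace [:: 1; 2; 3; 16;
      13; 6; 7; 8; 9; 5; 10] 14 (Trace [:: 0; 12; 2; 17; 16; 5; 6; 11; 8; 9; 10] 14 (Trace [:: 0; 6; 2; 8; 16; 13;
      12; 10; 17; 14; 11] 7 Conflict)))))))]))])))) (Trace [:: 0; 1; 2; 3; 4; 5; 6; 7; 8; 9; 10] 13 (Vote 4 [::
      (0,1); (1,1); (2,1); (3,1); (4,1); (5,1); (7,1); (8,1); (9,1); (10,1); (12,1); (13,1)] [:: ([:: 0; 3; 5; 8;
      13], (Vote 3 [:: (0,1); (1,1); (2,1); (6,1); (7,1); (8,1); (10,1); (13,1); (14,1)] [:: ([:: 1; 6; 8; 13],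
      (Vote 2 [:: (2,1); (7,1); (8,1); (10,1); (12,1); (13,1)] [:: ([:: 7; 8; 12], (Trace [:: 0; 1; 15; 13; 14; 5;
      6; 7; 8; 9; 10] 16 Conflict)); ([:: 2; 10; 13], (Trace [:: 1; 2; 8; 10; 5; 12; 15; 16; 14; 7; 13] 3 (Trace [::
      0; 1; 15; 3; 14; 5; 6; 7; 8; 9; 10] 12 Conflict)))])); ([:: 0; 2; 10; 13], (Trace [:: 1; 2; 15; 10; 7; 3; 0;
      8; 13; 5; 14] 4 (Trace [:: 4; 5; 10; 7; 13; 12; 8; 1; 15; 3; 2] 11 Conflict)))]))]))) (Trace [:: 0; 1; 2; 3;
      4; 5; 6; 7; 8; 9; 10] 12 (Trace [:: 0; 1; 2; 3; 4; 5; 6; 7; 8; 9; 10] 13 (Vote 4 [:: (0,1); (1,1); (2,1);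
      (3,1); (4,1); (5,1); (7,1); (8,1); (9,1); (10,1); (12,1); (13,1)] [:: ([:: 2; 4; 7; 9; 13], (Vote 3 [:: (0,1);
      (1,1); (2,1); (5,1); (6,1); (9,1); (10,1); (13,1); (14,1)] [:: ([:: 1; 6; 9; 13], (Vote 2 [:: (0,1); (4,1);
      (7,1); (8,1); (10,1); (12,1)] [:: ([:: 0; 7; 8], (Trace [:: 1; 2; 14; 13; 15; 6; 7; 8; 9; 5; 10] 16 (Trace [::
      2; 8; 10; 7; 14; 4; 6; 16; 9; 12; 0] 15 Conflict))); ([:: 4; 10; 12], (Trace [:: 0; 4; 3; 2; 12; 16; 9; 8; 7;
      6; 10] 13 (Vote 4 [:: (0,1); (1,1); (2,1); (3,1); (4,1); (8,1); (9,1); (10,1); (12,1); (13,1); (15,1); (16,1)]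
      [:: ([:: 0; 3; 8; 15], (Vote 2 [:: (0,1); (1,1); (7,1); (8,1); (10,1); (17,1)] [:: ([:: 0; 7; 8], (Trace [::
      1; 2; 3; 13; 15; 6; 7; 8; 9; 5; 10] 18 (Trace [:: 2; 3; 7; 10; 8; 17; 12; 9; 18; 6; 0] 15 Conflict))); ([:: 1;
      10; 17], (Trace [:: 1; 2; 3; 17; 15; 6; 7; 8; 9; 18; 10] 12 (Trace [:: 0; 1; 2; 3; 17; 18; 6; 7; 8; 9; 10] 13
      Conflict)))]))])))])); ([:: 0; 2; 10; 13], (Trace [:: 0; 1; 5; 10; 15; 2; 4; 7; 13; 9; 14] 3 (Trace [:: 3; 7;
      10; 5; 13; 12; 9; 1; 15; 4; 0] 11 Conflict)))]))]))))); ([:: 1; 3; 11], (Branch 12 6 (Branch 12 8 (Common 11 0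
      (Common 11 2 (Common 11 4 (Vote 3 [:: (0,1); (1,1); (3,1); (4,1); (5,1); (9,1); (10,1); (11,1); (12,1)] [::
      ([:: 0; 3; 5; 11], (Trace [:: 0; 1; 12; 3; 16; 5; 6; 7; 11; 9; 10] 14 (Trace [:: 0; 1; 12; 3; 16; 5; 6; 7; 11;
      9; 10] 15 (Trace [:: 0; 1; 12; 3; 4; 5; 6; 7; 8; 9; 10] 14 (Trace [:: 0; 1; 12; 3; 16; 5; 6; 7; 11; 9; 10] 14
      (Trace [:: 0; 4; 3; 2; 14; 5; 9; 8; 7; 6; 10] 15 (Trace [:: 0; 1; 12; 3; 16; 5; 6; 7; 11; 9; 10] 15 (Trace [::
      0; 1; 7; 3; 9; 15; 14; 12; 10; 16; 11] 8 Conflict)))))))); ([:: 1; 4; 9; 11], (Trace [:: 1; 12; 3; 4; 16; 11;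
      7; 8; 9; 5; 10] 13 (Trace [:: 1; 12; 3; 4; 16; 11; 7; 8; 9; 5; 10] 14 (Trace [:: 0; 1; 12; 3; 4; 5; 6; 7; 8;
      9; 10] 14 (Trace [:: 1; 12; 3; 4; 16; 11; 7; 8; 9; 5; 10] 14 (Trace [:: 0; 1; 2; 14; 4; 5; 6; 7; 8; 9; 10] 13
      (Trace [:: 1; 7; 10; 11; 12; 3; 5; 14; 8; 16; 4] 6 (Trace [:: 1; 12; 3; 4; 16; 11; 7; 8; 9; 5; 10] 13 (Trace
      [:: 1; 2; 14; 4; 16; 6; 7; 8; 11; 5; 10] 13 Conflict)))))))))])))) (Trace [:: 0; 1; 2; 3; 4; 5; 6; 7; 8; 9;
      10] 13 (Vote 4 [:: (0,1); (1,1); (2,1); (3,1); (4,1); (5,1); (6,1); (8,1); (9,1); (10,1); (12,1); (13,1)] [::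
      ([:: 1; 4; 6; 9; 13], (Vote 2 [:: (3,1); (4,1); (5,1); (6,1); (10,1); (12,1)] [:: ([:: 3; 5; 6], (Trace [:: 0;
      1; 5; 10; 6; 12; 4; 7; 15; 9; 3] 11 (Trace [:: 0; 1; 5; 10; 6; 2; 4; 7; 15; 9; 3] 11 Conflict))); ([:: 4; 10;
      12], (Vote 3 [:: (1,1); (2,1); (3,1); (7,1); (8,1); (9,1); (10,1); (13,1); (14,1)] [:: ([:: 2; 7; 9; 13],
      (Vote 4 [:: (0,1); (1,1); (2,1); (3,1); (4,1); (5,1); (9,1); (10,1); (12,1); (13,1); (15,1); (16,1)] [:: ([::
      0; 3; 5; 16], (Vote 2 [:: (2,1); (3,1); (5,1); (6,1); (10,1); (17,1)] [:: ([:: 3; 5; 6], (Trace [:: 0; 1; 5;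
      10; 6; 12; 17; 7; 18; 9; 3] 16 Conflict)); ([:: 2; 10; 17], (Trace [:: 0; 1; 2; 16; 17; 5; 6; 7; 18; 9; 10] 12
      (Trace [:: 0; 1; 2; 3; 17; 5; 6; 7; 18; 9; 10] 13 Conflict)))]))])); ([:: 1; 3; 10; 13], (Trace [:: 2; 3; 16;
      10; 8; 4; 1; 9; 13; 6; 14] 15 (Trace [:: 6; 10; 8; 13; 14; 9; 2; 16; 4; 12; 3] 11 (Trace [:: 3; 4; 14; 13; 12;
      15; 9; 5; 11; 16; 10] 2 Conflict))))]))]))]))) (Trace [:: 0; 1; 2; 3; 4; 5; 6; 7; 8; 9; 10] 12 (Trace [:: 0;
      1; 2; 3; 4; 5; 6; 7; 8; 9; 10] 13 (Vote 3 [:: (0,1); (1,1); (4,1); (5,1); (8,1); (9,1); (10,1); (12,1);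
      (13,1)] [:: ([:: 0; 5; 8; 13], (Vote 3 [:: (0,1); (1,1); (3,1); (7,1); (8,1); (9,1); (10,1); (12,1); (14,1)]
      [:: ([:: 1; 3; 10; 14], (Trace [:: 2; 3; 15; 10; 8; 4; 1; 9; 14; 6; 0] 13 Conflict)); ([:: 7; 9; 12; 14],
      (Vote 4 [:: (0,1); (1,1); (2,1); (3,1); (5,1); (6,1); (8,1); (9,1); (10,1); (12,1); (13,1); (14,1)] [:: ([::
      0; 3; 5; 8; 13], (Vote 3 [:: (1,1); (2,1); (3,1); (5,1); (6,1); (7,1); (10,1); (13,1); (16,1)] [:: ([:: 2; 5;
      7; 13], (Vote 3 [:: (2,1); (6,1); (7,1); (8,1); (10,1); (12,1); (13,1); (15,1); (17,1)] [:: ([:: 2; 10; 13;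
      15], (Trace [:: 2; 3; 16; 13; 17; 7; 8; 9; 5; 18; 10] 15 (Trace [:: 2; 17; 7; 10; 18; 13; 3; 5; 15; 8; 16] 12
      Conflict))); ([:: 6; 8; 15; 17], (Vote 4 [:: (0,1); (1,1); (5,1); (6,1); (7,1); (10,1); (12,1); (13,1);
      (14,1); (15,1); (17,1); (18,1)] [:: ([:: 0; 5; 12; 18], (Vote 2 [:: (5,1); (9,1); (10,1); (12,1); (13,1);
      (19,1)] [:: ([:: 5; 9; 12], (Trace [:: 13; 14; 15; 18; 17; 5; 9; 8; 7; 6; 10] 20 (Trace [:: 0; 9; 10; 5; 14;
      15; 6; 20; 8; 19; 18] 12 Conflict))); ([:: 10; 13; 19], (Trace [:: 6; 10; 8; 16; 13; 20; 18; 5; 12; 0; 19] 17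
      (Trace [:: 0; 16; 3; 2; 17; 5; 9; 8; 7; 6; 10] 12 Conflict)))])); ([:: 0; 5; 7; 13; 18], (Trace [:: 0; 14; 15;
      18; 19; 5; 9; 8; 7; 6; 10] 12 Conflict))]))])); ([:: 1; 3; 10; 13], (Trace [:: 1; 2; 6; 10; 17; 3; 0; 8; 13;
      5; 16] 4 (Trace [:: 4; 8; 10; 6; 13; 12; 5; 2; 17; 0; 1] 11 Conflict)))]))]))])); ([:: 1; 4; 10; 13], (Trace
      [:: 0; 1; 2; 3; 4; 14; 6; 7; 8; 9; 10] 13 Conflict))]))))); ([:: 2; 4; 11], (Branch 12 7 (Branch 12 9 (Common
      11 0 (Common 11 1 (Common 11 3 (Branch 0 15 (Vote 4 [:: (0,1); (1,1); (2,1); (3,1); (4,1); (5,1); (6,1);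
      (7,1); (10,1); (11,1); (12,1); (15,1)] [:: ([:: 0; 2; 5; 7; 11], (Trace [:: 0; 4; 12; 2; 16; 5; 9; 8; 11; 6;
      10] 14 (Trace [:: 0; 4; 12; 2; 16; 5; 9; 8; 11; 6; 10] 15 (Trace [:: 0; 4; 12; 2; 16; 5; 9; 8; 7; 6; 10] 15
      (Trace [:: 0; 15; 3; 2; 16; 11; 9; 8; 7; 6; 10] 14 Conflict)))))]) (Vote 3 [:: (0,1); (1,1); (2,1); (4,1);
      (5,1); (6,1); (10,1); (11,1); (12,1)] [:: ([:: 0; 2; 5; 11], (Trace [:: 0; 4; 12; 2; 17; 5; 9; 8; 11; 6; 10]
      15 (Trace [:: 0; 1; 2; 12; 4; 5; 6; 7; 8; 9; 10] 15 Conflict))); ([:: 1; 4; 6; 11], (Trace [:: 1; 2; 12; 4;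
      17; 6; 7; 8; 11; 5; 10] 13 (Trace [:: 1; 2; 12; 4; 17; 6; 7; 8; 11; 5; 10] 15 (Trace [:: 0; 1; 2; 12; 4; 5; 6;
      7; 8; 9; 10] 15 (Trace [:: 1; 2; 12; 4; 17; 6; 7; 8; 11; 5; 10] 15 (Trace [:: 4; 8; 10; 11; 12; 2; 5; 15; 7;
      17; 1] 9 (Trace [:: 1; 15; 3; 4; 17; 11; 7; 8; 9; 5; 10] 13 Conflict)))))))]))))) (Trace [:: 0; 1; 2; 3; 4; 5;
      6; 7; 8; 9; 10] 13 (Vote 4 [:: (0,1); (1,1); (2,1); (3,1); (4,1); (5,1); (6,1); (7,1); (9,1); (10,1); (12,1);
      (13,1)] [:: ([:: 0; 2; 5; 7; 13], (Vote 2 [:: (0,1); (4,1); (6,1); (7,1); (10,1); (12,1)] [:: ([:: 4; 6; 7],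
      (Trace [:: 1; 2; 6; 10; 7; 12; 0; 8; 15; 5; 4] 11 (Trace [:: 1; 2; 6; 10; 7; 3; 0; 8; 15; 5; 4] 11
      Conflict))); ([:: 0; 10; 12], (Vote 3 [:: (0,1); (2,1); (4,1); (5,1); (6,1); (10,1); (11,1); (12,1); (14,1)]
      [:: ([:: 0; 2; 5; 11], (Trace [:: 0; 4; 12; 2; 16; 5; 15; 8; 11; 6; 10] 3 (Trace [:: 0; 4; 3; 2; 14; 5; 15; 8;
      7; 6; 10] 13 (Trace [:: 0; 1; 2; 3; 4; 5; 6; 7; 8; 9; 10] 13 (Trace [:: 1; 7; 10; 9; 13; 12; 5; 3; 8; 0; 4] 11
      Conflict))))); ([:: 11; 14], (Vote 3 [:: (0,1); (4,1); (7,1); (8,1); (9,1); (10,1); (12,1); (13,1); (14,1)]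
      [:: ([:: 0; 7; 8; 13], (Trace [:: 0; 6; 10; 8; 17; 13; 15; 2; 7; 4; 12] 3 Conflict)); ([:: 8; 9; 12; 14],
      (Trace [:: 7; 10; 9; 17; 14; 5; 3; 8; 0; 12; 4] 11 Conflict))]))]))]))]))) (Trace [:: 0; 1; 2; 3; 4; 5; 6; 7;
      8; 9; 10] 12 (Trace [:: 0; 1; 2; 3; 4; 5; 6; 7; 8; 9; 10] 13 (Vote 4 [:: (0,1); (1,1); (2,1); (3,1); (4,1);
      (5,1); (6,1); (7,1); (9,1); (10,1); (12,1); (13,1)] [:: ([:: 1; 4; 6; 9; 13], (Vote 2 [:: (1,1); (2,1); (5,1);
      (9,1); (10,1); (12,1)] [:: ([:: 2; 5; 9], (Trace [:: 0; 4; 5; 10; 9; 12; 1; 8; 15; 6; 2] 11 (Trace [:: 0; 4;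
      5; 10; 9; 3; 1; 8; 15; 6; 2] 11 Conflict))); ([:: 1; 10; 12], (Vote 3 [:: (1,1); (2,1); (4,1); (5,1); (6,1);
      (10,1); (11,1); (12,1); (14,1)] [:: ([:: 1; 4; 6; 11], (Trace [:: 1; 2; 12; 4; 16; 6; 15; 8; 11; 5; 10] 3
      (Trace [:: 1; 2; 3; 4; 14; 6; 15; 8; 9; 5; 10] 13 (Trace [:: 0; 1; 2; 3; 4; 5; 6; 7; 8; 9; 10] 13 (Trace [::
      0; 9; 10; 7; 13; 12; 6; 3; 8; 1; 2] 11 Conflict))))); ([:: 2; 5; 11; 14], (Vote 3 [:: (0,1); (1,1); (2,1);
      (4,1); (5,1); (6,1); (10,1); (11,1); (12,1)] [:: ([:: 0; 2; 5; 11], (Vote 3 [:: (0,1); (2,1); (5,1); (6,1);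
      (9,1); (10,1); (12,1); (13,1); (17,1)] [:: ([:: 0; 2; 10; 13], (Trace [:: 0; 17; 5; 10; 18; 2; 4; 11; 13; 9;
      12] 3 Conflict)); ([:: 6; 9; 13; 17], (Vote 3 [:: (1,1); (2,1); (6,1); (7,1); (10,1); (11,1); (12,1); (13,1);
      (14,1)] [:: ([:: 1; 6; 11], (Trace [:: 2; 12; 4; 14; 16; 11; 8; 9; 5; 6; 10] 19 (Trace [:: 1; 2; 3; 4; 19; 6;
      7; 8; 9; 5; 10] 17 (Trace [:: 2; 6; 10; 11; 17; 0; 8; 19; 5; 12; 4] 7 Conflict)))); ([:: 2; 7; 11; 14], (Vote
      2 [:: (2,1); (6,1); (7,1); (10,1); (12,1); (13,1)] [:: ([:: 6; 7; 12], (Trace [:: 6; 10; 7; 19; 14; 9; 20; 11;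
      13; 2; 12] 3 Conflict)); ([:: 2; 10; 13], (Trace [:: 2; 12; 13; 18; 17; 11; 20; 9; 5; 6; 10] 3
      Conflict))]))]))])); ([:: 1; 4; 6; 11], (Trace [:: 2; 6; 10; 11; 16; 14; 8; 17; 5; 12; 4] 7 (Trace [:: 4; 5;
      10; 11; 17; 1; 8; 16; 6; 12; 2] 7 Conflict)))]))]))]))]))))); ([:: 0; 3; 11], (Branch 12 5 (Branch 12 8
      (Common 11 1 (Common 11 2 (Common 11 4 (Vote 3 [:: (0,1); (1,1); (2,1); (3,1); (6,1); (7,1); (10,1); (11,1);
      (12,1)] [:: ([:: 1; 3; 6; 11], (Trace [:: 0; 1; 16; 3; 12; 5; 6; 7; 11; 9; 10] 14 (Trace [:: 0; 1; 16; 3; 12;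
      5; 6; 7; 11; 9; 10] 15 (Trace [:: 0; 1; 2; 3; 12; 5; 6; 7; 8; 9; 10] 15 (Trace [:: 0; 1; 16; 3; 12; 5; 6; 7;
      11; 9; 10] 15 (Trace [:: 1; 2; 3; 4; 15; 6; 7; 8; 9; 5; 10] 14 (Trace [:: 0; 1; 16; 3; 12; 5; 6; 7; 11; 9; 10]
      14 (Trace [:: 0; 1; 7; 3; 9; 15; 14; 16; 10; 12; 11] 8 Conflict)))))))); ([:: 0; 2; 7; 11], (Trace [:: 0; 12;
      3; 2; 16; 11; 9; 8; 7; 6; 10] 13 (Trace [:: 0; 12; 3; 2; 16; 11; 9; 8; 7; 6; 10] 15 (Trace [:: 0; 1; 2; 3; 12;
      5; 6; 7; 8; 9; 10] 15 (Trace [:: 0; 12; 3; 2; 16; 11; 9; 8; 7; 6; 10] 15 (Trace [:: 0; 1; 2; 15; 4; 5; 6; 7;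
      8; 9; 10] 13 (Trace [:: 0; 9; 10; 11; 12; 3; 6; 15; 8; 16; 2] 5 (Trace [:: 0; 12; 3; 2; 16; 11; 9; 8; 7; 6;
      10] 13 (Trace [:: 0; 4; 15; 2; 16; 5; 9; 8; 11; 6; 10] 13 Conflict)))))))))])))) (Trace [:: 0; 1; 2; 3; 4; 5;
      6; 7; 8; 9; 10] 13 (Vote 4 [:: (0,1); (1,1); (2,1); (3,1); (4,1); (5,1); (6,1); (7,1); (8,1); (10,1); (12,1);
      (13,1)] [:: ([:: 0; 2; 5; 7; 13], (Vote 3 [:: (0,1); (3,1); (4,1); (7,1); (8,1); (9,1); (10,1); (13,1);
      (14,1)] [:: ([:: 4; 7; 9; 13], (Vote 4 [:: (0,1); (1,1); (2,1); (3,1); (4,1); (6,1); (7,1); (8,1); (9,1);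
      (10,1); (13,1); (15,1)] [:: ([:: 2; 4; 7; 9; 13], (Trace [:: 0; 4; 16; 2; 14; 5; 9; 8; 7; 6; 10] 12
      Conflict)); ([:: 1; 3; 6; 8; 15], (Trace [:: 0; 1; 16; 15; 4; 5; 6; 7; 8; 9; 10] 12 Conflict))])); ([:: 0; 3;
      10; 13], (Trace [:: 3; 4; 8; 10; 15; 0; 2; 5; 13; 7; 14] 1 (Trace [:: 1; 5; 10; 8; 13; 12; 7; 4; 15; 2; 3] 11
      Conflict)))]))]))) (Trace [:: 0; 1; 2; 3; 4; 5; 6; 7; 8; 9; 10] 12 (Trace [:: 0; 1; 2; 3; 4; 5; 6; 7; 8; 9;
      10] 13 (Vote 4 [:: (0,1); (1,1); (2,1); (3,1); (4,1); (5,1); (6,1); (7,1); (8,1); (10,1); (12,1); (13,1)] [::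
      ([:: 1; 3; 6; 8; 13], (Vote 3 [:: (0,1); (3,1); (4,1); (5,1); (6,1); (9,1); (10,1); (13,1); (14,1)] [:: ([::
      4; 6; 9; 13], (Vote 4 [:: (0,1); (1,1); (3,1); (4,1); (5,1); (6,1); (7,1); (9,1); (10,1); (13,1); (14,1);
      (15,1)] [:: ([:: 1; 4; 6; 9; 13], (Trace [:: 1; 14; 3; 4; 16; 6; 7; 8; 9; 5; 10] 12 Conflict)); ([:: 0; 5; 7;
      14; 15], (Trace [:: 3; 4; 15; 16; 14; 8; 9; 5; 6; 7; 10] 12 Conflict))])); ([:: 0; 3; 10; 13], (Trace [:: 0;
      4; 5; 10; 15; 3; 1; 8; 13; 6; 14] 2 (Trace [:: 2; 8; 10; 5; 13; 12; 6; 4; 15; 1; 0] 11 Conflict)))]))])))));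
      ([:: 1; 4; 11], (Branch 12 6 (Branch 12 9 (Common 11 0 (Common 11 2 (Common 11 3 (Vote 2 [:: (0,1); (2,1);
      (6,1); (11,1); (13,1); (14,1)] [:: ([:: 0; 2; 11], (Vote 4 [:: (0,1); (1,1); (2,1); (3,1); (4,1); (7,1);
      (8,1); (9,1); (10,1); (11,1); (12,1); (16,1)] [:: ([:: 2; 4; 7; 9; 11], (Trace [:: 1; 2; 17; 4; 12; 6; 7; 8;
      11; 5; 10] 15 (Trace [:: 1; 2; 17; 4; 12; 6; 7; 8; 11; 5; 10] 16 (Trace [:: 1; 2; 17; 4; 12; 6; 7; 8; 9; 5;
      10] 15 (Trace [:: 1; 2; 17; 4; 12; 6; 7; 8; 9; 5; 10] 16 (Trace [:: 1; 2; 17; 4; 12; 6; 7; 8; 11; 5; 10] 15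
      (Trace [:: 0; 4; 17; 2; 16; 5; 9; 8; 11; 6; 10] 15 Conflict)))))))])); ([:: 6; 13; 14], (Vote 4 [:: (0,1);
      (1,1); (2,1); (3,1); (4,1); (6,1); (7,1); (8,1); (10,1); (11,1); (12,1); (13,1)] [:: ([:: 1; 3; 6; 8; 11],
      (Trace [:: 1; 12; 4; 3; 17; 11; 5; 9; 8; 7; 10] 13 (Trace [:: 1; 12; 4; 3; 17; 11; 5; 9; 8; 7; 10] 14 (Trace
      [:: 1; 12; 4; 3; 17; 6; 5; 9; 8; 7; 10] 13 (Trace [:: 1; 12; 4; 3; 17; 6; 5; 9; 8; 7; 10] 14 (Trace [:: 1; 12;
      4; 3; 17; 11; 5; 9; 8; 7; 10] 13 (Trace [:: 1; 12; 4; 3; 17; 11; 5; 9; 8; 7; 10] 14 (Trace [:: 1; 12; 4; 3;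
      17; 6; 5; 9; 8; 7; 10] 16 Conflict)))))))); ([:: 1; 3; 6; 8; 13], (Vote 4 [:: (0,1); (1,1); (3,1); (4,1);
      (7,1); (8,1); (9,1); (10,1); (11,1); (12,1); (13,1); (17,1)] [:: ([:: 4; 7; 9; 11; 17], (Trace [:: 1; 12; 4;
      18; 17; 6; 5; 11; 8; 7; 10] 13 (Trace [:: 1; 12; 4; 18; 17; 6; 5; 11; 8; 7; 10] 15 (Trace [:: 1; 12; 4; 18;
      17; 6; 5; 9; 8; 7; 10] 13 (Trace [:: 1; 12; 4; 18; 17; 6; 5; 9; 8; 7; 10] 15 (Trace [:: 1; 12; 4; 18; 17; 6;
      5; 11; 8; 7; 10] 15 (Trace [:: 0; 4; 18; 17; 13; 5; 9; 8; 11; 6; 10] 15 Conflict)))))))]))]))])))) (Trace [::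
      0; 1; 2; 3; 4; 5; 6; 7; 8; 9; 10] 13 (Vote 3 [:: (2,1); (3,1); (4,1); (6,1); (7,1); (8,1); (10,1); (12,1);
      (13,1)] [:: ([:: 3; 6; 8; 13], (Vote 4 [:: (0,1); (1,1); (3,1); (4,1); (6,1); (7,1); (8,1); (9,1); (10,1);
      (12,1); (13,1); (14,1)] [:: ([:: 1; 3; 6; 8; 13], (Vote 3 [:: (0,1); (1,1); (4,1); (5,1); (8,1); (9,1);
      (10,1); (13,1); (15,1)] [:: ([:: 0; 5; 8; 13], (Vote 3 [:: (0,1); (1,1); (2,1); (7,1); (8,1); (9,1); (10,1);
      (13,1); (16,1)] [:: ([:: 0; 2; 10; 13], (Trace [:: 0; 1; 2; 3; 4; 5; 17; 7; 8; 9; 10] 12 Conflict)); ([:: 2;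
      7; 9; 16], (Trace [:: 0; 1; 2; 17; 16; 5; 6; 7; 8; 9; 10] 12 (Vote 3 [:: (0,1); (4,1); (6,1); (7,1); (8,1);
      (10,1); (12,1); (16,1); (17,1)] [:: ([:: 0; 7; 8; 12], (Trace [:: 0; 6; 10; 8; 18; 12; 9; 2; 7; 16; 17] 3
      Conflict)); ([:: 4; 6; 7; 16], (Trace [:: 1; 7; 10; 6; 15; 13; 5; 18; 8; 0; 16] 4 Conflict))])))])); ([:: 1;
      4; 10; 13], (Trace [:: 0; 4; 16; 10; 9; 3; 1; 8; 13; 6; 15] 2 (Trace [:: 2; 6; 10; 9; 13; 12; 8; 0; 16; 3; 4]
      11 Conflict)))]))])); ([:: 2; 4; 10; 13], (Trace [:: 0; 1; 2; 3; 4; 5; 6; 7; 14; 9; 10] 13 Conflict))])))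
      (Trace [:: 0; 1; 2; 3; 4; 5; 6; 7; 8; 9; 10] 12 (Trace [:: 0; 1; 2; 3; 4; 5; 6; 7; 8; 9; 10] 13 (Vote 4 [::
      (0,1); (1,1); (2,1); (3,1); (4,1); (6,1); (7,1); (8,1); (9,1); (10,1); (12,1); (13,1)] [:: ([:: 2; 4; 7; 9;
      13], (Vote 3 [:: (1,1); (2,1); (5,1); (6,1); (9,1); (10,1); (12,1); (13,1); (14,1)] [:: ([:: 2; 5; 9; 13],
      (Trace [:: 0; 4; 5; 10; 9; 14; 1; 8; 15; 6; 2] 13 Conflict)); ([:: 5; 6; 12; 14], (Trace [:: 0; 1; 5; 10; 6;
      2; 4; 7; 15; 9; 14] 3 (Trace [:: 3; 9; 10; 6; 15; 12; 7; 0; 5; 2; 1] 11 Conflict)))]))])))))]));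
      ([:: 0], (Vote 2 [:: (0,1); (1,1); (7,1); (8,1); (10,1); (11,1)] [:: ([:: 0; 7; 8], (Trace [:: 2; 3; 7;
      10; 8; 4; 1; 9; 12; 6; 0] 11 Conflict)); ([:: 1; 8; 11], (Vote 2 [:: (0,1); (4,1); (7,1); (8,1); (10,1);
      (11,1)] [:: ([:: 0; 7; 8], (Trace [:: 2; 3; 7; 10; 8; 4; 1; 9; 13; 6; 0] 11 Conflict)); ([:: 4; 7; 11], (Vote
      3 [:: (0,1); (1,1); (4,1); (7,1); (8,1); (10,1); (11,1); (12,1); (13,1)] [:: ([:: 1; 4; 10; 11], (Trace [:: 0;
      1; 2; 3; 4; 14; 6; 7; 8; 9; 10] 11 Conflict)); ([:: 0; 10; 12; 13], (Vote 3 [:: (0,1); (1,1); (2,1); (4,1);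
      (6,1); (7,1); (8,1); (10,1); (13,1)] [:: ([:: 1; 6; 8; 13], (Trace [:: 0; 1; 15; 13; 4; 5; 6; 7; 8; 14; 10] 11
      Conflict)); ([:: 0; 2; 10; 13], (Vote 3 [:: (0,1); (1,1); (3,1); (4,1); (7,1); (8,1); (9,1); (10,1); (12,1)]
      [:: ([:: 4; 7; 9; 12], (Trace [:: 0; 1; 12; 16; 4; 5; 14; 7; 8; 9; 10] 11 Conflict)); ([:: 0; 3; 10], (Vote 3
      [:: (1,1); (4,1); (5,1); (7,1); (8,1); (10,1); (11,1); (12,1); (13,1)] [:: ([:: 5; 7; 8; 11], (Trace [:: 0; 1;
      2; 3; 4; 5; 15; 7; 8; 16; 10] 17 (Common 11 10 (Trace [:: 1; 2; 15; 17; 7; 3; 0; 8; 13; 5; 4] 18 (Vote 4 [::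
      (0,1); (1,1); (2,1); (3,1); (4,1); (5,1); (7,1); (10,1); (11,1); (15,1); (17,1); (18,1)] [:: ([:: 0; 2; 5; 7;
      18], (Trace [:: 0; 4; 3; 2; 19; 5; 16; 8; 7; 15; 17] 18 (Trace [:: 2; 15; 10; 7; 19; 0; 8; 13; 5; 3; 4] 18
      Conflict)))]))))); ([:: 1; 4; 10; 11], (Trace [:: 0; 1; 2; 3; 4; 17; 15; 7; 8; 16; 10] 11
      Conflict))]))]))]))])); ([:: 7; 8; 11], (Trace [:: 0; 1; 2; 3; 4; 5; 6; 7; 8; 9; 10] 13 (Vote 3 [:: (0,1);
      (1,1); (2,1); (3,1); (4,1); (7,1); (8,1); (11,1); (13,1)] [:: ([:: 2; 4; 7; 11], (Trace [:: 0; 1; 2; 14; 4; 5;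
      6; 7; 8; 11; 13] 10 Conflict)); ([:: 1; 3; 8; 11], (Trace [:: 0; 1; 14; 3; 4; 5; 11; 7; 8; 9; 13] 10
      Conflict))]))); ([:: 4; 10; 11], (Vote 3 [:: (0,1); (1,1); (2,1); (3,1); (4,1); (6,1); (7,1); (10,1); (13,1)]
      [:: ([:: 1; 3; 6; 13], (Trace [:: 0; 1; 14; 3; 4; 5; 6; 7; 13; 9; 10] 11 Conflict)); ([:: 0; 2; 7; 13], (Trace
      [:: 0; 4; 3; 2; 14; 13; 9; 8; 7; 6; 10] 11 Conflict))]))])); ([:: 7; 8; 11], (Trace [:: 0; 1; 2; 3; 4; 5; 6;
      7; 8; 9; 10] 12 (Common 11 10 (Vote 4 [:: (0,1); (1,1); (2,1); (3,1); (4,1); (5,1); (8,1); (9,1); (10,1);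
      (11,1); (12,1); (13,1)] [:: ([:: 0; 3; 5; 8; 13], (Trace [:: 0; 1; 2; 3; 14; 5; 6; 7; 8; 9; 12] 13 (Trace [::
      0; 1; 2; 3; 4; 5; 6; 7; 8; 9; 10] 13 (Vote 4 [:: (0,1); (1,1); (2,1); (3,1); (4,1); (5,1); (6,1); (7,1);
      (10,1); (11,1); (12,1); (13,1)] [:: ([:: 0; 2; 5; 7; 13], (Trace [:: 0; 4; 3; 2; 15; 5; 9; 8; 7; 6; 12] 13
      Conflict))]))))])))); ([:: 1; 10; 11], (Vote 3 [:: (0,1); (1,1); (2,1); (3,1); (4,1); (8,1); (9,1); (10,1);
      (12,1)] [:: ([:: 0; 3; 8; 12], (Trace [:: 0; 1; 2; 3; 13; 12; 6; 7; 8; 9; 10] 11 Conflict)); ([:: 2; 4; 9;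
      12], (Trace [:: 0; 1; 2; 13; 4; 5; 6; 12; 8; 9; 10] 11 Conflict))]))]));
      ([:: 5; 7], (Vote 4 [:: (0,2); (1,1); (2,1); (3,1); (4,1); (6,1); (7,1); (8,1); (9,1); (10,1); (11,1)] [::
      ([:: 0; 8; 11], (Vote 4 [:: (0,1); (1,1); (2,1); (3,1); (4,1); (5,1); (6,1); (7,1); (8,1); (10,1); (11,1);
      (12,1)] [:: ([:: 1; 3; 6; 8; 11], (Common 11 2 (Trace [:: 0; 1; 13; 3; 4; 5; 6; 7; 8; 9; 10] 14 (Trace [:: 0;
      1; 2; 3; 4; 5; 6; 7; 8; 9; 10] 14 (Vote 4 [:: (0,1); (1,1); (2,1); (3,1); (4,1); (5,1); (8,1); (9,1); (10,1);
      (11,1); (13,1); (14,1)] [:: ([:: 0; 3; 5; 14], (Trace [:: 0; 1; 2; 3; 15; 5; 6; 7; 14; 9; 10] 11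
      Conflict))])))))])); ([:: 1; 3; 6; 8; 11], (Common 11 2 (Trace [:: 0; 1; 12; 3; 4; 5; 6; 7; 8; 9; 10] 13
      (Trace [:: 0; 1; 2; 3; 4; 5; 6; 7; 8; 9; 10] 13 (Vote 4 [:: (0,1); (1,1); (2,1); (3,1); (4,1); (5,1); (8,1);
      (9,1); (10,1); (11,1); (12,1); (13,1)] [:: ([:: 0; 3; 5; 13], (Trace [:: 0; 1; 2; 3; 14; 5; 6; 7; 13; 9; 10]
      11 Conflict))]))))); ([:: 1; 4; 6; 9; 11], (Common 11 0 (Trace [:: 1; 2; 3; 4; 12; 6; 7; 8; 9; 5; 10] 13
      (Trace [:: 0; 1; 2; 3; 4; 5; 6; 7; 8; 9; 10] 13 (Vote 4 [:: (0,1); (1,1); (2,1); (3,1); (4,1); (7,1); (8,1);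
      (9,1); (10,1); (11,1); (12,1); (13,1)] [:: ([:: 2; 4; 7; 13], (Trace [:: 0; 1; 2; 14; 4; 5; 6; 7; 8; 13; 10]
      11 Conflict))]))))); ([:: 1; 8; 9; 11], (Trace [:: 3; 4; 8; 10; 9; 0; 2; 5; 12; 7; 1] 11 Conflict)); ([:: 0;
      2; 10; 11], (Trace [:: 0; 1; 2; 3; 4; 5; 12; 7; 8; 9; 10] 11 Conflict)); ([:: 0; 3; 10; 11], (Trace [:: 0; 1;
      2; 3; 4; 5; 6; 7; 8; 12; 10] 11 Conflict))]));
      ([::], (Vote 2 [:: (0,1); (1,1); (2,1); (3,1); (4,1); (11,1)] [:: ([:: 0; 2; 11], (Branch 7 12 (Vote
      2 [:: (0,1); (4,1); (7,1); (8,1); (10,1); (12,1)] [:: ([:: 0; 7; 8], (Trace [:: 2; 3; 7; 10; 8; 4; 12; 9; 13;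
      6; 0] 11 Conflict)); ([:: 4; 10; 12], (Trace [:: 0; 4; 3; 2; 12; 13; 9; 8; 7; 6; 10] 11 Conflict))]) (Trace
      [:: 0; 1; 2; 3; 4; 5; 6; 7; 8; 9; 10] 13 (Vote 4 [:: (0,1); (1,1); (2,1); (3,1); (4,1); (5,1); (7,1); (8,1);
      (9,1); (10,1); (12,1); (13,1)] [:: ([:: 5; 7; 8; 9; 12], (Trace [:: 0; 1; 2; 3; 4; 5; 12; 7; 8; 9; 14] 11
      Conflict)); ([:: 0; 3; 5; 8; 13], (Trace [:: 0; 1; 2; 3; 14; 5; 6; 7; 8; 9; 10] 11 (Branch 10 12 (Trace [:: 1;
      2; 12; 10; 7; 3; 0; 8; 13; 5; 14] 11 Conflict) (Trace [:: 0; 1; 2; 3; 14; 5; 6; 7; 8; 9; 10] 12 (Vote 3 [::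
      (0,1); (1,1); (2,1); (6,1); (7,1); (8,1); (10,1); (13,1); (14,1)] [:: ([:: 1; 6; 8; 13], (Vote 3 [:: (1,1);
      (2,1); (5,1); (8,1); (9,1); (10,1); (12,1); (13,1); (16,1)] [:: ([:: 1; 8; 9; 12], (Trace [:: 1; 5; 10; 8; 17;
      12; 7; 14; 9; 16; 13] 3 Conflict)); ([:: 5; 9; 16], (Trace [:: 0; 9; 10; 5; 14; 13; 6; 17; 8; 1; 16] 2
      Conflict))])); ([:: 2; 10; 13], (Trace [:: 5; 10; 7; 13; 14; 8; 1; 16; 3; 12; 2] 11 Conflict))])))))]))));
      ([:: 1; 3; 11], (Vote 4 [:: (0,1); (1,1); (2,1); (3,1); (4,1); (5,1); (6,1); (8,1); (9,1); (10,2); (12,1)] [::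
      ([:: 5; 6; 8; 9; 12], (Trace [:: 0; 1; 2; 3; 4; 5; 6; 12; 8; 9; 13] 11 Conflict)); ([:: 0; 10; 12], (Branch 6
      12 (Branch 8 12 (Trace [:: 0; 1; 12; 3; 4; 5; 6; 7; 8; 9; 10] 11 Conflict) (Trace [:: 0; 1; 2; 3; 4; 5; 6; 7;
      8; 9; 10] 14 (Vote 2 [:: (3,1); (5,1); (9,1); (10,1); (12,1); (14,1)] [:: ([:: 5; 9; 12], (Trace [:: 0; 1; 2;
      3; 4; 5; 6; 7; 8; 9; 10] 15 (Trace [:: 0; 4; 5; 10; 9; 3; 1; 8; 15; 6; 2] 12 Conflict))); ([:: 3; 10; 14],
      (Trace [:: 0; 6; 10; 8; 14; 12; 9; 2; 15; 4; 3] 11 Conflict))]))) (Trace [:: 0; 1; 2; 3; 4; 5; 6; 7; 8; 9; 10]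
      12 (Trace [:: 0; 1; 12; 3; 4; 5; 13; 7; 8; 9; 10] 11 Conflict)))); ([:: 2; 4; 10; 12], (Branch 6 12 (Trace [::
      0; 1; 12; 3; 4; 5; 6; 7; 13; 9; 10] 11 Conflict) (Trace [:: 0; 1; 2; 3; 4; 5; 6; 7; 13; 9; 10] 14 (Trace [::
      0; 1; 2; 3; 4; 5; 6; 7; 8; 9; 10] 12 (Vote 2 [:: (1,1); (5,1); (9,1); (10,1); (12,1); (14,1)] [:: ([:: 5; 9;
      12], (Trace [:: 0; 1; 2; 3; 4; 5; 6; 7; 8; 9; 10] 15 (Trace [:: 0; 4; 5; 10; 9; 3; 1; 8; 15; 6; 2] 12
      Conflict))); ([:: 1; 10; 14], (Trace [:: 4; 8; 10; 6; 14; 12; 5; 2; 15; 0; 1] 11 Conflict))])))))])); ([:: 2;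
      4; 11], (Vote 4 [:: (0,1); (1,1); (2,1); (3,1); (4,1); (5,1); (6,1); (7,1); (9,1); (10,2); (12,1)] [:: ([:: 5;
      6; 7; 9; 12], (Trace [:: 0; 1; 2; 3; 4; 5; 6; 7; 12; 9; 13] 11 Conflict)); ([:: 0; 10; 12], (Branch 9 12 (Vote
      2 [:: (1,1); (2,1); (5,1); (9,1); (10,1); (12,1)] [:: ([:: 2; 5; 9], (Trace [:: 0; 4; 5; 10; 9; 12; 1; 8; 14;
      6; 2] 11 Conflict)); ([:: 1; 10; 12], (Trace [:: 0; 1; 2; 12; 4; 5; 6; 14; 8; 9; 10] 11 Conflict))]) (Trace
      [:: 0; 1; 2; 3; 4; 5; 6; 7; 8; 9; 10] 12 (Trace [:: 0; 1; 2; 12; 4; 5; 6; 7; 8; 13; 10] 11 Conflict)))); ([::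
      1; 10; 12], (Vote 2 [:: (0,1); (4,1); (6,1); (10,1); (12,1); (13,1)] [:: ([:: 0; 10; 12], (Trace [:: 0; 1; 2;
      12; 4; 5; 6; 13; 8; 14; 10] 11 Conflict)); ([:: 4; 6; 13], (Trace [:: 1; 2; 6; 10; 13; 12; 0; 8; 14; 5; 4] 11
      Conflict))]))])); ([:: 0; 3; 11], (Vote 4 [:: (0,1); (1,1); (2,1); (3,1); (4,1); (5,1); (6,1); (7,1); (8,1);
      (10,2); (12,1)] [:: ([:: 5; 6; 7; 8; 12], (Trace [:: 0; 1; 2; 3; 4; 5; 6; 7; 8; 12; 13] 11 Conflict)); ([:: 1;
      10; 12], (Vote 2 [:: (2,1); (3,1); (6,1); (10,1); (12,1); (13,1)] [:: ([:: 2; 10; 12], (Trace [:: 0; 1; 2; 3;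
      12; 13; 6; 7; 14; 9; 10] 11 Conflict)); ([:: 3; 6; 13], (Trace [:: 0; 1; 13; 10; 6; 2; 12; 7; 14; 9; 3] 11
      Conflict))])); ([:: 2; 10; 12], (Vote 2 [:: (0,1); (1,1); (7,1); (10,1); (12,1); (13,1)] [:: ([:: 1; 10; 12],
      (Trace [:: 0; 1; 2; 3; 12; 14; 6; 7; 13; 9; 10] 11 Conflict)); ([:: 0; 7; 13], (Trace [:: 2; 3; 7; 10; 13; 12;
      1; 9; 14; 6; 0] 11 Conflict))]))])); ([:: 1; 4; 11], (Vote 4 [:: (0,1); (1,1); (2,1); (3,1); (4,1); (6,1);
      (7,1); (8,1); (9,1); (10,2); (12,1)] [:: ([:: 6; 7; 8; 9; 12], (Trace [:: 0; 1; 2; 3; 4; 12; 6; 7; 8; 9; 13]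
      11 Conflict)); ([:: 2; 10; 12], (Vote 2 [:: (3,1); (4,1); (7,1); (10,1); (12,1); (13,1)] [:: ([:: 3; 10; 12],
      (Trace [:: 1; 2; 3; 4; 12; 13; 7; 8; 14; 5; 10] 11 Conflict)); ([:: 4; 7; 13], (Trace [:: 1; 2; 13; 10; 7; 3;
      12; 8; 14; 5; 4] 11 Conflict))])); ([:: 3; 10; 12], (Branch 9 12 (Vote 2 [:: (1,1); (2,1); (8,1); (9,1);
      (10,1); (12,1)] [:: ([:: 1; 8; 9], (Trace [:: 3; 4; 8; 10; 9; 12; 2; 5; 14; 7; 1] 11 Conflict)); ([:: 2; 10;
      12], (Trace [:: 1; 2; 3; 4; 12; 14; 7; 8; 9; 5; 10] 11 Conflict))]) (Trace [:: 0; 1; 2; 3; 4; 5; 6; 7; 8; 9;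
      10] 12 (Trace [:: 1; 2; 3; 4; 12; 6; 7; 8; 13; 5; 10] 11 Conflict))))]))]))].

(* Upsilon_3^11: the core without green vertex 5 is 0..6, followed by a, b, c, u, v, w, x. *)
Definition vega3 : seq (nat * nat) :=
  [:: (0,3);(0,4);(1,4);(1,5);(2,5);(2,6);(3,5);(3,6);(4,6);
      (7,0);(7,1);(7,2);(10,0);(10,1);(10,2);(8,3);(8,4);(11,3);(11,4);(9,5);(9,6);(12,5);(12,6);
      (7,11);(11,9);(9,10);(10,8);(8,12);(12,7);(13,7);(13,8);(13,9)].

(** These traces survive [trace_steps]; their certificates may end in a copy of [vega3], so they are
    excluded only where that graph does not occur. What is left in [traces2] are the eleven
    neighbourhoods of the Groetzsch graph and the five sets [extra i]. *)
Definition vega3_steps : seq (seq nat * cert) :=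
  [:: ([:: 10; 2], (Vote 3 [:: (0,1); (1,1); (2,1); (3,1); (4,1); (5,1); (9,1); (10,1); (11,1)] [:: ([:: 0; 3; 5;
      11], (Branch 8 12 (Common 11 4 (Trace [:: 0; 1; 2; 3; 12; 5; 6; 7; 11; 9; 10] 13 (Trace [:: 0; 1; 2; 3; 12; 5;
      6; 7; 8; 9; 10] 13 (Embedded 0 [:: 6; 11; 8; 0; 13; 12; 4; 10; 1; 3; 2; 9; 5; 7])))) (Trace [:: 0; 1; 2; 3; 4;
      5; 6; 7; 8; 9; 10] 13 (Common 11 4 (Trace [:: 0; 1; 2; 3; 12; 5; 6; 7; 11; 9; 10] 14 (Vote 4 [:: (1,1); (2,1);
      (3,1); (4,1); (5,1); (8,1); (9,1); (10,1); (11,1); (12,1); (13,1); (14,1)] [:: ([:: 2; 5; 9; 13], (Trace [::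
      2; 6; 10; 9; 15; 13; 11; 0; 5; 3; 12] 4 Conflict))])))))); ([:: 1; 4; 9; 11], (Branch 6 12 (Common 11 0 (Trace
      [:: 1; 2; 3; 4; 12; 11; 7; 8; 9; 5; 10] 13 (Trace [:: 1; 2; 3; 4; 12; 6; 7; 8; 9; 5; 10] 13 (Embedded 0 [:: 6;
      11; 8; 0; 12; 13; 4; 10; 1; 3; 2; 9; 5; 7])))) (Trace [:: 0; 1; 2; 3; 4; 5; 6; 7; 8; 9; 10] 13 (Vote 3 [::
      (0,1); (1,1); (3,1); (4,1); (5,1); (6,1); (7,1); (10,1); (13,1)] [:: ([:: 0; 5; 7; 13], (Trace [:: 1; 2; 3; 4;
      12; 11; 7; 8; 9; 5; 10] 14 (Trace [:: 0; 4; 3; 13; 14; 5; 9; 8; 7; 6; 10] 11 Conflict))); ([:: 1; 10; 13],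
      (Trace [:: 1; 2; 3; 13; 12; 11; 7; 8; 9; 14; 10] 0 Conflict))]))))]));
      ([:: 6; 3; 1], (Vote 2 [:: (3,1); (4,1); (5,1); (6,1); (10,1); (11,1)] [:: ([:: 3; 5; 6], (Trace [:: 0; 1; 2;
      3; 4; 5; 6; 7; 8; 9; 10] 12 (Common 11 8 (Trace [:: 0; 1; 2; 3; 4; 5; 6; 7; 8; 9; 10] 13 (Trace [:: 0; 1; 5;
      10; 6; 2; 4; 7; 12; 9; 3] 13 (Embedded 0 [:: 11; 2; 12; 13; 1; 8; 5; 3; 0; 10; 6; 7; 4; 9])))))); ([:: 4; 10;
      11], (Branch 2 12 (Common 11 8 (Trace [:: 0; 1; 2; 3; 4; 5; 6; 7; 12; 9; 10] 13 (Embedded 0 [:: 5; 8; 12; 1;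
      13; 2; 11; 10; 0; 3; 4; 7; 6; 9]))) (Trace [:: 0; 1; 11; 3; 4; 5; 6; 7; 12; 9; 10] 13 (Vote 3 [:: (0,1);
      (1,1); (3,1); (7,1); (9,1); (10,1); (11,1); (12,1); (13,1)] [:: ([:: 3; 10; 13], (Trace [:: 0; 4; 3; 2; 13;
      12; 9; 8; 14; 6; 10] 11 Conflict)); ([:: 7; 9; 11; 13], (Trace [:: 0; 1; 11; 14; 13; 5; 6; 7; 12; 9; 10] 8
      (Trace [:: 0; 1; 2; 3; 4; 5; 6; 7; 8; 9; 10] 14 Conflict)))]))))]));
      ([:: 6; 9; 1], (Vote 3 [:: (1,1); (2,1); (3,1); (4,1); (5,1); (8,1); (9,1); (10,1); (11,1)] [:: ([:: 3; 5; 8;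
      11], (Vote 4 [:: (0,1); (1,1); (2,1); (3,1); (4,1); (5,1); (6,1); (8,1); (9,1); (10,1); (11,1); (12,1)] [::
      ([:: 0; 3; 5; 8; 11], (Common 11 4 (Trace [:: 0; 1; 2; 3; 13; 5; 6; 7; 8; 9; 10] 14 (Embedded 0 [:: 6; 14; 8;
      0; 11; 4; 13; 10; 1; 3; 2; 9; 5; 7])))); ([:: 1; 4; 6; 9; 12], (Common 11 4 (Trace [:: 1; 2; 3; 12; 13; 6; 7;
      8; 9; 5; 10] 14 (Embedded 0 [:: 6; 14; 8; 13; 11; 4; 12; 10; 1; 3; 2; 9; 5; 7]))))])); ([:: 2; 4; 10; 11],
      (Common 11 8 (Trace [:: 0; 1; 2; 3; 4; 5; 6; 7; 12; 9; 10] 13 (Trace [:: 3; 4; 12; 10; 9; 0; 2; 5; 11; 7; 1]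
      13 (Embedded 0 [:: 6; 12; 8; 0; 11; 4; 13; 10; 1; 3; 2; 9; 5; 7])))))]))].

(** Representatives, up to symmetry, of the disjoint pairs among the remaining traces. The last
    entry is different: its two traces meet, so forcing adjacency shows that they cannot both
    occur. *)
Definition pair_certs : seq (seq nat * seq nat * cert) :=
  [:: ([:: 1; 4; 10], [:: 5; 6; 7; 8; 9], (Trace [:: 0; 1; 2; 3; 4; 5; 6; 7; 8; 9; 12] 11 Conflict));
      ([:: 1; 4; 10], [:: 0; 2; 5; 7], (Trace [:: 0; 4; 3; 2; 12; 5; 9; 8; 7; 6; 10] 11 Conflict));
      ([:: 1; 4; 6; 9], [:: 0; 2; 5; 7], (Trace [:: 1; 2; 3; 4; 11; 6; 7; 8; 9; 5; 10] 12 Conflict));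
      ([:: 1; 4; 10], [:: 3; 5; 6; 8], (Trace [:: 0; 1; 2; 3; 4; 11; 6; 7; 8; 9; 10] 12 Conflict));
      ([:: 1; 4; 6; 9], [:: 0; 5; 7; 8], (Trace [:: 1; 2; 3; 4; 11; 6; 7; 8; 9; 5; 10] 12 Conflict));
      ([:: 1; 4; 10], [:: 0; 5; 7; 8], (Trace [:: 0; 1; 2; 3; 4; 11; 6; 7; 8; 9; 10] 12 Conflict));
      ([:: 0; 5; 7; 8], [:: 2; 5; 7; 9], (Trace [:: 0; 4; 5; 10; 9; 3; 1; 8; 12; 6; 2] 11 Conflict))].

(** No [Trace] step is available before a copy of the Groetzsch graph is known; every leaf exhibits
    such a copy. *)
Definition hexagon_cert : cert :=
  (Common 0 3 (Common 1 4 (Common 2 5 (Vote 2 [:: (0,1); (1,1); (3,1); (4,1); (6,1); (7,1)] [::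
      ([:: 1; 4; 6], (Vote 3 [:: (0,1); (1,1); (2,1); (3,1); (4,1); (5,1); (6,1); (8,1); (9,1)] [:: ([:: 1; 4; 6;
      8], (Vote 4 [:: (0,2); (1,2); (2,2); (3,2); (4,2); (5,2)] [:: ([:: 0; 2; 4], (Vote 4 [:: (0,2); (2,2); (3,2);
      (5,2); (6,2); (8,2)] [:: ([:: 2; 5; 6], (Embedded 0 [:: 0; 5; 4; 10; 6; 12; 11; 8; 3; 1; 2])); ([:: 0; 3; 8],
      (Embedded 0 [:: 2; 3; 4; 10; 8; 12; 11; 6; 5; 1; 0]))])); ([:: 1; 3; 5], (Vote 4 [:: (0,2); (2,2); (3,2);
      (5,2); (6,2); (8,2)] [:: ([:: 2; 5; 6], (Embedded 0 [:: 1; 2; 3; 6; 10; 8; 11; 12; 4; 0; 5])); ([:: 0; 3; 8],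
      (Embedded 0 [:: 0; 1; 10; 8; 5; 11; 6; 2; 4; 12; 3]))]))])); ([:: 0; 3; 8; 9], (Vote 4 [:: (0,2); (1,2);
      (2,2); (3,2); (4,2); (5,2)] [:: ([:: 0; 2; 4], (Vote 4 [:: (1,2); (2,2); (4,2); (5,2); (8,2); (9,2)] [:: ([::
      1; 4; 8], (Embedded 0 [:: 0; 1; 2; 8; 10; 9; 11; 12; 3; 5; 4])); ([:: 2; 5; 9], (Embedded 0 [:: 0; 5; 4; 9;
      10; 8; 11; 12; 3; 1; 2]))])); ([:: 1; 3; 5], (Vote 4 [:: (1,2); (2,2); (4,2); (5,2); (8,2); (9,2)] [:: ([:: 1;
      4; 8], (Embedded 0 [:: 3; 4; 5; 8; 10; 9; 11; 12; 0; 2; 1])); ([:: 2; 5; 9], (Embedded 0 [:: 1; 2; 3; 10; 9;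
      12; 11; 8; 4; 0; 5]))]))]))])); ([:: 0; 3; 7], (Vote 3 [:: (0,1); (1,1); (2,1); (3,1); (4,1); (5,1); (7,1);
      (8,1); (9,1)] [:: ([:: 0; 3; 7; 8], (Vote 4 [:: (0,2); (1,2); (2,2); (3,2); (4,2); (5,2)] [:: ([:: 0; 2; 4],
      (Vote 4 [:: (1,2); (2,2); (4,2); (5,2); (7,2); (8,2)] [:: ([:: 2; 5; 7], (Embedded 0 [:: 0; 5; 4; 7; 10; 8;
      11; 12; 3; 1; 2])); ([:: 1; 4; 8], (Embedded 0 [:: 0; 1; 2; 8; 10; 7; 11; 12; 3; 5; 4]))])); ([:: 1; 3; 5],
      (Vote 4 [:: (1,2); (2,2); (4,2); (5,2); (7,2); (8,2)] [:: ([:: 2; 5; 7], (Embedded 0 [:: 1; 2; 3; 10; 7; 12;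
      11; 8; 4; 0; 5])); ([:: 1; 4; 8], (Embedded 0 [:: 3; 4; 5; 8; 10; 7; 11; 12; 0; 2; 1]))]))])); ([:: 1; 4; 8;
      9], (Vote 4 [:: (0,2); (1,2); (2,2); (3,2); (4,2); (5,2)] [:: ([:: 0; 2; 4], (Vote 4 [:: (0,2); (2,2); (3,2);
      (5,2); (8,2); (9,2)] [:: ([:: 0; 3; 8], (Embedded 0 [:: 2; 3; 4; 10; 8; 12; 11; 9; 5; 1; 0])); ([:: 2; 5; 9],
      (Embedded 0 [:: 0; 5; 4; 10; 9; 12; 11; 8; 3; 1; 2]))])); ([:: 1; 3; 5], (Vote 4 [:: (0,2); (2,2); (3,2);
      (5,2); (8,2); (9,2)] [:: ([:: 0; 3; 8], (Embedded 0 [:: 0; 1; 10; 8; 5; 11; 9; 2; 4; 12; 3])); ([:: 2; 5; 9],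
      (Embedded 0 [:: 1; 2; 3; 9; 10; 8; 11; 12; 4; 0; 5]))]))]))]))])))).

(* Kinds 0..7 are the vertices a, b, c, u, v, w, x, y of a Vega graph; 8, 9, 10 are its colours. *)
Definition skeleton_edges : seq (nat * nat) :=
  [:: (0,4);(4,2);(2,3);(3,1);(1,5);(5,0);(6,0);(6,1);(6,2);(7,3);(7,4);(7,5);(6,7);
      (0,8);(3,8);(1,9);(4,9);(2,10);(5,10)].
Definition krel i j := haspair skeleton_edges i j || haspair skeleton_edges j i.
Definition kind_mask k := [seq krel k j | j <- iota 0 6].
(** The value 11 signals that [a] is not the mask of any kind. *)
Definition kind_of (a : seq bool) := index a [seq kind_mask k | k <- iota 0 11].

(** The hexagon on the six letters has eighteen independent sets. Its two triples are the masks of x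
    and y, the three antipodal pairs those of the colours, the six pairs at distance two those of
    the letters themselves. The empty set and the singletons remain to be refuted. *)
Definition type_certs : seq (seq nat * cert) :=
  [:: ([::], (Trace [:: 1; 4; 8; 12; 7; 11; 10; 6; 13; 5; 9] 14 Conflict));
      ([:: 0], (Trace [:: 1; 4; 8; 12; 7; 11; 10; 6; 13; 5; 9] 14 (Trace [:: 1; 5; 9; 11; 7; 12; 10; 3; 13;
      4; 8] 14 (Trace [:: 3; 6; 9; 10; 8; 12; 11; 2; 13; 0; 7] 14 Conflict))));
      ([:: 1], (Trace [:: 1; 4; 8; 12; 7; 11; 10; 6; 13; 5; 9] 14 (Trace [:: 4; 6; 9; 10; 8; 12; 11; 2; 13;
      1; 7] 14 (Trace [:: 4; 6; 9; 10; 8; 12; 11; 2; 13; 0; 7] 14 (Trace [:: 3; 5; 9; 10; 8; 12; 11; 2; 13; 0; 7] 14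
      Conflict)))));
      ([:: 2], (Trace [:: 1; 5; 9; 11; 7; 12; 10; 3; 13; 4; 8] 14 (Trace [:: 4; 6; 9; 10; 8; 12; 11; 2; 13;
      1; 7] 14 (Trace [:: 4; 6; 9; 10; 8; 12; 11; 2; 13; 0; 7] 14 (Trace [:: 3; 5; 9; 10; 8; 12; 11; 1; 13; 0; 7] 14
      Conflict)))));
      ([:: 3], (Trace [:: 1; 4; 8; 12; 7; 11; 10; 6; 13; 5; 9] 14 (Trace [:: 1; 5; 9; 11; 7; 12; 10; 3; 13;
      4; 8] 14 (Trace [:: 4; 6; 9; 10; 8; 12; 11; 2; 13; 1; 7] 14 (Trace [:: 3; 6; 9; 10; 8; 12; 11; 2; 13; 0; 7] 14
      Conflict)))));
      ([:: 4], (Trace [:: 1; 4; 8; 12; 7; 11; 10; 6; 13; 5; 9] 14 (Trace [:: 4; 6; 9; 10; 8; 12; 11; 2; 13;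
      1; 7] 14 (Trace [:: 3; 5; 9; 10; 8; 12; 11; 2; 13; 0; 7] 14 Conflict))));
      ([:: 5], (Trace [:: 1; 5; 9; 11; 7; 12; 10; 3; 13; 4; 8] 14 (Trace [:: 4; 6; 9; 10; 8; 12; 11; 2; 13;
      1; 7] 14 Conflict)))].

Definition kind_certs : seq (nat * nat * cert) :=
  [:: (0, 8, (Common 14 15 (Trace [:: 4; 6; 9; 10; 8; 12; 11; 2; 13; 1; 7] 14 (Trace [:: 4; 6; 9; 10; 8; 12; 11; 2; 13;
      1; 7] 16 Conflict))));
      (0, 3, (Trace [:: 4; 6; 9; 10; 8; 12; 11; 2; 13; 1; 7] 14 (Trace [:: 4; 6; 9; 10; 8; 12; 11; 2; 13;
      1; 7] 15 Conflict)));
      (0, 4, (Common 14 15 (Trace [:: 4; 6; 9; 10; 8; 12; 11; 2; 13; 1; 7] 14 (Trace [:: 4; 6; 9; 10; 8; 12; 11; 2; 13;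
      1; 7] 16 Conflict))));
      (0, 6, (Common 14 15 (Trace [:: 1; 4; 8; 12; 7; 11; 10; 6; 15; 5; 9] 14 (Trace [:: 4; 6; 9; 10; 8; 12; 11; 2; 15;
      1; 7] 14 Conflict))));
      (1, 9, (Common 14 15 (Trace [:: 1; 5; 9; 11; 7; 12; 10; 3; 13; 4; 8] 14 (Trace [:: 1; 5; 9; 11; 7; 12; 10; 3; 13;
      4; 8] 16 Conflict))));
      (1, 4, (Trace [:: 1; 5; 9; 11; 7; 12; 10; 3; 13; 4; 8] 14 (Trace [:: 1; 5; 9; 11; 7; 12; 10; 3; 13;
      4; 8] 15 Conflict)));
      (1, 5, (Common 14 15 (Trace [:: 1; 4; 8; 12; 7; 11; 10; 6; 13; 5; 9] 16 (Trace [:: 1; 5; 9; 11; 7; 12; 10; 3; 13;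
      4; 8] 14 (Trace [:: 1; 5; 9; 11; 7; 12; 10; 3; 13; 4; 8] 16 Conflict)))));
      (1, 6, (Common 14 15 (Trace [:: 1; 4; 8; 12; 7; 11; 10; 6; 15; 5; 9] 14 (Trace [:: 1; 5; 9; 11; 7; 12; 10; 3; 15;
      4; 8] 14 Conflict))));
      (2, 10, (Common 14 15 (Trace [:: 1; 4; 8; 12; 7; 11; 10; 6; 13; 5; 9] 14 (Trace [:: 1; 4; 8; 12; 7; 11; 10; 6; 13;
      5; 9] 16 Conflict))));
      (2, 3, (Common 14 15 (Trace [:: 1; 4; 8; 12; 7; 11; 10; 6; 13; 5; 9] 14 (Trace [:: 1; 4; 8; 12; 7; 11; 10; 6; 13;
      5; 9] 16 Conflict))));
      (2, 5, (Trace [:: 1; 4; 8; 12; 7; 11; 10; 6; 13; 5; 9] 14 (Trace [:: 1; 4; 8; 12; 7; 11; 10; 6; 13;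
      5; 9] 15 Conflict)));
      (2, 6, (Common 14 15 (Trace [:: 1; 4; 8; 12; 7; 11; 10; 6; 15; 5; 9] 14 Conflict)));
      (3, 8, (Common 14 15 (Trace [:: 1; 4; 8; 12; 7; 11; 10; 6; 13; 5; 9] 16 (Trace [:: 1; 5; 9; 11; 7; 12; 10; 3; 13;
      4; 8] 16 (Trace [:: 4; 6; 9; 10; 8; 12; 11; 2; 13; 1; 7] 16 (Trace [:: 3; 5; 9; 10; 8; 12; 11; 2; 13; 0; 7] 16
      (Trace [:: 3; 5; 9; 10; 8; 12; 11; 1; 13; 0; 7] 14 (Trace [:: 3; 5; 9; 10; 8; 12; 11; 1; 13; 0; 7] 16
      Conflict))))))));
      (3, 1, (Common 14 15 (Trace [:: 1; 5; 9; 11; 7; 12; 10; 3; 13; 4; 8] 15 (Trace [:: 1; 5; 9; 11; 7; 12; 10; 3; 13;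
      4; 8] 16 Conflict))));
      (3, 7, (Common 14 15 (Trace [:: 1; 4; 11; 9; 10; 8; 7; 6; 15; 5; 12] 14 (Trace [:: 4; 6; 12; 7; 11; 9; 8; 2; 15; 1;
      10] 14 Conflict))));
      (4, 9, (Common 14 15 (Trace [:: 1; 4; 8; 12; 7; 11; 10; 6; 13; 5; 9] 16 (Trace [:: 4; 6; 9; 10; 8; 12; 11; 2; 13;
      1; 7] 16 (Trace [:: 1; 5; 9; 11; 7; 12; 10; 3; 13; 4; 8] 16 (Vote 2 [:: (3,2); (14,2); (16,2)] [:: ([:: 3;
      14], (Trace [:: 1; 5; 9; 11; 7; 12; 10; 3; 13; 4; 8] 14 (Trace [:: 1; 5; 9; 11; 7; 12; 10; 3; 13; 4; 8] 16
      (Trace [:: 4; 6; 9; 10; 8; 12; 11; 2; 13; 1; 7] 16 Conflict)))); ([:: 3; 16], (Trace [:: 1; 5; 9; 11; 7; 12;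
      10; 3; 13; 4; 8] 16 (Trace [:: 4; 6; 9; 10; 8; 12; 11; 2; 13; 1; 7] 16 (Trace [:: 3; 6; 9; 10; 8; 12; 11; 2;
      13; 0; 7] 16 Conflict))))]))))));
      (4, 2, (Common 14 15 (Trace [:: 1; 4; 8; 12; 7; 11; 10; 6; 13; 5; 9] 15 (Trace [:: 1; 4; 8; 12; 7; 11; 10; 6; 13;
      5; 9] 16 Conflict))));
      (4, 7, (Common 14 15 (Trace [:: 1; 4; 11; 9; 10; 8; 7; 6; 15; 5; 12] 14 (Trace [:: 1; 5; 12; 8; 10; 9; 7; 3; 15; 4;
      11] 14 Conflict))));
      (5, 10, (Common 14 15 (Trace [:: 1; 5; 9; 11; 7; 12; 10; 3; 13; 4; 8] 16 (Trace [:: 3; 5; 9; 10; 8; 12; 11; 1; 13;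
      0; 7] 16 (Trace [:: 1; 4; 8; 12; 7; 11; 10; 6; 13; 5; 9] 16 (Vote 3 [:: (2,1); (4,1); (6,1); (7,1); (8,1);
      (9,1); (10,1); (11,1); (14,1)] [:: ([:: 2; 4; 9; 14], (Trace [:: 4; 8; 10; 9; 17; 14; 0; 13; 2; 11; 7] 5
      (Trace [:: 3; 5; 9; 10; 8; 12; 11; 2; 13; 0; 7] 16 (Trace [:: 1; 4; 11; 9; 10; 8; 7; 17; 16; 5; 14] 12
      Conflict)))); ([:: 6; 10; 11; 14], (Trace [:: 1; 4; 8; 12; 7; 11; 10; 6; 13; 5; 9] 14 (Trace [:: 1; 4; 8; 12;
      7; 11; 10; 6; 13; 5; 9] 17 Conflict)))]))))));
      (5, 0, (Common 14 15 (Trace [:: 1; 4; 8; 12; 7; 11; 10; 6; 13; 5; 9] 16 (Trace [:: 4; 6; 9; 10; 8; 12; 11; 2; 13;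
      1; 7] 15 (Trace [:: 4; 6; 9; 10; 8; 12; 11; 2; 13; 1; 7] 16 Conflict)))));
      (5, 7, (Common 14 15 (Trace [:: 1; 4; 11; 9; 10; 8; 7; 6; 15; 5; 12] 14 Conflict)));
      (6, 7, (Common 14 15 (Trace [:: 1; 4; 11; 9; 10; 8; 7; 6; 15; 5; 12] 14 Conflict)))].

Definition chain_certs : seq (nat * nat * cert) :=
  [:: (9, 10, (Vote 3 [:: (1,1); (4,1); (7,1); (8,1); (9,1); (10,1); (11,1); (12,1); (16,1)] [:: ([:: 4; 7;
      10; 16], (Trace [:: 7; 11; 9; 16; 18; 4; 13; 14; 10; 12; 8] 17 (Common 17 14 (Trace [:: 4; 8; 12; 7; 18; 10;
      6; 13; 16; 11; 9] 19 (Trace [:: 7; 11; 9; 16; 18; 4; 13; 14; 10; 12; 8] 19 (Trace [:: 7; 12; 8; 14; 19; 17;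
      13; 16; 10; 11; 9] 15 Conflict)))))); ([:: 1; 8; 11; 16], (Trace [:: 1; 7; 12; 8; 18; 11; 5; 13; 16; 10; 9] 15
      (Trace [:: 3; 5; 9; 10; 8; 12; 11; 2; 13; 0; 7] 15 (Common 17 14 (Trace [:: 1; 7; 12; 8; 15; 11; 5; 13; 17;
      10; 9] 19 (Trace [:: 1; 5; 9; 11; 7; 12; 10; 3; 13; 15; 8] 19 (Trace [:: 7; 12; 8; 14; 19; 17; 13; 16; 10; 11;
      9] 15 Conflict)))))))]));
      (8, 10, (Vote 2 [:: (1,2); (4,2); (17,2)] [:: ([:: 1; 17], (Trace [:: 3; 5; 9; 10; 8; 12; 11; 2; 13;
      0; 7] 18 (Vote 2 [:: (0,1); (7,1); (9,1); (13,1); (17,1); (18,1)] [:: ([:: 0; 13; 17], (Trace [:: 0; 7; 13; 8;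
      10; 15; 19; 12; 9; 18; 17] 5 Conflict)); ([:: 7; 9; 18], (Trace [:: 1; 7; 12; 8; 18; 19; 5; 13; 17; 10; 9] 15
      (Trace [:: 8; 10; 9; 17; 18; 1; 13; 15; 19; 12; 7] 16 (Trace [:: 3; 5; 9; 10; 8; 12; 11; 15; 13; 0; 7] 18
      (Common 17 14 (Trace [:: 1; 7; 12; 8; 18; 11; 5; 13; 16; 10; 9] 20 (Trace [:: 8; 10; 9; 16; 18; 1; 13; 14; 11;
      12; 7] 20 (Trace [:: 7; 12; 8; 20; 14; 16; 13; 17; 10; 11; 9] 15 Conflict))))))))]))); ([:: 4; 17], (Trace [::
      4; 6; 9; 10; 8; 12; 11; 2; 13; 1; 7] 17 (Vote 2 [:: (4,2); (14,2); (16,2)] [:: ([:: 4; 14], (Trace [:: 1; 5;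
      9; 11; 7; 12; 10; 3; 13; 4; 8] 19 (Trace [:: 3; 5; 9; 10; 8; 12; 11; 1; 13; 0; 7] 19 (Trace [:: 4; 8; 10; 9;
      19; 12; 1; 13; 14; 11; 7] 17 Conflict)))); ([:: 4; 16], (Trace [:: 4; 6; 9; 10; 8; 12; 11; 2; 13; 1; 7] 16
      (Vote 3 [:: (4,1); (6,1); (7,1); (8,1); (9,1); (10,1); (11,1); (12,1); (15,1)] [:: ([:: 6; 8; 11; 15], (Common
      17 14 (Trace [:: 7; 12; 8; 20; 15; 17; 13; 6; 10; 11; 9] 21 (Trace [:: 6; 9; 10; 8; 20; 11; 2; 13; 15; 12; 7]
      21 (Trace [:: 7; 12; 8; 21; 14; 16; 13; 17; 10; 11; 9] 15 Conflict))))); ([:: 4; 9; 12; 15], (Trace [:: 4; 8;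
      10; 9; 20; 12; 1; 13; 15; 11; 7] 16 Conflict))])))])))]));
      (8, 9, (Vote 3 [:: (1,1); (5,1); (7,1); (8,1); (9,1); (10,1); (11,1); (12,1); (17,1)] [:: ([:: 5; 7;
      10; 17], (Trace [:: 5; 9; 11; 7; 18; 10; 3; 13; 17; 12; 8] 14 (Trace [:: 5; 9; 11; 7; 14; 10; 3; 13; 16; 12;
      8] 15 (Common 17 14 (Trace [:: 5; 9; 11; 7; 15; 10; 3; 13; 17; 12; 8] 19 (Trace [:: 3; 5; 9; 10; 8; 12; 11;
      15; 13; 0; 7] 19 (Trace [:: 7; 12; 8; 17; 15; 5; 13; 19; 10; 11; 9] 16 Conflict))))))); ([:: 1; 9; 12; 17],
      (Trace [:: 1; 4; 8; 12; 7; 11; 10; 6; 13; 18; 9] 2 (Trace [:: 8; 10; 9; 18; 17; 15; 13; 1; 11; 12; 7] 16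
      (Common 17 14 (Trace [:: 1; 7; 11; 9; 18; 12; 4; 13; 16; 10; 8] 19 (Trace [:: 8; 10; 9; 18; 16; 14; 13; 2; 11;
      12; 7] 19 (Trace [:: 7; 12; 8; 16; 14; 19; 13; 18; 10; 11; 9] 15 Conflict)))))))]))].

Definition type_conf a := Conf 15 (att true 14 7 a ++ vega3) (att false 14 7 a).
(** As a number, [b] makes [nseq] produce one copy of the pair 14, 15 or none, so the pair becomes
    an edge or a non-edge according to [b]. *)
Definition kind_conf k l (b : bool) :=
  Conf 16 (nseq b (14, 15) ++ att true 14 7 (kind_mask k) ++ att true 15 7 (kind_mask l) ++ vega3)
    (nseq (~~ b) (14, 15) ++ att false 14 7 (kind_mask k) ++ att false 15 7 (kind_mask l)).
(** Two disjoint edges between two colours such that neither crossing pair is adjacent. Excluding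
    this pattern is what makes the neighbourhoods a chain. *)
Definition chain_conf k l :=
  let f b := att b 14 7 (kind_mask k) ++ att b 15 7 (kind_mask k) ++
             att b 16 7 (kind_mask l) ++ att b 17 7 (kind_mask l) in
  Conf 18 ([:: (14, 16); (15, 17)] ++ f true ++ vega3) ([:: (14, 17); (15, 16)] ++ f false).

Definition traces0 := [seq a <- bseqs 11 | indep_mask groetzsch a].
Definition traces1 := foldl surviving traces0 (unzip1 trace_steps).
Definition traces2 := foldl surviving traces1 (unzip1 vega3_steps).

Definition kind_certified k l :=
  has (fun c => if c.1 == (k, l) then check traces1 [::] (kind_conf k l (~~ krel k l)) c.2 else false) kind_certs.
Definition sharing (a b : seq bool) := has (fun p => p.1 && p.2) (zip a b).

Lemma trace_steps_ok : check_steps [::] traces0 trace_steps.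
Proof. by vm_compute. Qed.

Lemma vega3_steps_ok : check_steps [:: vega3] traces1 vega3_steps.
Proof. by vm_compute. Qed.

Lemma pair_certs_ok :
  all (fun c => check traces2 [:: vega3] (pair_conf c.1.1 c.1.2) c.2) pair_certs.
Proof. by vm_compute. Qed.

Lemma type_certs_ok : all (fun a => [|| kind_of a < 11, ~~ indep_mask skeleton_edges a
   | has (fun c => if mask_of 6 c.1 == a then check traces1 [::] (type_conf a) c.2 else false) type_certs]) (bseqs 6).
Proof. by vm_compute. Qed.

(** Adjacency is left open for two different colours and excluded by triangle-freeness when the
    kinds share a letter as neighbour. In all other cases a certificate, listed for one order of the
    two kinds, refutes the opposite of [krel]. *)
Lemma kind_certs_ok : all (fun k => all (fun l =>
  [|| (7 < k) && (7 < l) && (k != l), sharing (kind_mask k) (kind_mask l) && ~~ krel k l,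
      kind_certified k l | kind_certified l k]) (iota 0 11)) (iota 0 11).
Proof. by vm_compute. Qed.

Lemma chain_certs_ok : all (fun k => all (fun l =>
  (k < l) ==> has (fun c => if c.1 == (k, l) then check traces1 [::] (chain_conf k l) c.2 else false) chain_certs)
    [:: 8; 9; 10]) [:: 8; 9; 10].
Proof. by vm_compute. Qed.

Definition hexagon_edges := [:: (0,1);(1,2);(2,3);(3,4);(4,5);(5,0)].
Lemma hexagon_cert_ok :
  check traces0 [:: groetzsch] (Conf 6 hexagon_edges [:: (0,3);(1,4);(2,5)]) hexagon_cert.
Proof. by vm_compute. Qed.

(** * From the certificates to a skeleton *)

(** All that later arguments know about a graph with an induced hexagon. Adjacency is prescribed
    except between different colours, where only the chain condition is recorded; kind 7, the vertex
    y, is the one kind that may be absent. *)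
Record skeleton (T : finType) (e : rel T) (tau : T -> nat) : Prop := {
  sk_lt : forall p, tau p < 11;
  sk_rel : forall p q, [|| tau p < 8, tau q < 8 | tau p == tau q] -> e p q = krel (tau p) (tau q);
  sk_chain : forall p p' q q', 7 < tau p -> 7 < tau q -> tau p = tau p' -> tau q = tau q' ->
    e p q -> e p' q' -> e p q' || e p' q;
  sk_onto : forall k, k < 11 -> k != 7 -> exists p, tau p = k }.

Lemma krelC k l : krel k l = krel l k.
Proof. by rewrite /krel orbC. Qed.

(** Since [vega3] is found only as a subgraph, its vertices must reveal their kinds through known
    edges and non-edges. For each kind other than y some vertex is compatible with that mask
    alone. *)
Lemma vega3_kinds : all (fun k => (k == 7) || has (fun i => all (fun m =>
  compat (known (Conf 14 vega3 [::]) i (iota 7 6)) (kind_mask m) ==> (m == k))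
    (iota 0 11)) (iota 0 14)) (iota 0 11).
Proof. by vm_compute. Qed.

Local Opaque kind_mask krel kind_of.

Section Skeleton.
Variables (T : finType) (e : rel T).
Hypotheses (e_sym : symmetric e) (e_irr : irreflexive e).
Hypothesis e_mtf : maximal_triangle_free e.
Hypothesis e_D : prop_D e 4.

Lemma traces1_ok : traces_ok e traces1.
Proof.
apply: (check_steps_ok e_sym e_irr e_mtf e_D (@reachedN0 _ e) trace_steps_ok).
exact: traces_ok_start.
Qed.

Lemma sharing_nonadj n h p q : sharing (trace e n h p) (trace e n h q) -> ~~ e p q.
Proof.
case/(has_nthP (false, false))=> i; rewrite size_zip !size_trace minnn => ni.
rewrite nth_zip ?size_trace //= !nth_trace // => /andP[pi qi].
exact: (common_nbrN e_sym e_mtf pi qi).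
Qed.

(** * Graphs that contain Upsilon_3^11 *)

Section Vega3.
Variable h : nat -> T.
Hypothesis hh : maps e vega3 h.

Let ltr := trace e 6 (fun j => h (7 + j)).

Lemma facts_letters b n phi v p a :
  v < n -> 13 <= n -> (forall k, k < 14 -> phi k = h k) -> phi v = p -> ltr p = a ->
  all (fact e b n phi) (att b v 7 a).
Proof.
move=> vn n14 phih phiv Ha; have sa : size a = 6 by rewrite -Ha size_trace.
apply: facts_att; rewrite ?sa // -Ha; apply/eq_in_map=> i; rewrite mem_iota => /andP[_ i6].
by rewrite phiv phih // -[14]/(7 + 7) ltn_add2l (leq_trans i6).
Qed.

Lemma facts_vega3 N phi : (forall k, k < 14 -> phi k = h k) -> 14 <= N ->
  all (fact e true N phi) vega3.
Proof. by move=> phih; apply: (facts_pattern (n := 14) _ phih hh). Qed.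

Lemma contradiction c phi t : models e c phi -> ~~ check traces1 [::] c t.
Proof.
move=> Hc; apply/negP=> /(check_sound e_sym e_irr e_mtf e_D traces1_ok Hc).
exact: reachedN0.
Qed.

Lemma ltr_indep p : indep_mask skeleton_edges (ltr p).
Proof.
apply/allP=> -[i j] ij /=; case: (ltnP i 6) => i6; last by rewrite nth_default ?size_trace.
case: (ltnP j 6) => j6; last by rewrite andbC nth_default ?size_trace.
rewrite !nth_trace //; apply/negP=> /andP[pi pj]; apply: (no_triangle e_sym e_mtf pi _ pj).
have /allP/(_ _ ij) : all (fun p => (p.1 < 6) && (p.2 < 6) ==> ((7 + p.1, 7 + p.2) \in vega3))
  skeleton_edges by vm_compute.
by rewrite /= i6 j6 => /(allP hh).
Qed.

Lemma kind_of_lt p : kind_of (ltr p) < 11.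
Proof.
have := allP type_certs_ok (ltr p); rewrite -{1}(size_trace e 6 (fun j => h (7 + j)) p).
rewrite mem_bseqs ltr_indep => /(_ isT)/orP[] // /has_exists[c]; case: ifP => // /eqP _ H.
pose phi k := if k < 14 then h k else p.
have phih k : k < 14 -> phi k = h k by rewrite /phi => ->.
have Hm : models e (type_conf (ltr p)) phi.
  have f b : all (fact e b 15 phi) (att b 14 7 (ltr p)) by apply: facts_letters.
  by apply: (models_intro e_sym) => //; rewrite all_cat f facts_vega3.
by have := contradiction c.2 Hm; rewrite H.
Qed.

Lemma kind_ofP p : ltr p = kind_mask (kind_of (ltr p)).
Proof.
have tp := kind_of_lt p; have lp : ltr p \in [seq kind_mask k | k <- iota 0 11].
  by rewrite -index_mem size_map size_iota.
by rewrite -[LHS](nth_index [::] lp) (nth_map 0) ?size_iota // nth_iota.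
Qed.

Section Kinds.
Variable tau : T -> nat.
Hypotheses (tau_lt : forall p, tau p < 11) (tauP : forall p, ltr p = kind_mask (tau p)).

Lemma kind_models p q : models e (kind_conf (tau p) (tau q) (e p q))
  (fun k => if k < 14 then h k else if k == 14 then p else q).
Proof.
set phi := fun k => _; have phih k : k < 14 -> phi k = h k by rewrite /phi => ->.
have f1 b : all (fact e b 16 phi) (att b 14 7 (kind_mask (tau p))).
  by apply: facts_letters (tauP p).
have f2 b : all (fact e b 16 phi) (att b 15 7 (kind_mask (tau q))).
  by apply: facts_letters (tauP q).
have f3 b : all (fact e b 16 phi) (nseq (e p q == b) (14, 15)).
  by rewrite all_nseq; case E: (e p q == b); rewrite /fact /= ?E.
rewrite /kind_conf; apply: (models_intro e_sym); rewrite !all_cat.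
  apply/and4P; split; [|exact: f1|exact: f2|exact: facts_vega3].
  by have := f3 true; rewrite eqb_id.
by apply/and3P; split; [have := f3 false; rewrite eqbF_neg|exact: f1|exact: f2].
Qed.

Lemma tau_rel p q : [|| tau p < 8, tau q < 8 | tau p == tau q] ->
  e p q = krel (tau p) (tau q).
Proof.
have cert k l p' q' : tau p' = k -> tau q' = l -> kind_certified k l -> e p' q' = krel k l.
  move=> <- <- /has_exists[c]; case: ifP => // _ H; have := contradiction c.2 (kind_models p' q').
  by case: (krel _ _) (e _ _) H => [] [] // ->.
move=> Hpq; have /allP/(_ (tau p)) := kind_certs_ok; rewrite mem_iota tau_lt => /(_ isT).
move=> /allP/(_ (tau q)); rewrite mem_iota tau_lt => /(_ isT)/or4P[H|/andP[H]|H|H].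
- by case/andP: H Hpq => /andP[p7 q7] /negPf->; rewrite ![_ < 8]ltnNge p7 q7.
- move/negPf=> ->; move: H; rewrite -!tauP => H.
  have H2 := @sharing_nonadj 6 (fun j => h (7 + j)) p q H.
  exact: negbTE H2.
- exact: cert H.
by rewrite e_sym krelC; apply: cert H.
Qed.

Lemma tau_chain p p' q q' : 7 < tau p -> 7 < tau q -> tau p = tau p' -> tau q = tau q' ->
  e p q -> e p' q' -> e p q' || e p' q.
Proof.
have main k l r r' s s' : k < l -> k \in [:: 8; 9; 10] -> l \in [:: 8; 9; 10] ->
    tau r = k -> tau r' = k -> tau s = l -> tau s' = l -> e r s -> e r' s' -> e r s' || e r' s.
  move=> kl k8 l8 rk r'k sl s'l rs r's'; apply/negPn/negP; rewrite negb_or => /andP[rs' r's].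
  have /has_exists[c] := implyP (allP (allP chain_certs_ok k k8) l l8) kl; case: ifP => // _ H.
  pose phi i := if i < 14 then h i else nth s' [:: r; r'; s] (i - 14).
  have phih i : i < 14 -> phi i = h i by rewrite /phi => ->.
  have f b v t : v < 18 -> phi v = t -> all (fact e b 18 phi) (att b v 7 (kind_mask (tau t))).
    by move=> v18 phiv; apply: facts_letters (tauP t).
  have Hm : models e (chain_conf k l) phi.
    have f4 b : all (fact e b 18 phi) (att b 14 7 (kind_mask k) ++ att b 15 7 (kind_mask k) ++
             att b 16 7 (kind_mask l) ++ att b 17 7 (kind_mask l)).
      rewrite !all_cat -{1}rk -{1}r'k -{1}sl -{1}s'l.
      by apply/and4P; split; apply: f.
    rewrite /chain_conf; apply: (models_intro e_sym); rewrite all_cat; apply/andP; split.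
    - by rewrite /= /fact /= rs r's'.
    - by rewrite all_cat; apply/andP; split; [exact: f4|exact: facts_vega3].
    - by rewrite /= /fact /= (negPf rs') (negPf r's).
    exact: f4.
  by have := contradiction c.2 Hm; rewrite H.
have colour r : 7 < tau r -> tau r \in [:: 8; 9; 10].
  by have := tau_lt r; case: (tau r) => [|[|[|[|[|[|[|[|[|[|[|]]]]]]]]]]].
move=> p7 q7 pp' qq' pq p'q'; case: (ltngtP (tau p) (tau q)) => [lt|lt|eq].
- by apply: (main _ _ _ _ _ _ lt) => //; apply: colour.
- rewrite (e_sym p) (e_sym p') orbC; apply: (main _ _ _ _ _ _ lt); rewrite ?colour //.
    by rewrite e_sym.
  by rewrite e_sym.
(* Vertices of the same colour are never adjacent, which contradicts [e p q]. *)
have := tau_rel (p := p) (q := q); rewrite pq eq eqxx !orbT => /(_ isT).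
by case: (tau q) q7 (tau_lt q) => [|[|[|[|[|[|[|[|[|[|[|]]]]]]]]]]].
Qed.

End Kinds.

Lemma vega3_skeleton : exists tau, skeleton e tau.
Proof.
have [tau tP] : exists tau : T -> nat, forall p, tau p < 11 /\ ltr p = kind_mask (tau p).
  by exists (fun p => kind_of (ltr p)) => p; split; [exact: kind_of_lt|exact: kind_ofP].
have lt p := (tP p).1; have mask p := (tP p).2.
exists tau; split; [exact: lt | exact: tau_rel | exact: tau_chain | move=> k k11 k7].
have /allP/(_ k) := vega3_kinds; rewrite mem_iota k11 (negPf k7) => /(_ isT)/hasP[i].
rewrite mem_iota => /andP[_ i14] /allP/(_ (tau (h i))); rewrite mem_iota lt => /(_ isT)/implyP H.
exists (h i); apply/eqP/H; rewrite -mask.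
have Hm : models e (Conf 14 vega3 [::]) h by apply: (models_intro e_sym) => //; exact: facts_vega3.
exact: (compat_known e_sym e_irr e_mtf i (iota 7 6) Hm).
Qed.

End Vega3.
End Skeleton.

(** * Graphs without Upsilon_3^11 *)

Definition apart (a b : seq bool) := ~~ sharing a b.
Definition pair_listed a b := has (fun c => has (fun s =>
  ((relabel s a == mask_of 11 c.1.1) && (relabel s b == mask_of 11 c.1.2)) ||
  ((relabel s b == mask_of 11 c.1.1) && (relabel s a == mask_of 11 c.1.2))) dihedral) pair_certs.

(** Disjoint traces are covered by certificates and so force adjacency, while traces that meet
    forbid it. Hence the traces determine the graph, see [adj_apart]. *)
Lemma apart_listed : all (fun a => all (fun b => apart a b ==> pair_listed a b) traces2) traces2.
Proof. by vm_compute. Qed.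

(** The traces in [traces2] that are not neighbourhoods within the Groetzsch graph, indexed by the
    single pentagon vertex that they contain. *)
Definition extra i := mask_of 11 [:: i; 5 + i; 5 + (i + 2) %% 5; 5 + (i + 3) %% 5].
Definition rot k := nth [::] dihedral k.

(** The certificates force adjacency although the traces meet, so the two cannot both occur. The
    indices that occur therefore contain no two at distance two modulo 5 and lie in a pair of
    consecutive ones, which a rotation brings to 0 and 1. *)
Lemma extra_conflict :
  all (fun i => pair_listed (extra i) (extra ((i + 2) %% 5)) && sharing (extra i) (extra ((i + 2) %% 5)))
    (iota 0 5).
Proof. by vm_compute. Qed.

Lemma extra_rot : all (fun k => all (fun a => all (fun j =>
  (relabel (rot k) a == extra j) ==> (a == extra ((j + k) %% 5))) (iota 0 5)) traces2) (iota 0 5).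
Proof. by vm_compute. Qed.

Definition traces3 := [seq a <- traces2 | a \notin [:: extra 2; extra 3; extra 4]].

(* In the Groetzsch labelling a, b, c, u, v, w are 10, 1, 4, 0, 8, 7; [extra 0] is y and [extra 1] is green. *)
Definition letters := [:: 10; 1; 4; 0; 8; 7].
Definition kind2 a := kind_of (relabel letters a).

Lemma kind2_lt : all (fun a => kind2 a < 11) traces3.
Proof. by vm_compute. Qed.

Lemma kind2_rel : all (fun a => all (fun b =>
  [|| kind2 a < 8, kind2 b < 8 | kind2 a == kind2 b] ==> (apart a b == krel (kind2 a) (kind2 b)))
  traces3) traces3.
Proof. by vm_compute. Qed.

(** Restricting to these keeps the fourfold enumeration in [kind2_chain] small. *)
Definition coloured := [seq a <- traces3 | 7 < kind2 a].
Lemma kind2_chain : all (fun a => all (fun a' => all (fun b => all (fun b' =>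
  [&& kind2 a == kind2 a', kind2 b == kind2 b', apart a b & apart a' b'] ==> (apart a b' || apart a' b))
  coloured) coloured) coloured) coloured.
Proof. by vm_compute. Qed.

Definition row i := [seq haspair groetzsch i j || haspair groetzsch j i | j <- iota 0 11].
(** The trace of [h i] contains [row i] because [h] preserves edges, and for a suitable [i] all
    admissible traces containing [row i] have the kind sought. *)
Lemma kind2_onto : all (fun k => (k == 7) || has (fun i => all (fun a =>
  all (fun j => nth false (row i) j ==> nth false a j) (iota 0 11) ==> (kind2 a == k)) traces3)
    (iota 0 11)) (iota 0 11).
Proof. by vm_compute. Qed.

Local Opaque kind2 apart.

Section NoVega3.
Variables (T : finType) (e : rel T).
Hypotheses (e_sym : symmetric e) (e_irr : irreflexive e).
Hypothesis e_mtf : maximal_triangle_free e.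
Hypothesis e_D : prop_D e 4.
Hypothesis no_vega3 : ~ reached e [:: vega3].

Lemma traces2_ok : traces_ok e traces2.
Proof.
apply: (check_steps_ok e_sym e_irr e_mtf e_D no_vega3 vega3_steps_ok).
exact: traces1_ok.
Qed.

Lemma listed_adj h p q : maps e groetzsch h ->
  pair_listed (trace e 11 h p) (trace e 11 h q) -> e p q.
Proof.
move=> hh Hpq.
(* The accepted check is carried along with the matching entry, because [has_exists] will forget
   where the entry came from. *)
have {Hpq} : has (fun c => check traces2 [:: vega3] (pair_conf c.1.1 c.1.2) c.2 &&
    has (fun s => ((relabel s (trace e 11 h p) == mask_of 11 c.1.1) &&
                   (relabel s (trace e 11 h q) == mask_of 11 c.1.2)) ||
                  ((relabel s (trace e 11 h q) == mask_of 11 c.1.1) &&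
                   (relabel s (trace e 11 h p) == mask_of 11 c.1.2))) dihedral) pair_certs.
  move: Hpq pair_certs_ok; rewrite /pair_listed; elim: pair_certs => //= c l IH.
  by case/orP=> [Hc /andP[-> _]|Hl /andP[_ /(IH Hl)->]]; rewrite ?Hc ?orbT.
case/has_exists=> -[[t1 t2] c] /andP[chk /hasP[s sd]]; rewrite [_.1.1]/= [_.1.2]/= in chk *.
rewrite -!(trace_dihedral e h _ sd) => /orP[] /andP[/eqP H1 /eqP H2].
  by apply: (pair_refuted e_sym e_irr e_mtf e_D no_vega3 chk traces2_ok (maps_dihedral e_sym sd hh)).
rewrite e_sym.
by apply: (pair_refuted e_sym e_irr e_mtf e_D no_vega3 chk traces2_ok (maps_dihedral e_sym sd hh)).
Qed.

Lemma adj_apart h p q : maps e groetzsch h -> e p q = apart (trace e 11 h p) (trace e 11 h q).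
Proof.
move=> hh; have tr := traces2_ok hh; apply/idP/idP=> [pq | ap].
  by apply/negP=> /(sharing_nonadj e_sym e_mtf); rewrite pq.
apply: (listed_adj hh); exact: (implyP (allP (allP apart_listed _ (tr p)) _ (tr q))).
Qed.

Lemma good_rotation h0 : maps e groetzsch h0 ->
  exists2 h, maps e groetzsch h & forall p, trace e 11 h p \in traces3.
Proof.
move=> hh0; pose occ i := [exists p, trace e 11 h0 p == extra i].
have conf i : i < 5 -> ~~ (occ i && occ ((i + 2) %% 5)).
  move=> i5; rewrite /occ; apply/negP=> /andP[/existsP[p /eqP Hp] /existsP[q /eqP Hq]].
  have := allP extra_conflict i; rewrite mem_iota i5 => /(_ isT)/andP[L S].
  rewrite -Hp -Hq in L S; have := sharing_nonadj e_sym e_mtf S.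
  by rewrite (listed_adj hh0 L).
(* The exclusions [conf] form a 5-cycle on the indices, and an independent set of this cycle lies in
   some k, k + 1 modulo 5. *)
have [k k5 /and3P[n2 n3 n4]] : exists2 k, k < 5 &
    [&& ~~ occ ((2 + k) %% 5), ~~ occ ((3 + k) %% 5) & ~~ occ ((4 + k) %% 5)].
  move: (conf 0 isT) (conf 1 isT) (conf 2 isT) (conf 3 isT) (conf 4 isT).
  rewrite /=.
  case E0: (occ 0); case E1: (occ 1); case E2: (occ 2); case E3: (occ 3); case E4: (occ 4) => //= _ _ _ _ _.
  all: try by exists 0; rewrite //= ?E0 ?E1 ?E2 ?E3 ?E4.
  all: try by exists 1; rewrite //= ?E0 ?E1 ?E2 ?E3 ?E4.
  all: try by exists 2; rewrite //= ?E0 ?E1 ?E2 ?E3 ?E4.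
  all: try by exists 3; rewrite //= ?E0 ?E1 ?E2 ?E3 ?E4.
  all: try by exists 4; rewrite //= ?E0 ?E1 ?E2 ?E3 ?E4.
have kd : rot k \in dihedral by apply: mem_nth; rewrite (leq_trans k5).
exists (fun i => h0 (nth 0 (rot k) i)) => [|p]; first exact: maps_dihedral.
rewrite mem_filter traces2_ok ?andbT; last exact: maps_dihedral.
apply/negP=> H; rewrite (trace_dihedral e h0 p kd) in H.
have Hk j : j < 5 -> relabel (rot k) (trace e 11 h0 p) == extra j -> occ ((j + k) %% 5).
  move=> j5 Hj; apply/existsP; exists p.
  have ki : k \in iota 0 5 by rewrite mem_iota.
  have ji : j \in iota 0 5 by rewrite mem_iota.
  exact: (implyP (allP (allP (allP extra_rot k ki) _ (traces2_ok hh0 p)) j ji) Hj).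
by move: H; rewrite !inE => /or3P[] /Hk H; [move: n2|move: n3|move: n4]; rewrite H.
Qed.

Lemma no_vega3_skeleton h0 : maps e groetzsch h0 -> exists tau, skeleton e tau.
Proof.
case/good_rotation=> h hh tr; pose tau p := kind2 (trace e 11 h p).
have adjE p q : e p q = apart (trace e 11 h p) (trace e 11 h q) by apply: adj_apart.
have col p : 7 < tau p -> trace e 11 h p \in coloured by move=> p7; rewrite mem_filter tr andbT.
exists tau; split=> [p|p q H|p p' q q' p7 q7 pp qq pq p'q'|k k11 k7].
- exact: (allP kind2_lt).
- by rewrite adjE; apply/eqP; apply: (implyP (allP (allP kind2_rel _ (tr p)) _ (tr q))).
- have c' : trace e 11 h p' \in coloured by apply: col; rewrite -pp.
  have d' : trace e 11 h q' \in coloured by apply: col; rewrite -qq.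
  have := allP (allP (allP (allP kind2_chain _ (col p p7)) _ c') _ (col q q7)) _ d'.
  by rewrite !adjE in pq p'q' *; rewrite -!/(tau _) pp qq !eqxx pq p'q'.
have ki : k \in iota 0 11 by rewrite mem_iota.
have := allP kind2_onto k ki; rewrite (negPf k7) orFb => /hasP[i].
rewrite mem_iota => /andP[_ i11] Hi.
have Hr := implyP (allP Hi _ (tr (h i))).
exists (h i); apply/eqP.
apply: Hr.
apply/allP=> j; rewrite mem_iota => /andP[_ j11]; apply/implyP.
rewrite nth_trace // (nth_map 0) ?size_iota // nth_iota // !add0n.
by case/orP=> /haspairP/(allP hh); rewrite // e_sym.
Qed.

End NoVega3.

Section Hexagon.
Variables (T : finType) (e : rel T).
Hypotheses (e_sym : symmetric e) (e_irr : irreflexive e).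
Hypothesis e_mtf : maximal_triangle_free e.
Hypothesis e_D : prop_D e 4.

Lemma skeleton_of_hexagon (x : seq T) (x0 : T) (h := nth x0 x) :
  maps e hexagon_edges h -> ~~ e (h 0) (h 3) -> ~~ e (h 1) (h 4) -> ~~ e (h 2) (h 5) ->
  exists tau, skeleton e tau.
Proof.
move=> /allP hh n03 n14 n25.
have Hm : models e (Conf 6 hexagon_edges [:: (0,3);(1,4);(2,5)]) h.
  apply: (models_intro e_sym); last by rewrite /= /fact /= (negPf n03) (negPf n14) (negPf n25).
  by apply/allP=> -[i j] ij; rewrite /fact /= (hh _ ij) andbT; move: ij; rewrite !inE => /or4P[|||/or3P[]] /eqP[-> ->].
have ok0 : traces_ok e traces0 by exact: traces_ok_start.
have [P] := check_sound e_sym e_irr e_mtf e_D ok0 Hm hexagon_cert_ok.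
rewrite inE => /eqP-> [g hg].
(* Whether [vega3] occurs is made decidable by restricting the map to its fourteen vertices, as
   there are finitely many such maps. *)
case: (boolP [exists f : {ffun 'I_14 -> T}, maps e vega3 (fun i => f (inord i))]).
  by case/existsP=> f; apply: (vega3_skeleton e_sym e_irr e_mtf e_D).
move=> /existsPn no3; apply: (no_vega3_skeleton e_sym e_irr e_mtf e_D) hg => -[Q].
rewrite inE => /eqP-> [k hk]; case/negP: (no3 [ffun i : 'I_14 => k i]).
have /allP bound : all (fun p => (p.1 < 14) && (p.2 < 14)) vega3 by vm_compute.
by apply/allP=> p pv; have /andP[p1 p2] := bound p pv; rewrite !ffunE !inordK // (allP hk).
Qed.

End Hexagon.

Local Transparent kind_mask krel kind_of.

(** * Three chained colour classes *)

Lemma card_inj_interval (T : finType) (X : {set T}) (rho : T -> nat) (a b : nat) :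
  {in X &, injective rho} -> (forall x, x \in X -> a <= rho x < b) -> #|X| <= b - a.
Proof.
move=> inj Hx; rewrite cardE -(size_map rho) -(size_iota a (b - a)); apply: uniq_leq_size.
  by rewrite map_inj_in_uniq ?enum_uniq // => x y; rewrite !mem_enum; apply: inj.
by move=> _ /mapP[x + ->]; rewrite mem_enum mem_iota => /Hx; lia.
Qed.

Lemma card_below (T : finType) (X : {set T}) (rho : T -> nat) (m : nat) :
  {in X &, injective rho} -> (forall x, x \in X -> rho x < #|X|) -> m <= #|X| ->
  #|[set x in X | rho x < m]| = m.
Proof.
move=> inj Hx mX; apply/eqP; rewrite eqn_leq; apply/andP; split.
  rewrite -{2}[m]subn0; apply: (card_inj_interval (rho := rho)).
    by move=> x y; rewrite !inE => /andP[xX _] /andP[yX _]; apply: inj.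
  by move=> x; rewrite !inE => /andP[].
have: #|[set x in X | m <= rho x]| <= #|X| - m.
  apply: (card_inj_interval (rho := rho)) => [x y|x]; rewrite !inE => /andP[xX Hm].
    by move=> /andP[yX _]; apply: inj.
  by rewrite Hm Hx.
have -> : [set x in X | m <= rho x] = X :\: [set x in X | rho x < m].
  by apply/setP=> x; rewrite !inE; case: (x \in X); rewrite ?andbF ?andbT //= leqNgt.
rewrite cardsD (setIidPr _); last by apply/subsetP=> x; rewrite inE => /andP[].
have : #|[set x in X | rho x < m]| <= #|X| by apply/subset_leq_card/subsetP=> x; rewrite inE => /andP[].
lia.
Qed.

(** An injective [rho] with values below [#|X|] is a ranking of [X], and a down-closed set is an
    initial segment of it. Applied to neighbourhoods, this turns adjacency into a comparison of two
    degrees. *)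
Lemma rank_downset (T : finType) (X S : {set T}) (rho : T -> nat) :
  {in X &, injective rho} -> (forall x, x \in X -> rho x < #|X|) -> S \subset X ->
  (forall x y, x \in S -> y \in X -> rho y < rho x -> y \in S) ->
  forall x, x \in X -> (x \in S) = (rho x < #|S|).
Proof.
move=> inj Hx SX down x xX; apply/idP/idP=> [xS|].
  rewrite -(card_below inj Hx (m := (rho x).+1)); last exact: Hx.
  apply/subset_leq_card/subsetP=> y; rewrite inE ltnS leq_eqVlt => /andP[yX /orP[/eqP/inj->//|]].
  exact: down.
apply: contraTT => xS; rewrite -leqNgt -(card_below inj Hx (m := rho x)); last exact/ltnW/Hx.
apply/subset_leq_card/subsetP=> y yS; rewrite inE (subsetP SX) //= ltn_neqAle.
have yX := subsetP SX y yS; apply/andP; split; first by apply/eqP=> /inj yx; rewrite -yx // yS in xS.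
by rewrite leqNgt; apply/negP=> xy; rewrite (down y x) in xS.
Qed.

Section Core.
Variables (T : finType) (e : rel T) (C : 'I_3 -> {set T}).
Hypothesis e_sym : symmetric e.
Hypothesis tri : forall x y z, e x y -> e y z -> e x z -> False.
Hypothesis chain : forall i j x x' y y', i != j -> x \in C i -> x' \in C i -> y \in C j -> y' \in C j ->
  e x y -> e x' y' -> e x y' || e x' y.
Hypothesis third : forall i j k x y, i != j -> i != k -> j != k -> x \in C i -> y \in C j -> ~~ e x y ->
  exists2 z, z \in C k & e x z && e y z.
Hypothesis twins : forall i x x', x \in C i -> x' \in C i ->
  (forall j y, j != i -> y \in C j -> e x y = e x' y) -> x = x'.

Definition nb j x := [set y in C j | e x y].
Definition dg j x := #|nb j x|.
Definition full i j := exists2 x, x \in C i & forall y, y \in C j -> e x y.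

Lemma dg_le j x : dg j x <= #|C j|.
Proof. by apply/subset_leq_card/subsetP=> y; rewrite inE => /andP[]. Qed.

Lemma nb_chain i j x x' : i != j -> x \in C i -> x' \in C i -> dg j x <= dg j x' -> nb j x \subset nb j x'.
Proof.
move=> ij xC x'C le; apply/subsetP=> y yx; move: (yx); rewrite !inE => /andP[yC xy]; rewrite yC /=.
apply/negPn/negP=> x'y.
have sub : nb j x' \subset nb j x.
  apply/subsetP=> z; rewrite !inE => /andP[zC x'z]; rewrite zC /=.
  by have := chain ij xC x'C yC zC xy x'z; rewrite (negPf x'y) orbF.
have E : nb j x' = nb j x by apply/eqP; rewrite eqEcard sub.
by move: yx; rewrite -E inE (negPf x'y) andbF.
Qed.

(** Let x' but not x see y in the class j. A common neighbour z of x and y in the class k is missed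
    by x', as x', y, z would form a triangle. Since x sees z and x' does not, the chain between i
    and k puts the neighbours of x' among those of x. *)
Lemma nb_order i j k x x' : i != j -> i != k -> j != k -> x \in C i -> x' \in C i ->
  dg j x < dg j x' -> nb k x' \subset nb k x.
Proof.
move=> ij ik jk xC x'C lt.
have /subsetPn[y] : ~~ (nb j x' \subset nb j x).
  by apply/negP=> /subset_leq_card; rewrite leqNgt => /negP.
rewrite !inE => /andP[yC x'y]; rewrite yC /= => xy.
have [z zC /andP[xz yz]] := third ij ik jk xC yC xy.
have x'z : ~~ e x' z by apply/negP=> x'z; apply: tri x'y yz x'z.
apply/subsetP=> w; rewrite !inE => /andP[wC x'w]; rewrite wC /=.
by have := chain ik xC x'C zC wC xz x'w; rewrite (negPf x'z) orbF.
Qed.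

Lemma ord3_cases (i j k l : 'I_3) : i != j -> i != k -> j != k -> l != i -> (l == j) || (l == k).
Proof.
rewrite -!val_eqE /=; move: (ltn_ord i) (ltn_ord j) (ltn_ord k) (ltn_ord l); lia.
Qed.

(** By the chain, equal degrees into the class j mean equal neighbourhoods there. These determine
    the neighbourhood in the class k: were z seen by y only, a common neighbour w of y' and z in the
    class j would also be seen by y and close a triangle. So the vertices are twins. *)
Lemma dg_inj i j k : i != j -> i != k -> j != k -> {in C i &, injective (dg j)}.
Proof.
move=> ij ik jk x x' xC x'C E.
have Ej : nb j x = nb j x' by apply/eqP; rewrite eqEsubset !(nb_chain ij) ?E.
have half y y' : y \in C i -> y' \in C i -> nb j y = nb j y' -> forall z, z \in C k -> e y z -> e y' z.
  move=> yC y'C H z zC yz; apply/negPn/negP=> y'z.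
  have kj : k != j by rewrite eq_sym.
  have [w wC /andP[y'w zw]] := third ik ij kj y'C zC y'z.
  have : w \in nb j y by rewrite H inE wC.
  by rewrite inE wC => yw; apply: tri yz zw yw.
apply: (twins xC x'C) => l y li yC; have /orP[/eqP lj|/eqP lk] := ord3_cases ij ik jk li.
  by move/setP: Ej => /(_ y); rewrite !inE -lj yC.
by rewrite lk in yC; apply/idP/idP; apply: half.
Qed.

Section Sizes.
Variables (i j k : 'I_3).
Hypotheses (ij : i != j) (ik : i != k) (jk : j != k).

Lemma full_pos : full i j -> forall y, y \in C j -> 0 < dg i y.
Proof. by case=> x xC H y yC; apply/card_gt0P; exists x; rewrite inE xC e_sym H. Qed.

Lemma card_full : full i j -> #|C j| <= #|C i|.
Proof.
move=> F; have : #|C j| <= #|C i|.+1 - 1; last by rewrite subn1.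
apply: (card_inj_interval (rho := dg i)); first by apply: (dg_inj _ jk ik); rewrite eq_sym.
by move=> y yC; rewrite (full_pos F) //= ltnS dg_le.
Qed.

(** The neighbours in [C j] of a vertex of least degree are shared by all of [C i], so any such
    neighbour would witness [full j i]. *)
Lemma not_full : C j != set0 -> ~ full j i -> exists2 x, x \in C i & nb j x = set0.
Proof.
move=> /set0Pn[y0 y0C] nF.
have [Ci0|[x0 x0C]] := set_0Vmem (C i).
  by case: nF; exists y0 => // x; rewrite Ci0 inE.
case: (arg_minnP (dg j) x0C) => x xC xmin; exists x => //; apply/eqP/negPn/negP=> /set0Pn[y].
rewrite inE => /andP[yC xy]; case: nF; exists y => // x' x'C; rewrite e_sym.
have /subsetP/(_ y) := nb_chain ij xC x'C (xmin x' x'C).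
by rewrite !inE yC xy => /(_ isT).
Qed.

Lemma not_full_lt : C j != set0 -> ~ full j i -> forall y, y \in C j -> dg i y < #|C i|.
Proof.
move=> Cj nF y yC; have [x xC E] := not_full Cj nF.
apply: proper_card; apply/properP; split; first by apply/subsetP=> z; rewrite inE => /andP[].
exists x => //; rewrite inE xC /= e_sym; apply/negP=> xy.
by have := in_set0 y; rewrite -E inE yC xy.
Qed.

Lemma card_not_full : C j != set0 -> full i j -> ~ full j i -> #|C j| < #|C i|.
Proof.
move=> Cj F nF; have [y0 y0C] := set0Pn _ Cj.
have Ci : 0 < #|C i| by apply: leq_ltn_trans (not_full_lt Cj nF y0C).
have : #|C j| <= #|C i| - 1; last by lia.
apply: (card_inj_interval (rho := dg i)); first by apply: (dg_inj _ jk ik); rewrite eq_sym.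
by move=> y yC; rewrite (full_pos F) //=; apply: not_full_lt.
Qed.

Lemma card_le_succ : #|C i| <= #|C j|.+1.
Proof.
rewrite -[#|C j|.+1]subn0; apply: (card_inj_interval (rho := dg j)); first exact: (dg_inj ij ik jk).
by move=> x xC; rewrite ltnS dg_le.
Qed.

End Sizes.

Section Coordinates.
Variables (r g b : 'I_3).
Hypotheses (rg : r != g) (rb : r != b) (gb : g != b).
Hypothesis card_rb : #|C r| = #|C b|.+1.
Hypothesis g_range : forall y, y \in C g -> 0 < dg r y <= #|C g|.
Hypothesis b_range : forall z, z \in C b -> 0 < dg g z <= #|C b|.

Let gr : g != r. Proof. by rewrite eq_sym. Qed.
Let br : b != r. Proof. by rewrite eq_sym. Qed.
Let bg : b != g. Proof. by rewrite eq_sym. Qed.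

(** The class [r] is ranked by [dg b], whose values fill 0..[#|C b|] because [r] has one vertex more
    than [b]. By [nb_order] the neighbours of [y] in [r] form an initial segment. *)
Lemma adj_rg x y : x \in C r -> y \in C g -> e x y = (dg b x < dg r y).
Proof.
move=> xC yC; rewrite -(rank_downset (X := C r) (S := nb r y) (rho := dg b)) //; last 1 first.
- move=> z z'; rewrite !inE => /andP[zC yz] z'C lt; rewrite z'C /=.
  have /subsetP/(_ y) := nb_order rb rg bg z'C zC lt.
  by rewrite !inE yC e_sym yz e_sym => /(_ isT).
- by rewrite inE xC e_sym.
- exact: (dg_inj rb rg bg).
- by move=> z _; rewrite card_rb ltnS dg_le.
by apply/subsetP=> z; rewrite inE => /andP[].
Qed.

Lemma adj_gb y z : y \in C g -> z \in C b -> e y z = (dg r y <= dg g z).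
Proof.
(* In this class the degrees start at 1, so the rank is the degree minus one. *)
move=> yC zC; have -> : (dg r y <= dg g z) = ((dg r y).-1 < dg g z) by have := g_range yC; lia.
rewrite -(rank_downset (X := C g) (S := nb g z) (rho := fun y => (dg r y).-1)) //; last 1 first.
- move=> w w'; rewrite !inE => /andP[wC zw] w'C lt; rewrite w'C /=.
  have lt' : dg r w' < dg r w by move: lt; clear; lia.
  have /subsetP/(_ z) := nb_order gr gb rb w'C wC lt'.
  by rewrite !inE zC e_sym zw e_sym => /(_ isT).
- by rewrite inE yC e_sym.
- move=> w w' wC w'C E; apply: (dg_inj gr gb rb wC w'C).
  by move: (g_range wC) (g_range w'C) E; clear; lia.
- by move=> w /g_range; lia.
by apply/subsetP=> w; rewrite inE => /andP[].
Qed.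

Lemma adj_rb x z : x \in C r -> z \in C b -> e x z = (dg g z <= dg b x).
Proof.
move=> xC zC; have -> : (dg g z <= dg b x) = ((dg g z).-1 < dg b x) by have := b_range zC; lia.
rewrite -(rank_downset (X := C b) (S := nb b x) (rho := fun z => (dg g z).-1)) //; last 1 first.
- move=> w w'; rewrite !inE => /andP[wC xw] w'C lt; rewrite w'C /=.
  have lt' : dg g w' < dg g w by move: lt; clear; lia.
  have /subsetP/(_ x) := nb_order bg br gr w'C wC lt'.
  by rewrite !inE xC e_sym xw e_sym => /(_ isT).
- by rewrite inE zC.
- move=> w w' wC w'C E; apply: (dg_inj bg br gr wC w'C).
  by move: (b_range wC) (b_range w'C) E; clear; lia.
- by move=> w /b_range; lia.
by apply/subsetP=> w; rewrite inE => /andP[].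
Qed.

End Coordinates.

End Core.

Lemma rank_onto (T : finType) (X : {set T}) (rho : T -> nat) (m : nat) :
  {in X &, injective rho} -> (forall x, x \in X -> rho x < #|X|) -> m < #|X| ->
  exists2 x, x \in X & rho x = m.
Proof.
move=> inj Hx mX.
have /subsetPn[x] : ~~ ([set x in X | rho x < m.+1] \subset [set x in X | rho x < m]).
  by apply/negP=> /subset_leq_card; rewrite !card_below ?ltnn // ltnW.
rewrite !inE => /andP[xX lt]; rewrite xX /= => nlt; exists x => //.
by apply/eqP; rewrite eqn_leq -ltnS lt leqNgt.
Qed.

Definition nat_andrasfai k p q := let n := 3 * k - 1 in let d := (p + n - q) %% n in (k <= d) && (d <= 2 * k - 1).

(** The interval k..2k - 1 is invariant under the reflection that sends d to 3k - 1 - d, so both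
    orders of the arguments reduce to the difference q - p. *)
Lemma andrasfai_le k p q : 0 < k -> p <= q < 3 * k - 1 ->
  (nat_andrasfai k p q = (k <= q - p <= 2 * k - 1)) * (nat_andrasfai k q p = (k <= q - p <= 2 * k - 1)).
Proof.
move=> k0 /andP[pq qn]; rewrite /nat_andrasfai; split; last first.
  by rewrite -addnBAC // modnDr modn_small //; lia.
have [->|npq] := eqVneq p q; first by rewrite addnC addnK modnn subnn; lia.
have lt : p < q by rewrite ltn_neqAle npq.
by rewrite modn_small; lia.
Qed.

Lemma andrasfai_sym k p q : 0 < k -> p < 3 * k - 1 -> q < 3 * k - 1 ->
  nat_andrasfai k p q = nat_andrasfai k q p.
Proof.
move=> k0 pn qn; case: (leqP p q) => [pq|/ltnW pq].
  have H : p <= q < 3 * k - 1 by rewrite pq.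
  by rewrite (andrasfai_le k0 H).1 (andrasfai_le k0 H).2.
have H : q <= p < 3 * k - 1 by rewrite pq.
by rewrite (andrasfai_le k0 H).1 (andrasfai_le k0 H).2.
Qed.

(** * Coordinates on the circle *)

Definition cR : 'I_3 := @Ordinal 3 0 isT.
Definition cG : 'I_3 := @Ordinal 3 1 isT.
Definition cB : 'I_3 := @Ordinal 3 2 isT.

Lemma colour3 (c : 'I_3) : [\/ c = cR, c = cG | c = cB].
Proof. by case: c => [[|[|[|]]] ?] //; [apply: Or31|apply: Or32|apply: Or33]; apply: val_inj. Qed.

Section Circular.
Variables (T : finType) (e : rel T) (C : 'I_3 -> {set T}).
Hypothesis e_sym : symmetric e.
Hypothesis tri : forall x y z, e x y -> e y z -> e x z -> False.
Hypothesis indep : forall c x y, x \in C c -> y \in C c -> ~~ e x y.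
Hypothesis disj : forall c d x, x \in C c -> x \in C d -> c = d.
Hypothesis chain : forall i j x x' y y', i != j -> x \in C i -> x' \in C i -> y \in C j -> y' \in C j ->
  e x y -> e x' y' -> e x y' || e x' y.
Hypothesis third : forall i j k x y, i != j -> i != k -> j != k -> x \in C i -> y \in C j -> ~~ e x y ->
  exists2 z, z \in C k & e x z && e y z.
Hypothesis twins : forall i x x', x \in C i -> x' \in C i ->
  (forall j y, j != i -> y \in C j -> e x y = e x' y) -> x = x'.
Hypotheses (n_rb : #|C cR| = #|C cB|.+1) (n_g : (#|C cG| == #|C cR|) || (#|C cG| == #|C cB|)).
Hypothesis g_range : forall y, y \in C cG -> 0 < dg e C cR y <= #|C cG|.
Hypothesis b_range : forall z, z \in C cB -> 0 < dg e C cG z <= #|C cB|.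

Local Notation i := #|C cR|.
Let nu := #|C cG| == #|C cB|.

(* The chains and twin-freeness make the three degrees below injective on their classes. *)
Definition coord p :=
  if p \in C cR then dg e C cB p else if p \in C cG then i.-1 + dg e C cR p else (2 * i).-1 + dg e C cG p.

Lemma coordR p : p \in C cR -> coord p = dg e C cB p.
Proof. by rewrite /coord => ->. Qed.

Lemma coordG p : p \in C cG -> coord p = i.-1 + dg e C cR p.
Proof. by rewrite /coord => pC; rewrite pC ifN //; apply/negP=> /disj/(_ pC). Qed.

Lemma coordB p : p \in C cB -> coord p = (2 * i).-1 + dg e C cG p.
Proof. by rewrite /coord => pC; rewrite !ifN //; apply/negP=> /disj/(_ pC). Qed.

Lemma coordR_range p : p \in C cR -> coord p < i.
Proof. by move=> pC; rewrite coordR // n_rb ltnS dg_le. Qed.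

(** When [nu] holds, the green class has one vertex fewer and its last coordinate 2i - 1 stays free.
    This is the vertex deleted in Upsilon_i^01 and Upsilon_i^11. *)
Lemma coordG_range p : p \in C cG -> i <= coord p <= 2 * i - 1 - nu.
Proof.
move=> pC; rewrite coordG //; move: (g_range pC) n_rb n_g; rewrite /nu.
move: #|C cG| #|C cB| (i) (dg _ _ _ _) => u v w d H1 H2.
by case: eqP => ?; case: eqP => ? /=; lia.
Qed.

Lemma coordB_range p : p \in C cB -> 2 * i <= coord p <= 3 * i - 2.
Proof.
move=> pC; rewrite coordB //; move: (b_range pC) n_rb.
by move: #|C cB| (i) (dg _ _ _ _) => v w d; lia.
Qed.

Lemma coord_lt c p : p \in C c -> coord p < 3 * i - 1.
Proof.
have [->|->|->] := colour3 c => [/coordR_range|/coordG_range|/coordB_range]; rewrite ?n_rb; lia.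
Qed.

Lemma andrasfai_coord c d x y : x \in C c -> y \in C d -> coord x <= coord y ->
  nat_andrasfai i (coord x) (coord y) = (i <= coord y - coord x <= 2 * i - 1).
Proof.
move=> xC yC xy; have H : coord x <= coord y < 3 * i - 1 by rewrite xy (coord_lt yC).
by rewrite (andrasfai_le _ H).1 // n_rb.
Qed.

Lemma rel_rg x y : x \in C cR -> y \in C cG -> e x y = nat_andrasfai i (coord x) (coord y).
Proof.
move=> xC yC; have hx := coordR_range xC; have hy := coordG_range yC.
rewrite (andrasfai_coord xC yC); last by move: hx hy; clear; lia.
rewrite (adj_rg e_sym tri chain third twins (r := cR) (g := cG) (b := cB)) //.
move: hx hy; rewrite coordR // coordG // n_rb; clear.
by move: #|C cB| (dg _ _ _ x) (dg _ _ _ y) (nat_of_bool nu) => *; lia.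
Qed.

Lemma rel_gb y z : y \in C cG -> z \in C cB -> e y z = nat_andrasfai i (coord y) (coord z).
Proof.
move=> yC zC; have hy := coordG_range yC; have hz := coordB_range zC.
rewrite (andrasfai_coord yC zC); last by move: hy hz; clear; lia.
rewrite (adj_gb e_sym tri chain third twins (r := cR) (g := cG) (b := cB)) //.
move: hy hz; rewrite coordG // coordB // n_rb; clear.
by move: #|C cB| (dg _ _ _ y) (dg _ _ _ z) (nat_of_bool nu) => *; lia.
Qed.

Lemma rel_rb x z : x \in C cR -> z \in C cB -> e x z = nat_andrasfai i (coord x) (coord z).
Proof.
move=> xC zC; have hx := coordR_range xC; have hz := coordB_range zC.
rewrite (andrasfai_coord xC zC); last by move: hx hz; clear; lia.
rewrite (adj_rb e_sym tri chain third twins (r := cR) (g := cG) (b := cB)) //.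
move: hx hz; rewrite coordR // coordB // n_rb; clear.
by move: #|C cB| (dg _ _ _ x) (dg _ _ _ z) => *; lia.
Qed.

Lemma rel_same c x y : x \in C c -> y \in C c -> e x y = nat_andrasfai i (coord x) (coord y).
Proof.
move=> xC yC; rewrite (negPf (indep xC yC)).
wlog le : x y xC yC / coord x <= coord y.
  move=> H; have [le|/ltnW le] := leqP (coord x) (coord y); first exact: H.
  rewrite andrasfai_sym ?(coord_lt xC) ?(coord_lt yC) ?n_rb //; rewrite -n_rb.
  exact: H.
rewrite (andrasfai_coord xC yC) //; have: 0 < i by rewrite n_rb.
by have [E|E|E] := colour3 c; rewrite {}E in xC yC; [move: (coordR_range xC) (coordR_range yC)
  |move: (coordG_range xC) (coordG_range yC)|move: (coordB_range xC) (coordB_range yC)]; clear; lia.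
Qed.

Lemma rel_coord c d x y : x \in C c -> y \in C d -> e x y = nat_andrasfai i (coord x) (coord y).
Proof.
wlog le : c d x y / c <= d.
  move=> H xC yC; case: (leqP c d) => [le|/ltnW le]; first exact: H le xC yC.
  rewrite e_sym (H d c y x le yC xC); apply: andrasfai_sym; [by rewrite n_rb|exact: coord_lt yC|exact: coord_lt xC].
move: le; have [->|->|->] := colour3 c; have [->|->|->] := colour3 d => // _.
- exact: rel_same.
- exact: rel_rg.
- exact: rel_rb.
- exact: rel_same.
- exact: rel_gb.
exact: rel_same.
Qed.

Lemma coord_onto (m : nat) : m < 3 * i - 1 -> ~~ (nu && (m == 2 * i - 1)) ->
  exists c p, p \in C c /\ coord p = m.
Proof.
move=> m3 mnu; have inj c d f : c != d -> c != f -> d != f -> {in C c &, injective (dg e C d)} :=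
  @dg_inj _ _ _ tri chain third twins c d f.
case: (ltnP m i) => mi.
  have [|x _|//|p pC E] := @rank_onto _ (C cR) (dg e C cB) m.
  - exact: (inj cR cB cG).
  - by rewrite n_rb ltnS dg_le.
  by exists cR, p; rewrite coordR.
case: (ltnP m (2 * i)) => m2i.
  have [|x xC||p pC E] := @rank_onto _ (C cG) (fun x => (dg e C cR x).-1) (m - i).
  - move=> x y xC yC E; apply: (inj cG cR cB) => //.
    by move: (g_range xC) (g_range yC) E; clear; lia.
  - by move: (g_range xC); clear; lia.
  - move: mnu n_g; rewrite /nu; move: #|C cG| #|C cR| #|C cB| m2i n_rb mi => u v w; clear.
    by case: eqP => ?; case: eqP => ? /=; lia.
  by exists cG, p; split=> //; rewrite coordG //; move: (g_range pC) E mi n_rb; clear; lia.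
have [|x xC||p pC E] := @rank_onto _ (C cB) (fun x => (dg e C cG x).-1) (m - 2 * i).
- move=> x y xC yC E; apply: (inj cB cG cR) => //.
  by move: (b_range xC) (b_range yC) E; clear; lia.
- by move: (b_range xC); clear; lia.
- by move: n_rb m3 m2i; clear; lia.
by exists cB, p; split=> //; rewrite coordB //; move: (b_range pC) E m2i n_rb; clear; lia.
Qed.

End Circular.

(** * Sizes of the colour classes *)

Definition twin_free (T : finType) (e : rel T) := forall x y, (forall z, e x z = e y z) -> x = y.

Section Recolour.
Variables (T : finType) (e : rel T) (tau : T -> nat).
Hypothesis tauS : skeleton e tau.

(** A permutation of the colours is a symmetry of the skeleton when it moves a, b, c and u, v, w
    along and fixes x and y. *)
Definition recolour (s : seq nat) k :=
  if k < 3 then index k s else if k < 6 then 3 + index (k - 3) s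
  else if k < 8 then k else 8 + index (k - 8) s.

Definition colourings := permutations [:: 0; 1; 2].

Lemma recolour_ok : all (fun s => all (fun k => [&& recolour s k < 11, (7 < recolour s k) == (7 < k),
    has (fun l => recolour s l == k) (iota 0 11), (recolour s k == 7) == (k == 7) &
    all (fun l => (krel (recolour s k) (recolour s l) == krel k l) &&
       ((recolour s k == recolour s l) == (k == l))) (iota 0 11)])
  (iota 0 11)) colourings.
Proof. by vm_compute. Qed.

Lemma skeleton_recolour s : s \in colourings -> skeleton e (recolour s \o tau).
Proof.
move=> /(allP recolour_ok)/allP Hs.
have in11 k : k < 11 -> k \in iota 0 11 by rewrite mem_iota.
have H k : k < 11 -> [/\ recolour s k < 11, (7 < recolour s k) = (7 < k),
    exists2 l, l < 11 & recolour s l = k, (recolour s k == 7) = (k == 7) &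
    forall l, l < 11 -> krel (recolour s k) (recolour s l) = krel k l /\
       (recolour s k == recolour s l) = (k == l)].
  move=> /in11/Hs/and5P[H1 /eqP H2 /hasP[l lI /eqP H3] /eqP H4 /allP H5]; split=> //.
    by rewrite mem_iota in lI; exists l.
  by move=> m /in11/H5/andP[/eqP-> /eqP->].
have lt p := sk_lt tauS p.
have le8 k : k < 11 -> (recolour s k < 8) = (k < 8).
  by move=> /H[_ E _ _ _]; rewrite !(ltnNge _ 8); congr (~~ _).
split=> [p|p q|p p' q q'|k k11 k7] /=.
- by have [] := H _ (lt p).
- rewrite !le8 //; have [_ _ _ _ /(_ _ (lt q))[-> ->]] := H _ (lt p).
  exact: sk_rel.
- have [_ -> _ _ Hp] := H _ (lt p); have [_ -> _ _ Hq] := H _ (lt q).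
  move=> p7 q7 /eqP; rewrite (Hp _ (lt p')).2 => /eqP pp /eqP; rewrite (Hq _ (lt q')).2 => /eqP qq.
  exact: (sk_chain tauS).
have [_ _ [l l11 E] _ _] := H _ k11; have [_ _ _ E7 _] := H _ l11.
have [p Hp] : exists p, tau p = l by apply: (sk_onto tauS) => //; rewrite -E7 E.
by exists p; rewrite Hp.
Qed.

End Recolour.

Section Sizes.
Variables (T : finType) (e : rel T) (tau : T -> nat).
Hypotheses (e_sym : symmetric e) (e_irr : irreflexive e).
Hypothesis e_mtf : maximal_triangle_free e.
Hypothesis e_D : prop_D e 4.
Hypothesis tw : twin_free e.
Hypothesis tauS : skeleton e tau.

Definition colour (i : 'I_3) := [set p | tau p == 8 + i].
Let tri : forall x y z, e x y -> e y z -> e x z -> False := no_triangle e_sym e_mtf.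

(** No letter is joined to two colours, so a common neighbour of vertices of two colours has the
    third colour. *)
Lemma krel_colour : all (fun k => all (fun l => (k != l) ==>
   all (fun m => ~~ (krel k m && krel l m)) (iota 0 8)) [:: 8; 9; 10]) [:: 8; 9; 10].
Proof. by vm_compute. Qed.

Lemma colour_kind (i : 'I_3) : 8 + i \in [:: 8; 9; 10].
Proof. by case: i => [[|[|[|]]]]. Qed.

Lemma same_colour i x y : x \in colour i -> y \in colour i -> ~~ e x y.
Proof.
rewrite !inE => /eqP xi /eqP yi; rewrite (sk_rel tauS) ?xi ?yi ?eqxx ?orbT //.
Qed.

Lemma colour_or_letter p : (tau p < 8) || [exists i, p \in colour i].
Proof.
case: (ltnP (tau p) 8) => //= p8; apply/existsP.
have lt : tau p - 8 < 3 by have := sk_lt tauS p; lia.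
by exists (Ordinal lt); rewrite inE /=; apply/eqP; lia.
Qed.

Lemma colour_chain i j x x' y y' : i != j -> x \in colour i -> x' \in colour i ->
  y \in colour j -> y' \in colour j -> e x y -> e x' y' -> e x y' || e x' y.
Proof.
rewrite !inE => _ /eqP xi /eqP xi' /eqP yj /eqP yj'; apply: (sk_chain tauS);
  by rewrite ?xi ?yj ?xi' ?yj'.
Qed.

Lemma colour_third i j k x y : i != j -> i != k -> j != k -> x \in colour i -> y \in colour j ->
  ~~ e x y -> exists2 z, z \in colour k & e x z && e y z.
Proof.
move=> ij ik jk xi yj xy; have [z xz yz] := common_nbr e_sym e_mtf e_D xy.
exists z; last by rewrite xz.
have /orP[z8|/existsP[l zl]] := colour_or_letter z.
  move: xz yz; rewrite !(sk_rel tauS) ?z8 ?orbT //; move: xi yj; rewrite !inE => /eqP-> /eqP->.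
  have := implyP (allP (allP krel_colour _ (colour_kind i)) _ (colour_kind j)).
  rewrite eqn_add2l val_eqE => /(_ ij)/allP/(_ (tau z)); rewrite mem_iota z8 => /(_ isT).
  by move=> + xz yz; rewrite xz yz.
have li : l != i by apply: contraTneq xz => li; rewrite -li in xi; apply: same_colour zl.
have lj : l != j by apply: contraTneq yz => lj; rewrite -lj in yj; apply: same_colour zl.
by have := ord3_cases ij ik jk li; rewrite (negPf lj) => /eqP <-.
Qed.

Lemma colour_twins i x x' : x \in colour i -> x' \in colour i ->
  (forall j y, j != i -> y \in colour j -> e x y = e x' y) -> x = x'.
Proof.
move=> xi x'i H; apply: tw => z; have /orP[z8|/existsP[l zl]] := colour_or_letter z.
  by move: xi x'i; rewrite !(sk_rel tauS) ?z8 ?orbT // !inE => /eqP-> /eqP->.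
have [li|li] := eqVneq l i; last exact: H zl.
by rewrite li in zl; rewrite !(negPf (same_colour _ zl)).
Qed.

Lemma colour_neq0 i : colour i != set0.
Proof.
have [p Hp] : exists p, tau p = 8 + i.
  by apply: (sk_onto tauS); have := ltn_ord i; lia.
by apply/set0Pn; exists p; rewrite inE Hp.
Qed.

Definition fullb i j := [exists x in colour i, [forall y in colour j, e x y]].
Lemma fullP i j : reflect (full e colour i j) (fullb i j).
Proof.
apply: (iffP exists_inP) => [] [x xi H]; exists x => //; first by move=> y; apply: (forall_inP H).
exact/forall_inP.
Qed.

Lemma votes6 : all (fun i => all (fun j => (i != j) ==> all (fun m =>
   count (krel^~ m) [:: i; 3 + i; j; 3 + j; 8 + i; 8 + j] <= 2) (iota 0 8)) (iota 0 3)) (iota 0 3).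
Proof. by vm_compute. Qed.

(** Otherwise some x of colour i has no neighbour of colour j, and some y of colour j none of colour
    i. Property D_2 for x, y and the four letters joined to these colours asks for a vertex that
    sees three of the six, but a vertex of any kind sees at most two. *)
Lemma full_total i j : i != j -> fullb i j || fullb j i.
Proof.
move=> ij; apply/negPn/negP; rewrite negb_or => /andP[/fullP nF /fullP nF'].
have ji : j != i by rewrite eq_sym.
have [x xi x0] := not_full e_sym colour_chain ij (colour_neq0 j) nF'.
have [y yj y0] := not_full e_sym colour_chain ji (colour_neq0 i) nF.
have letter k : k < 6 -> exists p, tau p = k.
  by move=> k6; apply: (sk_onto tauS); lia.
have i3 := ltn_ord i; have j3 := ltn_ord j.
have [a1 A1] : exists p, tau p = i by apply: letter; lia.
have [a2 A2] : exists p, tau p = j by apply: letter; lia.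
have [u1 U1] : exists p, tau p = 3 + i by apply: letter; lia.
have [u2 U2] : exists p, tau p = 3 + j by apply: letter; lia.
have rel8 p k w : tau p = k -> k < 8 -> e p w = krel k (tau w).
  by move=> <- k8; rewrite (sk_rel tauS) ?k8.
have [z] := prop_D_seq (m := 2) (s := [:: a1; u1; a2; u2; x; y]) e_D isT erefl.
have xi' := xi; have yj' := yj; rewrite !inE in xi' yj'; move/eqP: xi' => xt; move/eqP: yj' => yt.
have iI : (i : nat) \in iota 0 3 by rewrite mem_iota.
have jI : (j : nat) \in iota 0 3 by rewrite mem_iota.
have /orP[z8|/existsP[l zl]] := colour_or_letter z.
  have := implyP (allP (allP votes6 i iI) j jI) ij => /allP/(_ (tau z)).
  rewrite mem_iota z8 => /(_ isT); rewrite leqNgt => /negP H; apply: contra_not H => /=.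
  by rewrite !(sk_rel tauS) ?z8 ?orbT // A1 A2 U1 U2 xt yt.
have zt : tau z = 8 + l by move: zl; rewrite inE => /eqP.
have i8 : i < 8 by apply: leq_trans i3 _.
have j8 : j < 8 by apply: leq_trans j3 _.
have i8' : 3 + i < 8 by apply: (@leq_trans (3 + 3)); rewrite ?ltn_add2l.
have j8' : 3 + j < 8 by apply: (@leq_trans (3 + 3)); rewrite ?ltn_add2l.
rewrite /= (rel8 _ _ z A1 i8) (rel8 _ _ z A2 j8) (rel8 _ _ z U1 i8') (rel8 _ _ z U2 j8') zt.
have xz : l = j -> e x z = false.
  by move=> lj; have := in_set0 z; rewrite -x0 inE -lj zl.
have yz : l = i -> e y z = false.
  by move=> li; have := in_set0 z; rewrite -y0 inE -li zl.
have [li|li] := eqVneq l i.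
  rewrite (yz li) li in zl *; rewrite (negPf (same_colour xi zl)).
  move: ij; rewrite -!val_eqE /=; clear -i3 j3.
  by case: (val i) i3 => [|[|[|]]] //; case: (val j) j3 => [|[|[|]]].
have [lj|lj] := eqVneq l j.
  rewrite (xz lj) lj in zl *; rewrite (negPf (same_colour yj zl)).
  move: ij; rewrite -!val_eqE /=; clear -i3 j3.
  by case: (val i) i3 => [|[|[|]]] //; case: (val j) j3 => [|[|[|]]].
have l3 := ltn_ord l; move: li lj ij; rewrite -!val_eqE /=; clear -i3 j3 l3.
move: (e x z) (e y z) => b1 b2.
by case: (val i) i3 => [|[|[|]]] //; case: (val j) j3 => [|[|[|]]] //;
   case: (val l) l3 => [|[|[|]]] // _ _ _; case: b1 b2 => [] [].
Qed.

Let n i := #|colour i|.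

Lemma size_cases i j : i != j -> [\/ n i = n j /\ fullb i j && fullb j i,
   n i = (n j).+1 /\ fullb i j && ~~ fullb j i | n j = (n i).+1 /\ fullb j i && ~~ fullb i j].
Proof.
move=> ij; have ji : j != i by rewrite eq_sym.
have [k ik jk] : exists2 k : 'I_3, i != k & j != k.
  have [k Hk] : exists k, k \notin [set i; j].
    apply/existsP; rewrite -negb_forall; apply/negP=> /forallP H.
    have : #|[set: 'I_3]| <= #|[set i; j]| by apply/subset_leq_card/subsetP=> k _; apply: H.
    by rewrite cardsT card_ord cards2 ij.
  by move: Hk; rewrite !inE negb_or ![k == _]eq_sym => /andP[ik jk]; exists k.
have card_nf a b c (ab : a != b) (ac : a != c) (bc : b != c) : fullb a b -> ~~ fullb b a -> n a = (n b).+1.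
  move=> F /fullP nF; apply/eqP; rewrite eqn_leq.
  rewrite (card_le_succ tri colour_chain colour_third colour_twins ab ac bc).
  by apply: (card_not_full e_sym tri colour_chain colour_third colour_twins ab ac bc (colour_neq0 b)); first exact/fullP.
have := full_total ij; case Fij: (fullb i j); case Fji: (fullb j i) => //= _.
- apply: Or31; split=> //; apply/eqP; rewrite eqn_leq; apply/andP; split.
    by apply: (card_full e_sym tri colour_chain colour_third colour_twins ji jk ik); apply/fullP.
  by apply: (card_full e_sym tri colour_chain colour_third colour_twins ij ik jk); apply/fullP.
- by apply: Or32; split=> //; apply: (card_nf _ _ k) => //; rewrite Fji.
by apply: Or33; split=> //; apply: (card_nf _ _ k) => //; rewrite Fij.
Qed.

(** Let x see all of colour j and z, of colour k, all of colour i. Since some vertex of colour j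
    sees all of colour k, z has a neighbour y of colour j, and x, y, z form a triangle. *)
Lemma not_all_full (i j k : 'I_3) : i != j -> i != k -> j != k ->
  ~~ [&& fullb i j, fullb j k & fullb k i].
Proof.
move=> ij ik jk; apply/negP=> /and3P[/fullP[x xi Hx] /fullP Fjk /fullP[z zk Hz]].
have := full_pos e_sym Fjk zk; rewrite /dg => /card_gt0P[y]; rewrite inE => /andP[yj zy].
by apply: (tri (Hx y yj) _ _ (y := y) (z := z)); rewrite ?(e_sym y) // e_sym Hz.
Qed.

(** Sizes differ by at most one, and classes of equal size are full to each other, so [not_all_full]
    excludes three equal sizes. Either one class is larger by one and becomes r ([one], giving nu =
    1), or one is smaller by one and becomes b ([two], giving nu = 0). *)
Lemma ordered_colours : exists r g b : 'I_3, [/\ [&& r != g, r != b & g != b],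
   n r = (n b).+1, (n g == n r) || (n g == n b),
   forall y, y \in colour g -> 0 < dg e colour r y <= n g &
   forall z, z \in colour b -> 0 < dg e colour g z <= n b].
Proof.
have one r g b : r != g -> r != b -> g != b -> n r = (n g).+1 -> n g = n b ->
   exists r g b : 'I_3, [/\ [&& r != g, r != b & g != b],
   n r = (n b).+1, (n g == n r) || (n g == n b),
   forall y, y \in colour g -> 0 < dg e colour r y <= n g &
   forall z, z \in colour b -> 0 < dg e colour g z <= n b].
  move=> rg rb gb nrg ngb; exists r, g, b.
  have gr : g != r by rewrite eq_sym.
  have [[E]|[_ /andP[F nF]]|[E]] := size_cases rg; try lia.
  have [[_ /andP[F' _]]|[E]|[E]] := size_cases gb; try lia.
  split; rewrite ?rg ?rb ?gb ?ngb ?eqxx ?orbT //; first by rewrite -ngb.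
    move=> y yg; rewrite (full_pos e_sym (fullP _ _ F)) //=.
    have := not_full_lt e_sym colour_chain rg (colour_neq0 g) (elimN (fullP _ _) nF) yg.
    by rewrite -/(n r) nrg ltnS -ngb.
  move=> z zb; rewrite (full_pos e_sym (fullP _ _ F')) //=.
  by rewrite -ngb dg_le.
have two r g b : r != g -> r != b -> g != b -> n r = (n b).+1 -> n g = n r ->
   exists r g b : 'I_3, [/\ [&& r != g, r != b & g != b],
   n r = (n b).+1, (n g == n r) || (n g == n b),
   forall y, y \in colour g -> 0 < dg e colour r y <= n g &
   forall z, z \in colour b -> 0 < dg e colour g z <= n b].
  move=> rg rb gb nrb ngr; exists r, g, b.
  have [[_ /andP[F _]]|[E]|[E]] := size_cases rg; try lia.
  have [[E]|[_ /andP[F' nF]]|[E]] := size_cases gb; try lia.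
  split; rewrite ?rg ?rb ?gb ?ngr ?eqxx //.
    by move=> y yg; rewrite (full_pos e_sym (fullP _ _ F)) //= dg_le.
  move=> z zb; rewrite (full_pos e_sym (fullP _ _ F')) //=.
  have := not_full_lt e_sym colour_chain gb (colour_neq0 b) (elimN (fullP _ _) nF) zb.
  by rewrite -/(n g) ngr nrb ltnS.
pose c0 : 'I_3 := inord 0; pose c1 : 'I_3 := inord 1; pose c2 : 'I_3 := inord 2.
have d01 : c0 != c1 by rewrite -val_eqE /= !inordK.
have d02 : c0 != c2 by rewrite -val_eqE /= !inordK.
have d12 : c1 != c2 by rewrite -val_eqE /= !inordK.
have d10 : c1 != c0 by rewrite eq_sym.
have d20 : c2 != c0 by rewrite eq_sym.
have d21 : c2 != c1 by rewrite eq_sym.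
have := not_all_full d01 d02 d12.
have H01 : [\/ n c0 = n c1, n c0 = (n c1).+1 | n c1 = (n c0).+1].
  by have [[E _]|[E _]|[E _]] := size_cases d01; [apply: Or31|apply: Or32|apply: Or33].
have H12 : [\/ n c1 = n c2, n c1 = (n c2).+1 | n c2 = (n c1).+1].
  by have [[E _]|[E _]|[E _]] := size_cases d12; [apply: Or31|apply: Or32|apply: Or33].
have H20 : [\/ n c2 = n c0, n c2 = (n c0).+1 | n c0 = (n c2).+1].
  by have [[E _]|[E _]|[E _]] := size_cases d20; [apply: Or31|apply: Or32|apply: Or33].
have eq_full i j : i != j -> n i = n j -> fullb i j.
  by move=> ij E; have [[_ /andP[]]|[E' _]|[E' _]] := size_cases ij => //; exfalso; lia.
move=> nfull.
have : [\/ n c0 = (n c1).+1 /\ n c1 = n c2, n c1 = (n c0).+1 /\ n c0 = n c2 | n c2 = (n c0).+1 /\ n c0 = n c1] \/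
       [\/ n c0 = (n c2).+1 /\ n c1 = n c0, n c0 = (n c1).+1 /\ n c2 = n c0 | n c1 = (n c0).+1 /\ n c2 = n c1].
  have : ~ (n c0 = n c1 /\ n c1 = n c2).
    by case=> E E'; rewrite !eq_full // -?E' -?E in nfull.
  move: H01 H12 H20; clear; move: (n c0) (n c1) (n c2) => x y z.
  case=> ?; case=> ?; case=> ? ?; first [exfalso; lia | left; first
    [by apply: Or31; lia | by apply: Or32; lia | by apply: Or33; lia] | right; first
    [by apply: Or31; lia | by apply: Or32; lia | by apply: Or33; lia]].
case=> -[] [E E'].
- exact: (one c0 c1 c2).
- exact: (one c1 c0 c2).
- exact: (one c2 c0 c1).
- exact: (two c0 c1 c2).
- exact: (two c0 c2 c1).
exact: (two c1 c2 c0).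
Qed.

End Sizes.

(** * Vega graphs *)

Definition kind_at i p := if p < i then 8 else if p < 2 * i then 9 else 10.

Section VegaRel.
Variable i : nat.
Hypothesis i_gt1 : 1 < i.
Local Notation core := (fun p : 'I_(3 * i - 1) => inl p : vega_vertex i).
Local Notation letter := (fun q : 'I_8 => inr q : vega_vertex i).

Lemma vega_rel_core p p' : vega_rel (core p) (core p') = nat_andrasfai i p p'.
Proof.
rewrite -[LHS]/(nat_andrasfai i p p' || nat_andrasfai i p' p).
by rewrite (andrasfai_sym (ltnW i_gt1) (ltn_ord p') (ltn_ord p)) orbb.
Qed.

Lemma vega_rel_letters q q' : vega_rel (letter q) (letter q') = krel q q'.
Proof. by case: q q' => [[|[|[|[|[|[|[|[|]]]]]]]] ?] // [[|[|[|[|[|[|[|[|]]]]]]]] ?]. Qed.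

Lemma letter_colour_rel (q : 'I_8) : [/\ krel 8 q = (q == vega_a) || (q == vega_u),
  krel 9 q = (q == vega_b) || (q == vega_v) & krel 10 q = (q == vega_c) || (q == vega_w)].
Proof. by case: q => [[|[|[|[|[|[|[|[|]]]]]]]] ?]. Qed.

Lemma vega_rel_letter_core q p : vega_rel (letter q) (core p) = krel (kind_at i p) q.
Proof.
have [k8 k9 k10] := letter_colour_rel q; rewrite /vega_rel /= orbF /is_red /is_green /is_blue /kind_at.
have E9 : (p <= 2 * i - 1) = (p < 2 * i) by move: i_gt1; clear; lia.
have E10 : p <= 3 * i - 2 by move: (ltn_ord p) i_gt1; clear; lia.
rewrite E9 E10 andbT; have [pi|ip] := ltnP p i.
  have /ltn_geF -> : p < 2 * i by move: pi; clear; lia.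
  by rewrite k8 !andbF !orbF andbT.
have [p2|p2] := ltnP p (2 * i); first by rewrite k9 ?(andbF, andbT, orbF, orFb).
by rewrite k10 ?(andbF, andbT, orbF, orFb).
Qed.

Lemma vega_relC : symmetric (@vega_rel i).
Proof. by move=> s t; apply: orbC. Qed.

End VegaRel.

Section VegaMap.
Variables (T : finType) (e : rel T).
Hypotheses (e_sym : symmetric e) (e_irr : irreflexive e).
Hypothesis e_mtf : maximal_triangle_free e.
Hypothesis e_D : prop_D e 4.
Hypothesis tw : twin_free e.

Let tri : forall x y z, e x y -> e y z -> e x z -> False := no_triangle e_sym e_mtf.

Lemma ordered_skeleton tau0 : skeleton e tau0 -> exists tau, let n i := #|colour tau i| in
  [/\ skeleton e tau, n cR = (n cB).+1, (n cG == n cR) || (n cG == n cB),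
    forall y, y \in colour tau cG -> 0 < dg e (colour tau) cR y <= n cG &
    forall z, z \in colour tau cB -> 0 < dg e (colour tau) cG z <= n cB].
Proof.
move=> S0; have [r [g [b [/and3P[rg rb gb] H1 H2 H3 H4]]]] :=
  ordered_colours e_sym e_mtf e_D tw S0.
pose s := [:: val r; val g; val b].
have sC : s \in colourings.
  rewrite mem_permutations; move: rg rb gb; rewrite -!val_eqE /s /=.
  by case: r {H1 H2 H3 H4 s} => [[|[|[|]]] ?] //; case: g => [[|[|[|]]] ?] //; case: b => [[|[|[|]]] ?].
have S := skeleton_recolour S0 sC.
have E p i (j : 'I_3) : i < 3 -> nth 0 s i = val j -> (recolour s (tau0 p) == 8 + i) = (tau0 p == 8 + j).
  move=> i3 sj.
  have us : uniq s by rewrite (perm_uniq (_ : perm_eq s [:: 0; 1; 2])) //; rewrite -mem_permutations.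
  have ri : recolour s (8 + j) = 8 + i.
    by rewrite -[LHS]/(8 + index (8 + j - 8) s) addKn -sj index_uniq.
  have k11 : 8 + j < 11 by rewrite -[11]/(8 + 3) ltn_add2l.
  have := allP (allP recolour_ok s sC) (tau0 p); rewrite mem_iota (sk_lt S0) => /(_ isT)/and5P[_ _ _ _].
  by move=> /allP/(_ (8 + j)); rewrite mem_iota k11 ri => /(_ isT)/andP[_ /eqP].
have ER : colour (recolour s \o tau0) cR = colour tau0 r by apply/setP=> p; rewrite !inE (E p 0 r).
have EG : colour (recolour s \o tau0) cG = colour tau0 g by apply/setP=> p; rewrite !inE (E p 1 g).
have EB : colour (recolour s \o tau0) cB = colour tau0 b by apply/setP=> p; rewrite !inE (E p 2 b).
exists (recolour s \o tau0); rewrite /= ER EG EB; split=> //.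
  by move=> y /H3; rewrite /dg /nb ER.
by move=> z /H4; rewrite /dg /nb EG.
Qed.

Section Fixed.
Variable tau : T -> nat.
Local Notation C := (colour tau).
Local Notation n c := #|colour tau c|.
Hypotheses (S : skeleton e tau) (n_rb : n cR = (n cB).+1) (n_g : (n cG == n cR) || (n cG == n cB)).
Hypothesis g_range : forall y, y \in C cG -> 0 < dg e C cR y <= n cG.
Hypothesis b_range : forall z, z \in C cB -> 0 < dg e C cG z <= n cB.

Local Notation i := #|colour tau cR|.
Let mu := ~~ [exists p, tau p == 7].
Let nu := n cG == n cB.

Local Notation coord := (coord e C).

Lemma n_b_pos : 0 < n cB.
Proof. by rewrite card_gt0; apply: (colour_neq0 S). Qed.

Lemma in_colour c p : (p \in C c) = (tau p == 8 + c).
Proof. by rewrite inE. Qed.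

Lemma colour_disj c d p : p \in C c -> p \in C d -> c = d.
Proof. by rewrite !in_colour => /eqP -> /eqP/addnI/val_inj. Qed.

Lemma colour_of p : 7 < tau p -> exists2 c, p \in C c & tau p = 8 + c.
Proof.
move=> p7; have := colour_or_letter S p; rewrite ltnNge p7 => /existsP[c pc].
by exists c; rewrite // (eqP (etrans (esym (in_colour c p)) pc)).
Qed.

Lemma coord_range p : 7 < tau p ->
  [/\ tau p = 8 -> coord p < i, tau p = 9 -> i <= coord p <= 2 * i - 1 - nu &
      tau p = 10 -> 2 * i <= coord p <= 3 * i - 2].
Proof.
move=> p7; split=> E.
- by apply: (coordR_range e n_rb); rewrite in_colour E.
- by apply: (coordG_range (colour_disj)); rewrite // in_colour E.
by apply: (coordB_range (colour_disj)); rewrite // in_colour E.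
Qed.

(** A relation rather than a function, because [coord] is known to be in range only for coloured
    vertices; [fin_all_exists] turns it into the map of the blow-up. *)
Definition matches (v : vega_vertex i) p :=
  match v with inl q => 7 < tau p /\ coord p = q | inr q => tau p = q end.

Lemma match_exists p : exists v, matches v p.
Proof.
case: (ltnP 7 (tau p)) => Hp; last by exists (inr (Ordinal (Hp : tau p < 8))).
have [c pc _] := colour_of Hp.
by exists (inl (Ordinal (coord_lt colour_disj n_rb n_g g_range b_range pc))).
Qed.

Let chain := colour_chain S.
Let third := colour_third e_sym e_mtf e_D S.
Let twins := colour_twins tw S.

Lemma i_gt1 : 1 < i.
Proof. by rewrite n_rb ltnS n_b_pos. Qed.

Lemma kind_coord p : 7 < tau p -> tau p = kind_at i (coord p).
Proof.
move=> p7; have [h1 h2 h3] := coord_range p7; rewrite /kind_at.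
have [c _ E] := colour_of p7; move: E h1 h2 h3; have [->|->|->] := colour3 c => -> h1 h2 h3.
- by rewrite (h1 erefl).
- case/andP: (h2 erefl) => ic ci; rewrite ltnNge ic /=.
  by have -> : coord p < 2 * i by move: ci i_gt1; clear; lia.
case/andP: (h3 erefl) => ic _; rewrite !ltnNge ic /=.
by have -> : i <= coord p by apply: leq_trans ic; rewrite leq_pmull.
Qed.

Lemma matches_rel p p' v v' : matches v p -> matches v' p' -> e p p' = vega_rel v v'.
Proof.
case: v v' => [q|q] [q'|q'].
- move=> [x7 E] [x'7 E']; rewrite vega_rel_core ?i_gt1 // -E -E'.
  have [[c xc _] [d yd _]] := (colour_of x7, colour_of x'7).
  exact: (rel_coord e_sym tri (same_colour S) colour_disj chain third twins n_rb n_g g_range b_range xc yd).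
- move=> [x7 E] E'; rewrite /= in E'; rewrite (sk_rel S) ?E' ?ltn_ord ?orbT //.
  by rewrite vega_relC vega_rel_letter_core ?i_gt1 // -E -kind_coord.
- move=> E' [x7 E]; rewrite /= in E'; rewrite (sk_rel S) ?E' ?ltn_ord ?orbT // krelC.
  by rewrite vega_rel_letter_core ?i_gt1 // -E -kind_coord.
by move=> /= E E'; rewrite (sk_rel S) E ?E' ?ltn_ord // vega_rel_letters.
Qed.

Lemma coord_inj_onto (m : nat) : m < 3 * i - 1 -> ~~ (nu && (m == 2 * i - 1)) ->
  exists2 p, 7 < tau p & coord p = m.
Proof.
move=> m3 mnu.
have [c [p [pc E]]] := coord_onto tri (colour_disj) chain third twins n_rb n_g g_range b_range m3 mnu.
by exists p; rewrite // (eqP (etrans (esym (in_colour c p)) pc)).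
Qed.

Lemma vega_blowup : blowup_on e (@vega_rel i) (vega_set i mu nu).
Proof.
have [f Hf] := fin_all_exists match_exists.
exists f; split=> [p|v|p p']; last exact: matches_rel.
- rewrite inE; have := Hf p; case: (f p) => [q [p7 E]|q E].
    have [h1 h2 h3] := coord_range p7; have i1 := i_gt1.
    rewrite -E; have := sk_lt S p; case E' : (tau p) p7 => [|[|[|[|[|[|[|[|[|[|[|]]]]]]]]]]] // _ _.
    + by move: (h1 E'); lia.
    + by move: (h2 E'); case: (nu) => /=; lia.
    by move: (h3 E'); lia.
  apply/negP=> /andP[/existsPn H /eqP qy]; have := H p; rewrite E qy.
  by rewrite eqxx.
rewrite inE; case: v => [q|q] Hq.
  have [p p7 E] := coord_inj_onto (ltn_ord q) Hq; exists p.
  have := Hf p; case: (f p) => [q' [_ E']|q' E']; last by rewrite /= in E'; rewrite E' ltnNge -ltnS ltn_ord in p7.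
  by congr inl; apply: val_inj; rewrite /= -E' -E.
have [p E] : exists p, tau p = q.
  case: (eqVneq (q : nat) 7) => q7; last by apply: (sk_onto S) => //; rewrite (leq_trans (ltn_ord q)).
  have : ~~ mu by apply: contraNN Hq => ->; rewrite -val_eqE /= q7.
  by rewrite negbK => /existsP[p /eqP pE]; exists p; rewrite pE q7.
exists p; have := Hf p; case: (f p) => [q' [p7 _]|q' E'].
  by rewrite E ltnNge -ltnS ltn_ord in p7.
by congr inr; apply: val_inj; rewrite /= -E' -E.
Qed.

End Fixed.

Lemma skeleton_vega tau0 : skeleton e tau0 ->
  exists i mu nu, 2 <= i /\ blowup_on e (@vega_rel i) (vega_set i mu nu).
Proof.
case/ordered_skeleton=> tau [S n_rb n_g g_range b_range].
exists #|colour tau cR|, (~~ [exists p, tau p == 7]), (#|colour tau cG| == #|colour tau cB|); split.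
  by rewrite n_rb ltnS card_gt0 (colour_neq0 S).
exact: vega_blowup.
Qed.
End VegaMap.

(** * Graphs without an induced hexagon *)

Section NoHexagon.
Variables (T : finType) (e : rel T).
Hypotheses (e_sym : symmetric e) (e_irr : irreflexive e).
Hypothesis e_mtf : maximal_triangle_free e.
Hypothesis e_D : prop_D e 4.
Hypothesis tw : twin_free e.
Hypothesis no_hexagon : forall p0 p1 p2 p3 p4 p5,
  e p0 p1 -> e p1 p2 -> e p2 p3 -> e p3 p4 -> e p4 p5 -> e p5 p0 ->
  [|| e p0 p3, e p1 p4 | e p2 p5].

Let tri : forall x y z, e x y -> e y z -> e x z -> False := no_triangle e_sym e_mtf.
Let nbrN x y z : e x z -> e y z -> ~~ e x y := @common_nbrN _ _ e_sym e_mtf x y z.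

Section Root.
Variable g0 : T.
Let trace p := [set r | e g0 r && e p r].

(** In the hexagon g0, r1, p, z, q, r2 the only long diagonal that can be present is g0 z. *)
Lemma crossing_nbr p q r1 r2 z : ~~ e g0 p -> ~~ e g0 q -> ~~ e p q ->
  e g0 r1 -> e p r1 -> ~~ e q r1 -> e g0 r2 -> ~~ e p r2 -> e q r2 ->
  e p z -> e q z -> e g0 z.
Proof.
move=> gp gq pq gr1 pr1 qr1 gr2 pr2 qr2 pz qz.
have := @no_hexagon g0 r1 p z q r2.
rewrite gr1 (e_sym r1) pr1 pz (e_sym z) qz qr2 (e_sym r2) gr2 (e_sym r1) (negPf qr1) (negPf pr2) !orbF.
by apply.
Qed.

Lemma disjoint_traces p q : ~~ e g0 p -> ~~ e g0 q ->
  (forall r, e g0 r -> e p r -> ~~ e q r) -> e p q.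
Proof.
move=> gp gq dis; apply/negPn/negP=> pq.
have [z pz qz] := common_nbr e_sym e_mtf e_D pq.
have [r1 gr1 pr1] := common_nbr e_sym e_mtf e_D gp.
have [r2 gr2 qr2] := common_nbr e_sym e_mtf e_D gq.
have qr1 := dis r1 gr1 pr1.
have pr2 : ~~ e p r2 by apply/negP=> /(dis _ gr2); rewrite qr2.
have gz := crossing_nbr gp gq pq gr1 pr1 qr1 gr2 pr2 qr2 pz qz.
by have := dis z gz pz; rewrite qz.
Qed.

(** The claim [sub] shows that a non-neighbour of g0 that sees one vertex of the trace of p sees all
    of it. Neighbours of g0 see none of it, so the trace consists of twins and is a single
    vertex. *)
Lemma minimal_trace : exists p r0, [/\ ~~ e g0 p, e g0 r0, e p r0 &
  forall r, e g0 r -> e p r -> r = r0].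
Proof.
have gg : ~~ e g0 g0 by rewrite e_irr.
case: (@arg_minnP _ g0 (fun p => ~~ e g0 p) (fun p => #|trace p|) gg) => p gp pmin.
have [r0 gr0 pr0] := common_nbr e_sym e_mtf e_D gp.
(* If q misses r1, minimality gives it an r2 outside the trace of p. The hexagon z, r1, p, z', r2, q
   forces the edge z z'. As z misses r, minimality also gives z an r3 outside that trace, and the
   hexagon z', z, r3, g0, r, p has no long diagonal. *)
have sub q r : ~~ e g0 q -> e g0 r -> e p r -> e q r -> forall r', e g0 r' -> e p r' -> e q r'.
  move=> gq gr pr qr r1 gr1 pr1; apply/negPn/negP=> qr1.
  have pq : ~~ e p q := nbrN pr qr.
  have [r2] : exists2 r2, r2 \in trace q & r2 \notin trace p.
    apply/subsetPn/negP=> tqp; have /subset_leqif_cards[_] := tqp.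
    rewrite eqn_leq subset_leq_card ?pmin //= => /esym/eqP/setP/(_ r1).
    by rewrite !inE gr1 pr1 (negPf qr1).
  rewrite !inE => /andP[gr2 qr2]; rewrite gr2 /= => pr2.
  have [z r1z qz] : exists2 z, e r1 z & e q z by apply: common_nbr; rewrite // e_sym.
  have [z' r2z' pz'] : exists2 z', e r2 z' & e p z' by apply: common_nbr; rewrite // e_sym.
  have gz : ~~ e g0 z by apply: (nbrN gr1); rewrite e_sym.
  have gz' : ~~ e g0 z' by apply: (nbrN gr2); rewrite e_sym.
  have r12 : ~~ e r1 r2 by apply: (@nbrN r1 r2 g0); rewrite e_sym.
  have zz' : e z z'.
    have := @no_hexagon z r1 p z' r2 q.
    rewrite (e_sym z r1) r1z (e_sym r1 p) pr1 pz' (e_sym z' r2) r2z' (e_sym r2 q) qr2 qz.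
    by rewrite (negPf r12) (negPf pq) !orbF; apply.
  have zr : ~~ e z r by apply: (@nbrN z r q); rewrite e_sym.
  have [r3] : exists2 r3, r3 \in trace z & r3 \notin trace p.
    apply/subsetPn/negP=> tqp; have /subset_leqif_cards[_] := tqp.
    rewrite eqn_leq subset_leq_card ?pmin //= => /esym/eqP/setP/(_ r).
    by rewrite !inE gr pr (negPf zr).
  rewrite !inE => /andP[gr3 zr3]; rewrite gr3 /= => pr3.
  have := @no_hexagon z' z r3 g0 r p.
  rewrite (e_sym z' g0) (negPf gz') (negPf zr) (e_sym r3 p) (negPf pr3).
  rewrite (e_sym z' z) zz' zr3 (e_sym r3) gr3 gr (e_sym r) pr pz'.
  by do 6 move=> /(_ isT).
exists p, r0; split=> // r gr pr; apply: tw => q; rewrite !(e_sym _ q).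
have [gq|gq] := boolP (e g0 q); last by apply/idP/idP => /sub; apply.
have nq r' : e g0 r' -> ~~ e q r' by move=> gr'; apply: (@nbrN q r' g0); rewrite e_sym.
by rewrite !(negPf (nq _ _)).
Qed.

Section Classes.
Variables (p r0 : T).
Hypotheses (gp : ~~ e g0 p) (gr0 : e g0 r0) (pr0 : e p r0).
Hypothesis p_min : forall r, e g0 r -> e p r -> r = r0.

(** If the chain fails, p misses r1 and r2, because its only neighbour in R is r0. Take common
    neighbours s of r1 and p, and s' of r2 and p. By [cross] the pairs s, r2 and s', r1 are
    non-adjacent, so the hexagon s, r1, g0, r2, s', p has no long diagonal. *)
Lemma root_chain q q' r1 r2 : ~~ e g0 q -> ~~ e g0 q' -> e q r0 -> e q' r0 ->
  e g0 r1 -> e g0 r2 -> e q r1 -> e q' r2 -> e q r2 || e q' r1.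
Proof.
move=> gq gq' qr0 q'r0 gr1 gr2 qr1 q'r2; apply/negPn; rewrite negb_or; apply/negP=> /andP[qr2 q'r1].
have pr1 : ~~ e p r1 by apply/negP=> /(p_min gr1) E; move: q'r1; rewrite E q'r0.
have pr2 : ~~ e p r2 by apply/negP=> /(p_min gr2) E; move: qr2; rewrite E qr0.
have far s : e p s -> ~~ e r0 s by move=> ps; apply: (@nbrN r0 s p); rewrite e_sym.
have cross a b u v w : e a r0 -> e b r0 -> e a u -> e b v -> ~~ e a v -> ~~ e b u ->
   e u w -> e p w -> ~~ e v w.
  move=> ar0 br0 au bv av bu uw pw; apply/negP=> vw.
  have := @no_hexagon a r0 b v w u.
  rewrite ar0 (e_sym r0 b) br0 bv vw (e_sym w u) uw (e_sym u a) au.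
  do 6 move=> /(_ isT).
  by rewrite (negPf av) (negPf bu) (negPf (far w pw)).
have [s r1s ps] : exists2 s, e r1 s & e p s by apply: common_nbr; rewrite // e_sym.
have [s' r2s' ps'] : exists2 s', e r2 s' & e p s' by apply: common_nbr; rewrite // e_sym.
have r2s := cross q q' r1 r2 s qr0 q'r0 qr1 q'r2 qr2 q'r1 r1s ps.
have r1s' := cross q' q r2 r1 s' q'r0 qr0 q'r2 qr1 q'r1 qr2 r2s' ps'.
have := @no_hexagon s r1 g0 r2 s' p.
rewrite (e_sym s r1) r1s (e_sym r1 g0) gr1 gr2 r2s' (e_sym s') ps' ps.
do 6 move=> /(_ isT).
by rewrite (e_sym s) (negPf r2s) (negPf r1s') (negPf gp).
Qed.

Definition trichotomy (c : 'I_3) : {set T} :=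
  if c == cR then [set x | e g0 x] else if c == cG then [set x | e x r0]
  else [set x | ~~ e g0 x && ~~ e x r0].

Local Notation C := trichotomy.

Lemma memR x : (x \in C cR) = e g0 x. Proof. by rewrite inE. Qed.
Lemma memG x : (x \in C cG) = e x r0. Proof. by rewrite inE. Qed.
Lemma memB x : (x \in C cB) = ~~ e g0 x && ~~ e x r0. Proof. by rewrite inE. Qed.

Lemma g_notR x : e x r0 -> ~~ e g0 x.
Proof. by move=> xr; apply: (nbrN gr0). Qed.

(** The trace of p is r0 alone, hence disjoint from that of x. So p is a common neighbour of the
    whole third class, which is therefore independent. *)
Lemma b_adj x : ~~ e g0 x -> ~~ e x r0 -> e x p.
Proof.
move=> gx xr; apply: disjoint_traces => // r gr xr'.
by apply/negP=> /(p_min gr) E; move: xr; rewrite -E xr'.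
Qed.

Lemma trichotomyP x : exists c, x \in C c.
Proof.
have [gx|gx] := boolP (e g0 x); first by exists cR; rewrite memR.
have [xr|xr] := boolP (e x r0); first by exists cG; rewrite memG.
by exists cB; rewrite memB gx.
Qed.

Lemma tri_indep c x y : x \in C c -> y \in C c -> ~~ e x y.
Proof.
have [->|->|->] := colour3 c; rewrite ?memR ?memG ?memB.
- by move=> gx gy; apply: (@nbrN x y g0); rewrite e_sym.
- exact: nbrN.
by move=> /andP[gx xr] /andP[gy yr]; apply: (@nbrN x y p); apply: b_adj.
Qed.

Lemma tri_disj c d x : x \in C c -> x \in C d -> c = d.
Proof.
pose f x := if e g0 x then cR else if e x r0 then cG else cB.
have E a : x \in C a -> a = f x; last by move=> /E -> /E.
rewrite /f; have [->|->|->] := colour3 a; rewrite ?memR ?memG ?memB; first by move=> ->.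
  by move=> xr; rewrite (negPf (g_notR xr)) xr.
by case/andP=> /negPf -> /negPf ->.
Qed.

Lemma chainR c x x' y y' : c != cR -> x \in C cR -> x' \in C cR -> y \in C c -> y' \in C c ->
  e x y -> e x' y' -> e x y' || e x' y.
Proof.
rewrite !memR => cR' gx gx' yc y'c xy x'y'; rewrite (e_sym x) (e_sym x') orbC.
have [E|E|E] := colour3 c; move: cR' yc y'c; rewrite {}E // => _.
  rewrite !memG => yr y'r; apply: root_chain; rewrite ?g_notR //; by rewrite e_sym.
rewrite !memB => /andP[gy yr] /andP[gy' y'r].
apply/negPn; rewrite negb_or; apply/negP=> /andP[h1 h2].
have yy' : ~~ e y y' by apply: (@nbrN y y' p); apply: b_adj.
(* The common neighbour p of y and y' would have to lie in R by [crossing_nbr]. *)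
have : e g0 p; last by rewrite (negPf gp).
by apply: (@crossing_nbr y y' x x') => //; rewrite ?b_adj // e_sym.
Qed.

(** By [disjoint_traces] the non-adjacent pairs x, y' and x', y have common neighbours r1 and r2 in
    R. Then [root_chain] yields the edge x r2 or x' r1, which closes a triangle with x y or x'
    y'. *)
Lemma chainGB x x' y y' : x \in C cG -> x' \in C cG -> y \in C cB -> y' \in C cB ->
  e x y -> e x' y' -> e x y' || e x' y.
Proof.
rewrite !memG !memB => xr x'r /andP[gy yr] /andP[gy' y'r] xy x'y'.
apply/negPn; rewrite negb_or; apply/negP=> /andP[h1 h2].
have meet a b : e a r0 -> ~~ e g0 b -> ~~ e a b -> exists2 r, e g0 r & e a r && e b r.
  move=> ar gb ab; have [/existsP[r /and3P[]]|/existsPn H] := boolP [exists r, [&& e g0 r, e a r & e b r]].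
    by exists r => //; apply/andP.
  move: ab; rewrite (disjoint_traces (g_notR ar) gb) // => r gr ar'.
  by have := H r; rewrite gr ar'.
have [r1 gr1 /andP[xr1 y'r1]] := meet x y' xr gy' h1.
have [r2 gr2 /andP[x'r2 yr2]] := meet x' y x'r gy h2.
have /orP[H|H] := root_chain (g_notR xr) (g_notR x'r) xr x'r gr1 gr2 xr1 x'r2.
  by apply: (tri xy yr2 H).
by apply: (tri x'y' y'r1 H).
Qed.

Lemma tri_chain i j x x' y y' : i != j -> x \in C i -> x' \in C i -> y \in C j -> y' \in C j ->
  e x y -> e x' y' -> e x y' || e x' y.
Proof.
wlog le : i j x x' y y' / i <= j.
  move=> H ij xi x'i yj y'j xy x'y'; case: (leqP i j) => [le|/ltnW le]; first exact: (H i j).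
  by rewrite (e_sym x) (e_sym x') orbC; apply: (H j i) => //; rewrite 1?eq_sym // e_sym.
move: le; have [->|->|->] := colour3 i; have [->|->|->] := colour3 j => // _ _.
- exact: chainR.
- exact: chainR.
exact: chainGB.
Qed.

Lemma tri_third i j k x y : i != j -> i != k -> j != k -> x \in C i -> y \in C j -> ~~ e x y ->
  exists2 z, z \in C k & e x z && e y z.
Proof.
move=> ij ik jk xi yj xy; have [z xz yz] := common_nbr e_sym e_mtf e_D xy.
exists z; last by rewrite xz.
have [c zc] := trichotomyP z; have [<- //|ck] := eqVneq c k.
have ci : c != i by apply: contraTneq xz => E; rewrite E in zc; apply: tri_indep xi zc.
have cj : c != j by apply: contraTneq yz => E; rewrite E in zc; apply: tri_indep yj zc.
by have /orP[] := ord3_cases ij ik jk ci; rewrite ?(negPf cj) ?(negPf ck).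
Qed.

Lemma tri_twins i x x' : x \in C i -> x' \in C i ->
  (forall j y, j != i -> y \in C j -> e x y = e x' y) -> x = x'.
Proof.
move=> xi x'i H; apply: tw => z; have [c zc] := trichotomyP z.
have [E|ci] := eqVneq c i; last exact: H ci zc.
by rewrite E in zc; rewrite (negPf (tri_indep xi zc)) (negPf (tri_indep x'i zc)).
Qed.

Lemma fullRG : full e C cR cG.
Proof. by exists r0; rewrite ?memR // => y; rewrite memG e_sym. Qed.

Lemma fullGR : full e C cG cR.
Proof. by exists g0; rewrite ?memG // => y; rewrite memR. Qed.

Lemma fullGB : full e C cG cB.
Proof. by exists p; rewrite ?memG // => y; rewrite memB => /andP[gy yr]; rewrite e_sym b_adj. Qed.

Lemma not_fullBG : ~ full e C cB cG.
Proof. by case=> b; rewrite memB => /andP[gb _] /(_ g0); rewrite memG gr0 e_sym (negPf gb) => /(_ isT). Qed.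

Lemma card_RG : #|C cR| = #|C cG|.
Proof.
apply/eqP; rewrite eqn_leq.
by rewrite (card_full e_sym tri tri_chain tri_third tri_twins (j := cR) (i := cG) (k := cB)) //;
   rewrite ?(card_full e_sym tri tri_chain tri_third tri_twins (j := cG) (i := cR) (k := cB)) //;
   [exact: fullRG | exact: fullGR].
Qed.

Lemma card_RB : #|C cR| = #|C cB|.+1.
Proof.
rewrite card_RG; apply/eqP; rewrite eqn_leq (card_le_succ tri tri_chain tri_third tri_twins (k := cR)) //=.
(* An empty third class is possible, namely for the single edge Gamma_1, and lies outside
   [card_not_full]; then p shows that the second class is non-empty. *)
have [->|Bn] := eqVneq (C cB) set0; last first.
  by apply: (card_not_full e_sym tri tri_chain tri_third tri_twins (k := cR)) => //; [exact: fullGB|exact: not_fullBG].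
by rewrite cards0 card_gt0; apply/set0Pn; exists p; rewrite memG.
Qed.

Lemma andrasfai_blowup : exists2 k, 1 <= k & blowup e (@andrasfai_rel k).
Proof.
have n_g : (#|C cG| == #|C cR|) || (#|C cG| == #|C cB|) by rewrite card_RG eqxx.
have g_range y : y \in C cG -> 0 < dg e C cR y <= #|C cG|.
  by move=> yG; rewrite (full_pos e_sym fullRG) // -card_RG dg_le.
have b_range z : z \in C cB -> 0 < dg e C cG z <= #|C cB|.
  move=> zB; rewrite (full_pos e_sym fullGB) // -ltnS -card_RB card_RG.
  have Bn : C cB != set0 by apply/set0Pn; exists z.
  exact: (not_full_lt e_sym tri_chain _ Bn not_fullBG).
exists #|C cR|; first by rewrite card_RB.
have lt x : coord e C x < 3 * #|C cR| - 1.
  have [c xc] := trichotomyP x.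
  exact: (coord_lt tri_disj card_RB n_g g_range b_range xc).
exists (fun x => Ordinal (lt x)); split=> [x|u _|x y]; first by rewrite inE.
  have [|c [x [xc E]]] := coord_onto tri tri_disj tri_chain tri_third tri_twins card_RB n_g g_range b_range (ltn_ord u).
    have : #|C cG| != #|C cB| by rewrite -card_RG card_RB neq_ltn ltnSn orbT.
    by move=> /negPf ->.
  by exists x; apply: val_inj.
have [[c xc] [d yd]] := (trichotomyP x, trichotomyP y).
exact: (rel_coord e_sym tri tri_indep tri_disj tri_chain tri_third tri_twins card_RB n_g g_range b_range xc yd).
Qed.

End Classes.
End Root.

Lemma no_hexagon_andrasfai : 0 < #|T| -> exists2 k, 1 <= k & blowup e (@andrasfai_rel k).
Proof.
case/card_gt0P=> g0 _; have [p [r0 [gp gr0 pr0 pm]]] := minimal_trace g0.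
exact: andrasfai_blowup gp gr0 pr0 pm.
Qed.

End NoHexagon.

(** * The converse *)

(* Averaging: some [v], chosen with probability proportional to [w], sees more than a third of the [xs j]. *)
Lemma weighted_prop_D (T U : finType) (e : rel T) (h : rel U) (S : {set U}) (w : U -> nat) m :
  blowup_on e h S -> (forall v, v \notin S -> w v = 0) ->
  (forall u, u \in S -> \sum_v w v < 3 * \sum_v w v * h u v) -> prop_D e m.
Proof.
move=> [f [fS f_onto ef]] w0 Hw k /andP[k0 _] xs; set W := \sum_v w v in Hw.
have [/existsP[y Hy]|/existsPn H] := boolP [exists y, k < #|[pred j | e (xs j) y]|]; first by exists y.
have le v : w v * #|[pred j | h (f (xs j)) v]| <= w v * k.
  have [vS|/w0->] := boolP (v \in S); last by rewrite !mul0n.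
  have [y fy] := f_onto v vS; rewrite leq_mul2l leqNgt; apply/orP; right.
  apply: contraNN (H y) => lt; apply: leq_trans lt _; apply: subset_leq_card.
  by apply/subsetP=> j; rewrite !inE ef fy.
have S1 : \sum_v w v * #|[pred j | h (f (xs j)) v]| <= W * k.
  by rewrite big_distrl; apply: leq_sum => v _; apply: le.
have S2 : \sum_v w v * #|[pred j | h (f (xs j)) v]| = \sum_j \sum_v w v * h (f (xs j)) v.
  rewrite exchange_big; apply: eq_bigr => v _; rewrite -big_distrr -sum1_card big_mkcond.
  by congr (_ * _); apply: eq_bigr => j _; rewrite inE; case: (h _ _).
have : \sum_(j < 3 * k) W.+1 <= \sum_(j < 3 * k) 3 * \sum_v w v * h (f (xs j)) v.
  by apply: leq_sum => j _; apply: Hw.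
rewrite sum_nat_const card_ord -big_distrr -S2 /=; move: S1 k0; clear.
move: (\sum_v _) W => s W; clear; nia.
Qed.

Lemma sum_interval n a b : b <= n -> \sum_(p < n) ((a <= p) && (p < b)) = b - a.
Proof.
move=> bn; rewrite -(big_mkord xpredT (fun p => nat_of_bool ((a <= p) && (p < b)))).
rewrite (big_cat_nat (n := b)) //= [X in _ + X]big_nat_cond [X in _ + X]big1 ?addn0; last first.
  by move=> p /andP[/andP[bp _] _]; rewrite [p < b]ltnNge bp andbF.
have [ab|/ltnW ba] := leqP a b.
  rewrite (big_cat_nat (n := a)) //= big_nat_cond big1 ?add0n; last first.
    by move=> p /andP[/andP[_ pa] _]; rewrite leqNgt pa.
  rewrite (eq_big_nat _ _ (fun p (ab : a <= p < b) => congr1 nat_of_bool ab)).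
  by rewrite sum_nat_const_nat muln1.
rewrite big_nat_cond big1 ?(eqP ba) // => p /andP[/andP[_ pb] _].
by rewrite leqNgt (leq_trans pb).
Qed.

(** Cutting the circle at 0 splits the neighbourhood into a part below p and a part above it;
    truncated subtraction and [minn] clip them to the range. *)
Lemma andrasfai_intervals k p q : 0 < k -> p < 3 * k - 1 -> q < 3 * k - 1 ->
  nat_of_bool (nat_andrasfai k p q) =
  ((p.+1 - 2 * k <= q) && (q < p.+1 - k)) + ((p + k <= q) && (q < minn (p + 2 * k) (3 * k - 1))).
Proof.
move=> k0 pn qn; case: (leqP p q) => [pq|/ltnW qp].
  rewrite (andrasfai_le _ (_ : p <= q < 3 * k - 1)).1 ?pq //.
  by rewrite -[RHS]/(nat_of_bool _ + nat_of_bool _); lia.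
rewrite (andrasfai_le _ (_ : q <= p < 3 * k - 1)).2 ?qp //.
by rewrite -[RHS]/(nat_of_bool _ + nat_of_bool _); lia.
Qed.

Lemma andrasfai_degree k p : 0 < k -> p < 3 * k - 1 -> \sum_(q < 3 * k - 1) nat_andrasfai k p q = k.
Proof.
move=> k0 pn; under eq_bigr => q _ do rewrite (andrasfai_intervals k0 pn (ltn_ord q)).
rewrite big_split /= !sum_interval ?geq_minr //; lia.
Qed.

(** Constant weights suffice: the degree k is more than a third of the 3k - 1 vertices. *)
Lemma andrasfai_prop_D (T : finType) (e : rel T) k m : 1 <= k -> blowup e (@andrasfai_rel k) -> prop_D e m.
Proof.
move=> k1 B; apply: (weighted_prop_D (w := fun=> 1) B) => [v|u _]; first by rewrite inE.
rewrite sum1_card card_ord; under eq_bigr => v _ do rewrite mul1n.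
rewrite (eq_bigr (fun v : 'I_(3 * k - 1) => nat_of_bool (nat_andrasfai k u v))) //.
by rewrite andrasfai_degree //; move: k1; clear; lia.
Qed.

(** * Weights for the Vega graphs *)

Section VegaWeights.
Variables (i : nat).
Hypothesis i2 : 2 <= i.
Local Notation n := (3 * i - 1).

(* Found by linear programming: the total is 27 i - 13, and every vertex sees at least 9 i - 4. *)
Definition core_weight p := if p == 0 then 2 else if p == i then 4 else if p == 2 * i - 1 then 0 else 3.

Definition letter_weight q :=
  nth 0 [:: 3 * i; 3 * i - 1; 3 * i - 2; 3 * i - 1; 3 * i - 2; 3 * i - 3; 2; 0] q.

Definition vega_weight (v : vega_vertex i) :=
  match v with inl p => core_weight p | inr q => letter_weight q end.

(* The corrections are placed so as to avoid truncated subtraction. *)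
Lemma core_sum (P : nat -> bool) :
  \sum_(p < n) core_weight p * P p + P 0 + 3 * P (2 * i - 1) = 3 * \sum_(p < n) P p + P i.
Proof.
have pt c : c < n -> \sum_(p < n) (p == c :> nat) * P p = P c.
  move=> cn; rewrite (bigD1 (Ordinal cn)) //= eqxx mul1n big1 ?addn0 // => p pc.
  by have /negPf -> : p != c :> nat by rewrite -val_eqE in pc.
rewrite -(pt 0) -?(pt i) -?(pt (2 * i - 1)) ?big_distrr -?big_split; [|lia..].
apply: eq_bigr => p _ /=; case: (P p); rewrite ?muln0 ?muln1 // /core_weight.
by move: (p : nat) => a; do 3 case: eqP => ? /=; lia.
Qed.

Lemma sum_red : \sum_(p < n) (p < i) = i.
Proof. by have := @sum_interval n 0 i; rewrite subn0; apply; lia. Qed.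

Lemma sum_green : \sum_(p < n) ((i <= p) && (p < 2 * i)) = i.
Proof. by rewrite sum_interval; lia. Qed.

Lemma sum_blue : \sum_(p < n) (2 * i <= p) = i - 1.
Proof.
have := @sum_interval n (2 * i) n (leqnn _); rewrite (eq_bigr (fun p : 'I_n => nat_of_bool (2 * i <= p))).
  by move=> ->; lia.
by move=> p _; rewrite ltn_ord andbT.
Qed.

Lemma vega_sum (F : vega_vertex i -> nat) : \sum_v F v = \sum_(p < n) F (inl p) + \sum_(q < 8) F (inr q).
Proof. exact: big_sumType. Qed.

Lemma total_weight : \sum_v vega_weight v = 27 * i - 13.
Proof.
rewrite vega_sum /=; have := core_sum xpredT; rewrite sum_nat_const card_ord.
under [X in X + _ + _]eq_bigr => p _ do rewrite muln1.
rewrite !big_ord_recl big_ord0 /letter_weight /= ; lia.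
Qed.

Lemma letters_sum k l : [seq krel k q | q <- iota 0 8] = l ->
  \sum_(q < 8) letter_weight q * krel k q =
  3 * i * nth false l 0 + (3 * i - 1) * nth false l 1 + (3 * i - 2) * nth false l 2 + (3 * i - 1) * nth false l 3
  + (3 * i - 2) * nth false l 4 + (3 * i - 3) * nth false l 5 + 2 * nth false l 6.
Proof. by move=> <-; rewrite !big_ord_recl big_ord0 !addnA -[RHS]addn0 -[RHS]addn0. Qed.

Lemma core_degree (p : 'I_n) : 9 * i - 4 <= \sum_v vega_weight v * vega_rel (inl p) v.
Proof.
have i0 : 0 < i by apply: ltnW.
rewrite vega_sum /=; under eq_bigr => q _ do rewrite vega_rel_core //.
under [X in _ <= _ + X]eq_bigr => q _ do rewrite vega_relC vega_rel_letter_core //.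
have := core_sum (nat_andrasfai i p); rewrite andrasfai_degree //.
have up q : p <= q < n -> nat_andrasfai i p q = (i <= q - p <= 2 * i - 1) by case/(andrasfai_le i0).
have down q : q <= p -> nat_andrasfai i p q = (i <= p - q <= 2 * i - 1).
  by move=> qp; have [|_ ->] := @andrasfai_le i q p i0; rewrite // qp ltn_ord.
rewrite down //; move: up down (ltn_ord p); rewrite /kind_at; move: (p : nat) => a up down an.
have [ai|ia] := ltnP a i; last have [a2|a2] := ltnP a (2 * i).
- have -> : (i <= a - 0 <= 2 * i - 1) = false by move: ai; clear; lia.
  have -> : nat_andrasfai i a (2 * i - 1) = true by rewrite up; move: ai i2; clear; lia.
  rewrite (letters_sum erefl) /=; move: (\sum_(_ < _) _) (nat_andrasfai _ _ _) i2 => s [] /=; clear; lia.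
- have -> : (i <= a - 0 <= 2 * i - 1) = true by move: ia a2; clear; lia.
  have -> : nat_andrasfai i a (2 * i - 1) = false by rewrite up; move: a2 ia i2; clear; lia.
  rewrite (letters_sum erefl) /=; move: (\sum_(_ < _) _) (nat_andrasfai _ _ _) i2 => s [] /=; clear; lia.
have -> : (i <= a - 0 <= 2 * i - 1) = false by move: a2 i2; clear; lia.
have -> : nat_andrasfai i a (2 * i - 1) = false by rewrite down; move: an a2 i2; clear; lia.
have -> : nat_andrasfai i a i = true by rewrite down; move: an a2 i2; clear; lia.
by rewrite (letters_sum erefl) /=; move: (\sum_(_ < _) _) i2 => s; clear; lia.
Qed.

Lemma red_weight : \sum_(p < n) core_weight p * (p < i) = 3 * i - 1.
Proof. by have := core_sum (fun p => p < i); rewrite sum_red; move: i2; clear; lia. Qed.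

Lemma green_weight : \sum_(p < n) core_weight p * ((i <= p) && (p < 2 * i)) = 3 * i - 2.
Proof. by have := core_sum (fun p => (i <= p) && (p < 2 * i)); rewrite sum_green; move: i2; clear; lia. Qed.

Lemma blue_weight : \sum_(p < n) core_weight p * (2 * i <= p) = 3 * i - 3.
Proof. by have := core_sum (fun p => 2 * i <= p); rewrite sum_blue; move: i2; clear; lia. Qed.

Lemma colours_sum q l : [seq krel k q | k <- iota 8 3] = l ->
  \sum_(p < n) core_weight p * krel (kind_at i p) q =
  (3 * i - 1) * nth false l 0 + (3 * i - 2) * nth false l 1 + (3 * i - 3) * nth false l 2.
Proof.
move=> <-; rewrite -[in RHS]red_weight -[in RHS]green_weight -[in RHS]blue_weight !big_distrl -!big_split /=.
apply: eq_bigr => p _; rewrite -!mulnA -!mulnDr /kind_at; congr (_ * _).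
have [pi|ip] := ltnP p i; last have [p2|p2] := ltnP p (2 * i); rewrite ?mul1n ?addn0 //.
by have -> : (2 * i <= p) = false; [move: pi; clear; lia|rewrite addn0].
Qed.

Lemma letter_degree (q : 'I_8) : 9 * i - 4 <= \sum_v vega_weight v * vega_rel (inr q) v.
Proof.
rewrite vega_sum /=; under eq_bigr => p _ do rewrite vega_rel_letter_core //.
under [X in _ <= _ + X]eq_bigr => q' _ do rewrite vega_rel_letters //.
rewrite (letters_sum erefl) (colours_sum erefl).
case: q => [[|[|[|[|[|[|[|[|]]]]]]]] ?] //=; move: i2; clear; lia.
Qed.

End VegaWeights.

(** The weights vanish at y and at 2i - 1, so deleting these vertices changes no sum and one choice
    of weights serves all four graphs. *)
Lemma vega_prop_D (T : finType) (e : rel T) i mu nu m :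
  2 <= i -> blowup_on e (@vega_rel i) (vega_set i mu nu) -> prop_D e m.
Proof.
move=> i2 B; apply: (weighted_prop_D (w := @vega_weight i) B) => [v|u _].
  rewrite inE; case: v => [p|q] /negbNE/andP[_ /eqP E] /=.
    by rewrite /core_weight E eqxx; move: i2; clear; do 2 (case: eqP => [|_]; first lia).
  by rewrite E.
(* Three times 9i - 4 exceeds the total 27i - 13 by exactly one. *)
rewrite total_weight //; have : 9 * i - 4 <= \sum_v vega_weight v * vega_rel u v.
  by case: u => [p|q]; [exact: core_degree | exact: letter_degree].
by move: (\sum_v _) => s; move: i2; clear; lia.
Qed.

(** * Proof of the theorem *)

Section Structure.
Variables (T : finType) (e : rel T).
Hypotheses (e_sym : symmetric e) (e_irr : irreflexive e).
Hypothesis e_mtf : maximal_triangle_free e.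
Hypothesis e_D : prop_D e 4.

Definition classified (T : finType) (e : rel T) :=
  (exists2 k : nat, 1 <= k & blowup e (@andrasfai_rel k)) \/
  (exists i : nat, exists mu nu : bool, 2 <= i /\ blowup_on e (@vega_rel i) (vega_set i mu nu)).

Lemma twin_free_classified : twin_free e -> 0 < #|T| -> classified e.
Proof.
move=> tw T0.
(* By triangle-freeness, six vertices with these edges and no long diagonal are distinct and have no
   short diagonals either, so this is an induced hexagon. *)
pose hexagon (p : 'I_6 -> T) := [&& maps e hexagon_edges (p \o inord), ~~ e (p (inord 0)) (p (inord 3)),
  ~~ e (p (inord 1)) (p (inord 4)) & ~~ e (p (inord 2)) (p (inord 5))].
have [/existsP[p /and4P[/= pe p03 p14 p25]]|/existsPn H] := boolP [exists p : {ffun 'I_6 -> T}, hexagon p].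
  right; pose s := [seq p (inord j) | j <- iota 0 6].
  have [|||| tau S] := @skeleton_of_hexagon T e e_sym e_irr e_mtf e_D s (p (inord 0)) => //.
  exact: (skeleton_vega e_sym e_mtf e_D tw S).
left; apply: (no_hexagon_andrasfai e_sym e_irr e_mtf e_D tw _ T0) => p0 p1 p2 p3 p4 p5 e01 e12 e23 e34 e45 e50.
have := H [ffun j : 'I_6 => nth p0 [:: p0; p1; p2; p3; p4; p5] j].
rewrite /hexagon /maps /= !ffunE !inordK //= e01 e12 e23 e34 e45 e50 /=.
by rewrite -!negb_or negbK.
Qed.

End Structure.

(** * Identification of twins *)

Section Twins.
Variables (T : finType) (e : rel T).
Hypotheses (e_sym : symmetric e) (e_irr : irreflexive e).
Hypothesis e_mtf : maximal_triangle_free e.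

Definition twin x y := [forall z, e x z == e y z].
(** The result depends only on the twin class, because [pick] agrees on extensionally equal
    predicates; the default [x] is never returned by [odflt], as [x] is its own twin. *)
Definition repr x := odflt x [pick y | twin x y].

Lemma twinP x y : reflect (forall z, e x z = e y z) (twin x y).
Proof. by apply: (iffP forallP) => H z; apply/eqP. Qed.

Lemma repr_twin x z : e (repr x) z = e x z.
Proof.
rewrite /repr; case: pickP => [y /twinP -> //|/(_ x)].
by move/negP; case; apply/twinP.
Qed.

Lemma eq_repr x y : (forall z, e x z = e y z) -> repr x = repr y.
Proof.
move=> H; rewrite /repr (@eq_pick _ (twin x) (twin y)).
  by case: pickP => //= /(_ y) /negP[]; apply/twinP.
by move=> w; apply/twinP/twinP=> H' z; rewrite ?H // -H.
Qed.

Local Notation reprs := {x | repr x == x}.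

Definition to_repr x : reprs := exist _ (repr x) (introT eqP (eq_repr (repr_twin x))).

Local Notation e' := (relpre (val : reprs -> T) e).

Lemma to_repr_rel x y : e' (to_repr x) (to_repr y) = e x y.
Proof. by rewrite /= repr_twin e_sym repr_twin e_sym. Qed.

Lemma to_repr_val x : to_repr (val x) = x.
Proof. by apply: val_inj; apply/eqP/(valP x). Qed.

Lemma reprs_twin_free : twin_free e'.
Proof.
move=> x y H; rewrite -(to_repr_val x) -(to_repr_val y); apply: val_inj; apply: eq_repr => z.
by have := H (to_repr z); rewrite /= !(e_sym _ (repr z)) !repr_twin !(e_sym z).
Qed.

Lemma reprs_mtf : maximal_triangle_free e'.
Proof.
split=> [x y z|x y xy nxy]; first exact: e_mtf.1.
have [z] := e_mtf.2 (val x) (val y) xy nxy; exists (to_repr z).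
by rewrite /= e_sym !repr_twin e_sym.
Qed.

Lemma reprs_prop_D k : prop_D e k -> prop_D e' k.
Proof.
move=> De m mk xs; have [y Hy] := De m mk (val \o xs); exists (to_repr y).
by apply: leq_trans Hy _; apply: subset_leq_card; apply/subsetP=> j; rewrite !inE /= e_sym -repr_twin e_sym.
Qed.

Lemma reprs_blowup (U : finType) (h : rel U) S : blowup_on e' h S -> blowup_on e h S.
Proof.
move=> [f [fS f_onto fe]]; exists (f \o to_repr); split=> [x|u /f_onto[x <-]|x y]; first exact: fS.
  by exists (val x); rewrite /= to_repr_val.
by rewrite -to_repr_rel; apply: fe.
Qed.

Lemma prop_D_classified : prop_D e 4 -> 0 < #|T| -> classified e.
Proof.
move=> De /card_gt0P[x _].
have [||||||[k k1 B]|[i [mu [nu [i2 B]]]]] := @twin_free_classified _ e'.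
- by move=> ? ?; apply: e_sym.
- by move=> ?; apply: e_irr.
- exact: reprs_mtf.
- exact: reprs_prop_D.
- exact: reprs_twin_free.
- by apply/card_gt0P; exists (to_repr x).
- by left; exists k => //; apply: reprs_blowup.
by right; exists i, mu, nu; split=> //; apply: reprs_blowup.
Qed.

End Twins.

Theorem theorem1p2 (T : finType) (e : rel T) :
  simple_graph e -> 0 < #|T| -> maximal_triangle_free e ->
  (prop_D e 4 <->
     (exists2 k : nat, 1 <= k & blowup e (@andrasfai_rel k)) \/
     (exists i : nat, exists mu nu : bool,
        2 <= i /\ blowup_on e (@vega_rel i) (vega_set i mu nu))).
Proof.
move=> [e_sym e_irr] T0 e_mtf; split=> [De|[[k k1 B]|[i [mu [nu [i2 B]]]]]].
- exact: (prop_D_classified e_sym e_irr e_mtf De T0).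
- exact: andrasfai_prop_D B.
exact: vega_prop_D B.
Qed.
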